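(* If $|m| \leq \frac{\sqrt{n}\log n}{\pi\sqrt{6}}$, we have as $n\to\infty$ $$N(m,n)=\frac{\beta}{4}\operatorname{sech}^2\left(\frac{\beta m}{2}\right) p(n)\left(1+O\left(\beta^{\frac12}|m|^{\frac13}\right)\right),$$ where $\beta:=\frac{\pi}{\sqrt{6n}}$.
   Context: A partition of $n$ is a non-increasing sequence of natural numbers (positive integers) whose sum is $n$; $p(n)$ is the number of partitions of $n$. The rank of a partition is its largest part minus the number of its parts. For an integer $m$, $N(m,n)$ denotes the number of partitions of $n$ with rank $m$.
   Formalization: In the error term |m| is replaced by max(|m|,1); this changes only m = 0, where the literal error O(0) would force N(0,n) = (β/4)p(n) exactly, which is impossible because β is irrational. *)

(* Defs.v *)
From HB Require Import structures.
From mathcomp Require Import all_boot all_order all_algebra.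
From mathcomp Require Import all_classical all_reals all_analysis.

Set Implicit Arguments.
Unset Strict Implicit.
Unset Printing Implicit Defensive.

Import Order.TTheory GRing.Theory Num.Theory.

Definition is_partition (n : nat) (s : seq nat) : bool :=
  [&& sorted geq s, all (leq 1) s & sumn s == n].

Definition rank (s : seq nat) : int :=
  ((\max_(x <- s) x)%:Z - (size s)%:Z)%R.

(* A partition of n has at most n parts, each at most n, so the partitions of n
   form a subset of the finite type of sequences of length at most n over
   {0, ..., n}; [partition_bseq] below shows that none is lost. *)
Definition bounded_seq (n : nat) := n.-bseq 'I_n.+1.

Definition parts (n : nat) (b : bounded_seq n) : seq nat :=
  [seq nat_of_ord i | i <- b].

Definition partitions (n : nat) : {set bounded_seq n} :=
  [set b | is_partition n (parts b)].

Definition p (n : nat) : nat := #|partitions n|.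

Definition N (m : int) (n : nat) : nat :=
  #|[set b in partitions n | rank (parts b) == m]|.

Lemma parts_inj (n : nat) : injective (@parts n).
Proof. by move=> b c /(inj_map val_inj) /val_inj. Qed.

Lemma partition_bseq (n : nat) (s : seq nat) :
  is_partition n s -> exists2 b, b \in partitions n & parts b = s.
Proof.
move=> s_n; have /and3P[_ s_pos /eqP s_sum] := s_n.
have size_s : size s <= n.
  rewrite -s_sum; elim: s s_pos {s_n s_sum} => //= x s IHs /andP[x1 /IHs].
  rewrite -add1n.
  exact: leq_add.
have s_le : all (fun x => x < n.+1) s.
  rewrite -s_sum; apply/allP => x; rewrite ltnS.
  elim: s {s_n s_pos s_sum size_s} => //= y s IHs; rewrite inE.
  by case/predU1P=> [->|/IHs/leq_trans->//]; rewrite ?leq_addr ?leq_addl.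
have valK : [seq nat_of_ord i | i <- [seq (inord x : 'I_n.+1) | x <- s]] = s.
  rewrite -map_comp -[RHS]map_id; apply/eq_in_map => x /(allP s_le) x_n /=.
  exact: inordK.
have size_i : size [seq (inord x : 'I_n.+1) | x <- s] <= n by rewrite size_map.
by exists (Bseq size_i); rewrite ?inE /parts /= valK.
Qed.

Local Open Scope ring_scope.

Definition sech (R : realType) (x : R) : R := 2 / (expR x + expR (- x)).

Definition beta (R : realType) (n : nat) : R := pi / Num.sqrt (6 * n%:R).

(* Main.v *)
Require Import Defs.
From HB Require Import structures.
From mathcomp Require Import all_boot all_order all_algebra.
From mathcomp Require Import all_classical all_reals all_analysis.
From mathcomp Require Import complex ring lra zify.

Set Implicit Arguments.
Unset Strict Implicit.
Unset Printing Implicit Defensive.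

Import Order.TTheory GRing.Theory Num.Theory.

(** Why the theorem holds.  Write P(q) for the generating function of
    partitions, b for beta and h for the square root of b.

    Dyson's map removes the first column of a partition, of length l say, and
    adds a row of length l + r + 1.  It turns the partitions of n - r - 1 of rank
    at most r + 2 into the partitions of n of rank at least r
    ([count_rank_dyson]).  Passing to the complement, if A_r P generates the
    partitions of rank at least r, then A_r = q^(r+1) (1 - A_(r+3)); the
    partitions of rank at most -r obey the same recursion, so that N(m, n) is
    for both signs of m the coefficient of q^n in P (A_|m| - A_(|m|+1))
    ([coef_rank_poly], [N_rank_recursion]).

    Let q = exp(- b + i t).  As A_r varies slowly with r, the functional equation
    forces A_r to be close to 1 / (1 + q^(-r-1)).  With a first order correction
    ([profile]) the equation holds up to O(b^2), and as its iteration contracts,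
    for |t| <= b one gets A_m - A_(m+1) = b/4 sech(b m / 2)^2 with the relative
    error O(h + |t| / b + m |t|) ([rank_series_diff]).

    Hence N(m, n) - b/4 sech(b m / 2)^2 p(n) is a coefficient of P times a
    function that is small near t = 0.  The ratio P(q) / P(exp(- b)) is the
    characteristic function [size_char] of the size of a random partition whose
    multiplicities are independent geometric variables.  It decays like
    exp(- c t^2 / b^3) ([size_char_bound]), so only |t| of order b^(3/2) counts,
    and the difference is
      O(b/4 sech(b m / 2)^2 (h + m h^3) h^3 P(exp(- b)) exp(n b)).
    On the other side p(n) is at least a constant times h^3 P(exp(- b)) exp(n b)
    ([sum_Re_size_char_ge]).  This is a local limit theorem for the random size,
    whose size_mean is n + O(1 / b) ([size_mean_near]) because zeta(2) = pi^2 / 6, and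
    whose variance is of order b^(-3).  The two bounds have the unknown factor
    P(exp(- b)) exp(n b) in common, so that no asymptotic formula for p(n) enters.
    The quotient has relative error O(h + m h^3), and m h^3 <= h m^(1/3) because
    the range of m keeps m h^3 bounded ([error_terms_le]).

    Coefficients are extracted by averaging over 2 L + 1 equally spaced points of
    a circle, which is exact for polynomials ([coef_dft]); accordingly P is
    replaced by a finite product of finite geometric sums, and A_r by the
    iterates of its recursion. *)


(** * Partitions of given rank and Dyson's map *)

(** A duplicate-free list of plain sequences: counting on it lets maps between
    partitions of different integers be written on sequences. *)
Definition partition_list (n : nat) : seq (seq nat) :=
  [seq parts b | b in partitions n].

Definition count_partitions (P : pred (seq nat)) (n : nat) : nat :=
  count P (partition_list n).

Lemma mem_partition_list n s : (s \in partition_list n) = is_partition n s.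
Proof.
apply/fintype.imageP/idP => [[b]|/partition_bseq[b bP <-]]; last by exists b.
by rewrite inE => bP ->.
Qed.

Lemma uniq_partition_list n : uniq (partition_list n).
Proof. by rewrite map_inj_uniq ?enum_uniq//; exact: parts_inj. Qed.

Lemma card_partitions (P : pred (seq nat)) n :
  #|[set b in partitions n | P (parts b)]| = count_partitions P n.
Proof.
rewrite /count_partitions /partition_list /image_mem count_map cardE -size_filter.
apply/perm_size/uniq_perm; [exact: enum_uniq|exact/filter_uniq/enum_uniq|].
by move=> b; rewrite mem_enum !inE mem_filter /= mem_enum !inE andbC.
Qed.

Lemma count_partitions_le (P P' : pred (seq nat)) n n' (f g : seq nat -> seq nat) :
  (forall s, is_partition n s -> P s ->
     [/\ is_partition n' (f s), P' (f s) & g (f s) = s]) ->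
  count_partitions P n <= count_partitions P' n'.
Proof.
move=> fP; rewrite /count_partitions -!size_filter -(size_map f).
apply: uniq_leq_size.
  rewrite map_inj_in_uniq ?filter_uniq ?uniq_partition_list// => s t.
  rewrite !mem_filter !mem_partition_list => /andP[Ps sn] /andP[Pt tn] fst.
  by have [_ _ <-] := fP s sn Ps; have [_ _ <-] := fP t tn Pt; rewrite fst.
move=> _ /mapP[s + ->]; rewrite !mem_filter !mem_partition_list => /andP[Ps sn].
by have [-> ->] := fP s sn Ps.
Qed.

Lemma count_partitions_bij (P P' : pred (seq nat)) n n' (f g : seq nat -> seq nat) :
  (forall s, is_partition n s -> P s ->
     [/\ is_partition n' (f s), P' (f s) & g (f s) = s]) ->
  (forall s, is_partition n' s -> P' s ->
     [/\ is_partition n (g s), P (g s) & f (g s) = s]) ->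
  count_partitions P n = count_partitions P' n'.
Proof. by move=> /count_partitions_le H1 /count_partitions_le H2; apply/eqP; rewrite eqn_leq H1. Qed.

Lemma bigmax_sorted s : sorted geq s -> \max_(y <- s) y = head 0 s.
Proof.
elim: s => [|x s IHs] xs /=; first by rewrite big_nil.
rewrite big_cons IHs ?(path_sorted xs)//; apply/maxn_idPl.
by case: s xs {IHs} => //= y s /andP[].
Qed.

Lemma rank_sorted s : sorted geq s -> rank s = ((head 0 s)%:Z - (size s)%:Z)%R.
Proof. by move=> ss; rewrite /rank bigmax_sorted. Qed.

(** The new row has length [size s + r + 1]; removing the column and the possibly
    empty row leaves zeros, which the filter deletes. *)
Definition dyson (r : int) (s : seq nat) : seq nat :=
  [seq x <- `|((size s)%:Z + r + 1)%R|%N :: [seq x.-1 | x <- s] | 0 < x].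

(** The first row has length [l + r + 1], where [l] is the length of the column
    that was removed, so [l] can be read off from it; padding with zeros up to
    length [l] recovers the rows that had become empty. *)
Definition dyson_inv (r : int) (s : seq nat) : seq nat :=
  let l := `|((head 0 s)%:Z - r - 1)%R|%N in
  [seq x.+1 | x <- behead s ++ nseq (l - size (behead s)) 0].

(** In a non-increasing sequence the zeros come last. *)
Lemma sorted_filter_pos s : sorted geq s ->
  [seq x <- s | 0 < x] ++ nseq (size s - size [seq x <- s | 0 < x]) 0 = s.
Proof.
elim: s => //= -[|x] s IHs xs; last by rewrite /= subSS IHs ?(path_sorted xs).
have s0 : s = nseq (size s) 0.
  apply/all_pred1P/allP => y ys /=.
  by have /allP/(_ _ ys) := order_path_min (rev_trans leq_trans) xs; rewrite /= leqn0.
have -> : [seq x <- s | 0 < x] = [::] by rewrite s0; elim: (size s).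
by rewrite /= {2}s0.
Qed.

Lemma sumn_filter_pos s : sumn [seq x <- s | 0 < x] = sumn s.
Proof. by elim: s => //= -[|x] s /= ->. Qed.

Lemma sumn_pred s : all (leq 1) s -> sumn [seq x.-1 | x <- s] + size s = sumn s.
Proof. by elim: s => //= -[|x] s IHs //= /IHs <-; lia. Qed.

Lemma sumn_succ s : sumn [seq x.+1 | x <- s] = sumn s + size s.
Proof. by elim: s => //= x s ->; lia. Qed.

Lemma map_predK s : all (leq 1) s -> [seq x.+1 | x <- [seq x.-1 | x <- s]] = s.
Proof. by elim: s => //= -[|x] s IHs //= /IHs ->. Qed.

(** The new row [size s + r + 1] fits on top because the rank of [s] is at most
    [r + 2]: it is at least the first part minus 1.  As at most [size s] other rows
    remain, the rank of the result is at least [r]. *)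
Lemma dyson_spec (r : int) n n' s : (n'%:Z = n%:Z + r + 1)%R ->
  is_partition n s -> (rank s <= r + 2)%R ->
  [/\ is_partition n' (dyson r s), (rank (dyson r s) >= r)%R & dyson_inv r (dyson r s) = s].
Proof.
move=> n'E /and3P[ss s1 /eqP sn]; rewrite rank_sorted// => rs.
have vE : (`|((size s)%:Z + r + 1)%R|%N%:Z = (size s)%:Z + r + 1)%R.
  case: s ss s1 sn rs => [|x s] /= ss s1 sn rs; first by lia.
  by case/andP: s1 => x1 _; lia.
set v := `|((size s)%:Z + r + 1)%R|%N in vE *.
set t := v :: [seq x.-1 | x <- s].
have tE : t = v :: [seq x.-1 | x <- s] by [].
have st : sorted geq t.
  rewrite /t; clear t tE; clearbody v.
  case: s ss s1 sn rs vE => [|x s] //= ss s1 sn rs vE.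
  apply/andP; split; first by lia.
  apply: (homo_path (f := predn) _ ss) => a c /=; lia.
have sumt : sumn t = n'.
  by have := sumn_pred s1; rewrite /t /=; lia.
have sft := sorted_filter_pos st.
rewrite -/t.
have sf : sorted geq (dyson r s).
  apply: (sorted_filter (rev_trans leq_trans)); exact: st.
split.
- apply/and3P; split=> //; first by apply/allP => x; rewrite mem_filter => /andP[].
  by rewrite sumn_filter_pos; apply/eqP.
- rewrite rank_sorted//.
  rewrite /dyson -/v.
  rewrite -/t; clearbody t; clear sf; case: v vE tE => [|v] vE tE.
    have s0 : [seq x.-1 | x <- s] = nseq (size s) 0.
      rewrite -[in RHS](size_map predn); apply/all_pred1P/allP => y ys /=.
      move: st; rewrite tE => /(order_path_min (rev_trans leq_trans)) /allP/(_ _ ys).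
      by rewrite /= leqn0.
    rewrite tE s0 /=; have -> : [seq x <- nseq (size s) 0 | 0 < x] = [::] by elim: (size s).
    by move=> /=; lia.
  have := count_size (fun x => 0 < x) [seq x.-1 | x <- s].
  by rewrite size_map -size_filter tE /=; lia.
- rewrite /dyson_inv.
  have hv : head 0 (dyson r s) = v.
    have : head 0 ([seq x <- t | 0 < x] ++ nseq (size t - size [seq x <- t | 0 < x]) 0) = v.
      by rewrite sft.
    by rewrite /dyson -/v -/t; case: [seq x <- t | 0 < x] => //=; case: (size t).
  rewrite hv; have -> : `|(v%:Z - r - 1)%R|%N = size s by clear tE sft; clearbody v; lia.
  rewrite -[RHS](map_predK s1); congr map.
  have -> : [seq x.-1 | x <- s] = behead t by [].
  rewrite -sft /dyson -/v -/t.
  have szt : size t = (size s).+1 by rewrite /t /= size_map.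
  case E : [seq x <- t | 0 < x] => [|y u] /=.
    by rewrite size_map subn0.
  by rewrite size_map subSS.
Qed.

Lemma dyson_inv_spec (r : int) n n' s : (n'%:Z = n%:Z + r + 1)%R ->
  is_partition n' s -> (r <= rank s)%R ->
  [/\ is_partition n (dyson_inv r s), (rank (dyson_inv r s) <= r + 2)%R & dyson r (dyson_inv r s) = s].
Proof.
move=> n'E /and3P[ss s1 /eqP sn]; rewrite rank_sorted// => rs.
have lE : (`|((head 0 s)%:Z - r - 1)%R|%N%:Z = (head 0 s)%:Z - r - 1)%R.
  case: s ss s1 sn rs => [|x s] /= ss s1 sn rs; first by lia.
  by case/andP: s1 => x1 _; lia.
rewrite /dyson_inv; set l := `|((head 0 s)%:Z - r - 1)%R|%N in lE *.
have lb : size (behead s) <= l.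
  by clearbody l; rewrite size_behead; case: s ss s1 sn rs lE => [|x s] /=; lia.
set t := behead s ++ nseq (l - size (behead s)) 0.
have szt : size t = l by rewrite /t size_cat size_nseq subnKC.
have st : sorted geq (head 0 s :: t).
  rewrite /t; clear t szt; clearbody l.
  case: s ss {s1 sn rs lE lb} => [|x s] /= ss.
    by elim: (l - 0) => //= -[|?].
  rewrite cat_path ss /=; elim: (l - size s) (last x s) => //= k IH y.
have sumt : sumn t + head 0 s = n'.
  rewrite /t sumn_cat sumn_nseq mul0n addn0 -sn.
  by case: (s) => //= x u; rewrite addnC.
have sst : sorted geq [seq x.+1 | x <- t].
  by apply: (homo_sorted (f := succn) (e := geq)); [move=> a c|exact: path_sorted st].
split.
- apply/and3P; split=> //; first by apply/allP => x /mapP[y _ ->].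
  rewrite sumn_succ szt; apply/eqP; clearbody t l.
  by move: (sumn t) (head 0 s) n'E lE sumt; clear; lia.
- rewrite rank_sorted// size_map szt.
  have : head 0 [seq x.+1 | x <- t] <= (head 0 s).+1.
    by case: (t) st => //= y u /andP[].
  by clearbody l; move: (head 0 s) (head 0 _) lE; clear; lia.
- rewrite /dyson size_map szt -map_comp map_id_in//.
  have -> : `|(l%:Z + r + 1)%R|%N = head 0 s by clearbody l; move: (head 0 s) lE; clear; lia.
  have fz k : [seq x <- nseq k 0 | 0 < x] = [::] by elim: k.
  rewrite /t; clear t szt st sumt sst; clearbody l.
  case: s s1 {ss sn rs lE lb} => [|x s] /= s1; first by rewrite fz.
  case/andP: s1 => -> s1; rewrite filter_cat fz cats0; congr cons.
  by apply/all_filterP.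
Qed.

Lemma count_rank_dyson (r : int) n n' : (n'%:Z = n%:Z + r + 1)%R ->
  count_partitions (fun s => rank s <= r + 2)%R n =
  count_partitions (fun s => r <= rank s)%R n'.
Proof.
move=> n'E; apply: (@count_partitions_bij _ _ _ _ (dyson r) (dyson_inv r)) => s.
  exact: dyson_spec.
exact: dyson_inv_spec.
Qed.

(** * Recursions for rank counts, and generating polynomials *)

Definition rank_ge (s n : nat) := count_partitions (fun l => s%:Z <= rank l)%R n.
Definition rank_le (s n : nat) := count_partitions (fun l => rank l <= - s%:Z)%R n.

(** The common recursion of the counts of partitions with rank at least r and
    with rank at most - r, which determines them. *)
Definition rank_recursion (G : nat -> nat -> nat) :=
  [/\ forall r n, r < n -> G r n + G (r + 3) (n - r.+1) = p (n - r.+1),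
      forall r n, 0 < n <= r -> G r n = 0 &
      forall r, G r.+1 0 = 0].

Lemma count_partitionsT n : count_partitions predT n = p n.
Proof.
rewrite -card_partitions; apply: eq_card => b; by rewrite !inE andbT.
Qed.

Lemma count_partitionsC P n :
  count_partitions P n + count_partitions (predC P) n = p n.
Proof. by rewrite -count_partitionsT /count_partitions count_predC count_predT. Qed.

Lemma eq_count_partitions P P' n :
  (forall s, is_partition n s -> P s = P' s) ->
  count_partitions P n = count_partitions P' n.
Proof.
by move=> PP'; apply: eq_in_count => s; rewrite mem_partition_list; exact: PP'.
Qed.

Lemma count_partitions0 P n : (forall s, is_partition n s -> ~~ P s) ->
  count_partitions P n = 0.
Proof.
move=> PF; rewrite (@eq_count_partitions _ pred0) ?/count_partitions ?count_pred0//.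
by move=> s /PF/negbTE.
Qed.

Lemma size_le_sumn s : all (leq 1) s -> size s <= sumn s.
Proof. by elim: s => //= x s IHs /andP[x1 /IHs]; lia. Qed.

(** Dyson's map followed by passing to the complement. *)
Lemma rank_ge_recursion : rank_recursion rank_ge.
Proof.
split=> [r n rn|r n /andP[n0 nr]|r].
- rewrite /rank_ge -(@count_rank_dyson r%:Z (n - r.+1)); last by lia.
  rewrite -(count_partitionsC (fun s => rank s <= r%:Z + 2)%R); congr addn.
  by apply: eq_count_partitions => s _ /=; lia.
- apply: count_partitions0 => -[|x s] /and3P[ss s1 /eqP sn].
    by move: sn n0 => /= <-.
  by rewrite rank_sorted//=; move: sn => /=; lia.
- apply: count_partitions0 => -[|x s] /and3P[ss s1 /eqP sn]; first by rewrite rank_sorted.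
  by move: s1 sn => /= /andP[]; lia.
Qed.

(** The same map read backwards: rank at most - r becomes rank at least
    - r - 2, whose complement is rank at most - (r + 3). *)
Lemma rank_le_recursion : rank_recursion rank_le.
Proof.
split=> [r n rn|r n /andP[n0 nr]|r].
- rewrite /rank_le addnC -(count_partitionsC (fun s => rank s <= - (r + 3)%:Z)%R).
  congr addn; rewrite [RHS](@eq_count_partitions _ (fun s => (- r%:Z - 2) <= rank s)%R); last first.
    by move=> s _ /=; lia.
  rewrite -(@count_rank_dyson _ n); last by lia.
  by apply: eq_count_partitions => s _; lia.
- apply: count_partitions0 => -[|x s] /and3P[ss s1 /eqP sn].
    by move: sn n0 => /= <-.
  by rewrite rank_sorted//=; have := size_le_sumn s1; move: s1 sn => /= /andP[]; lia.
- apply: count_partitions0 => -[|x s] /and3P[ss s1 /eqP sn]; first by rewrite rank_sorted.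
  by move: s1 sn => /= /andP[]; lia.
Qed.

Lemma count_partitionsU (P P1 P2 : pred (seq nat)) n :
  (forall s, P s = P1 s || P2 s) -> (forall s, ~~ (P1 s && P2 s)) ->
  count_partitions P n = count_partitions P1 n + count_partitions P2 n.
Proof.
move=> PE P0; rewrite /count_partitions -count_predUI.
rewrite (@eq_count _ (predI P1 P2) pred0) ?count_pred0 ?addn0.
  exact: eq_count.
by move=> s; apply/negbTE; exact: P0.
Qed.

Lemma N_count_partitions m n : N m n = count_partitions (fun s => rank s == m) n.
Proof. exact: (card_partitions (fun s => rank s == m)). Qed.

(** For negative m the partitions of rank at most m take the role of those of
    rank at least m, which replaces an appeal to conjugation. *)
Lemma N_rank_recursion (m : int) :
  exists2 G, rank_recursion G & forall n, G `|m|%N n = N m n + G `|m|%N.+1 n.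
Proof.
have [m0|m0] := lerP 0%R m.
- exists rank_ge; first exact: rank_ge_recursion.
  move=> n; rewrite N_count_partitions; apply: count_partitionsU => s; lia.
- exists rank_le; first exact: rank_le_recursion.
  move=> n; rewrite N_count_partitions; apply: count_partitionsU => s; lia.
Qed.

Section PartitionPoly.
Local Open Scope ring_scope.

Definition partition_poly (F : comNzRingType) (K J : nat) : {poly F} :=
  \prod_(k < K) \sum_(l < J.+1) 'X^(k.+1 * l).

Local Open Scope nat_scope.

Lemma sumn_count_mem K s : all (fun x => 0 < x <= K) s ->
  \sum_(k < K) k.+1 * count_mem k.+1 s = sumn s.
Proof.
elim: s => [|x s IHs] /=; first by rewrite big1// => k _; rewrite muln0.
move=> /andP[/andP[x0 xK] /IHs <-].
under eq_bigr do rewrite mulnDr.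
rewrite big_split /=; congr addn.
case: x x0 xK => // x _ xK.
rewrite (bigD1 (Ordinal xK)) //= eqxx muln1 big1 ?addn0// => k kx.
case: eqP => [[xk]|]; last by rewrite muln0.
by case/eqP: kx; apply/val_inj.
Qed.

Definition multiplicities K J (s : seq nat) : {ffun 'I_K -> 'I_J.+1} :=
  [ffun k : 'I_K => inord (count_mem k.+1 s)].

Definition of_multiplicities K J (f : {ffun 'I_K -> 'I_J.+1}) : seq nat :=
  sort geq (flatten [seq nseq (f k) (val k).+1 | k <- enum 'I_K]).

Lemma partition_bounds n s : is_partition n s -> all (fun x => 0 < x <= n) s /\ size s <= n.
Proof.
move=> /and3P[_ s1 /eqP <-]; split; last exact: size_le_sumn.
apply/allP => x xs; rewrite (allP s1)//=.
by elim: s xs {s1} => //= y s IHs; rewrite inE => /predU1P[->|/IHs]; lia.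
Qed.

Lemma count_of_multiplicities K J (f : {ffun 'I_K -> 'I_J.+1}) (k : 'I_K) :
  count_mem k.+1 (of_multiplicities f) = f k.
Proof.
rewrite /of_multiplicities count_sort count_flatten -map_comp sumnE big_map big_enum /=.
rewrite (bigD1 k)//= count_nseq /= eqxx mul1n big1 ?addn0// => j jk.
rewrite count_nseq /= eqSS; case: eqP => //.
by move=> /val_inj jk'; rewrite jk' eqxx in jk.
Qed.

Lemma all_of_multiplicities K J (f : {ffun 'I_K -> 'I_J.+1}) :
  all (fun x => 0 < x <= K) (of_multiplicities f).
Proof.
rewrite /of_multiplicities all_sort; apply/allP => x /flattenP[_ /mapP[k _ ->]].
by rewrite mem_nseq => /andP[_ /eqP ->]; rewrite /= ltn_ord.
Qed.

(** A partition is determined by the multiplicities of its parts. *)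
Lemma p_multiplicities K J n : n <= K -> n <= J ->
  p n = #|[set f : {ffun 'I_K -> 'I_J.+1} | \sum_(k < K) k.+1 * f k == n]|.
Proof.
move=> nK nJ; rewrite -count_partitionsT /count_partitions count_predT cardE.
rewrite -(size_map (multiplicities K J)); apply/perm_size/uniq_perm.
- rewrite map_inj_in_uniq ?uniq_partition_list// => s t.
  rewrite !mem_partition_list => sn tn /ffunP st.
  have [sb ss] := partition_bounds sn; have [tb ts] := partition_bounds tn.
  have/and3P[sso _ _] := sn; have/and3P[tso _ _] := tn.
  apply: (sorted_eq (rev_trans leq_trans) _ sso tso); first by move=> a c; lia.
  rewrite /perm_eq; apply/allP => x; rewrite mem_cat => xst.
  have xb : 0 < x <= n by case/orP: xst; [exact: (allP sb)|exact: (allP tb)].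
  case: x xb {xst} => // x xn; have xK : x < K by lia.
  have := st (Ordinal xK); rewrite !ffunE => /(congr1 val) /=.
  by rewrite !inordK ?ltnS; [move=> /eqP|apply: leq_trans (count_size _ _) _; lia..].
- exact: enum_uniq.
move=> f; rewrite mem_enum inE; apply/mapP/idP => [[s]|/eqP fn].
  rewrite mem_partition_list => sn ->; have [sb ss] := partition_bounds sn.
  have /and3P[_ _ /eqP sE] := sn.
  rewrite -[n in _ == n]sE -(@sumn_count_mem K); last first.
    by apply: sub_all sb => x; lia.
  apply/eqP/eq_bigr => k _; rewrite ffunE inordK// ltnS.
  exact: leq_trans (count_size _ _) (leq_trans ss nJ).
exists (of_multiplicities f).
  rewrite mem_partition_list; apply/and3P; split.
  - by apply: sort_sorted => x y; rewrite /geq /= leq_total.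
  - by apply: sub_all (all_of_multiplicities f) => x /andP[].
  - rewrite -(sumn_count_mem (all_of_multiplicities f)) -[X in _ == X]fn; apply/eqP.
    by apply: eq_bigr => k _; rewrite count_of_multiplicities.
by apply/ffunP => k; rewrite ffunE count_of_multiplicities inord_val.
Qed.

Local Open Scope ring_scope.

Lemma coef_partition_poly (F : comNzRingType) K J n : (n <= K)%N -> (n <= J)%N ->
  (partition_poly F K J)`_n = (p n)%:R.
Proof.
move=> nK nJ; rewrite /partition_poly bigA_distr_bigA /= (p_multiplicities nK nJ).
rewrite coef_sum -sum1_card natr_sum big_mkcond /=.
rewrite [RHS]big_mkcond /=; apply: eq_bigr => f _.
rewrite inE; have -> : \prod_(i < K) 'X^(i.+1 * f i) = 'X^(\sum_(i < K) i.+1 * f i) :> {poly F}.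
  by elim/big_rec2: _ => [|i x y _ ->]; rewrite ?expr0// exprD.
by rewrite coefXn eq_sym; case: eqP.
Qed.

End PartitionPoly.

Section RankPoly.
Local Open Scope ring_scope.

(** The i-th iterate, started from 0, of A_r = q^(r+1) (1 - A_(r+3)).  Each step
    shifts degrees by at least 1, so the coefficients up to degree i are final. *)
Fixpoint rank_poly (F : comNzRingType) (i r : nat) : {poly F} :=
  if i is i'.+1 then 'X^(r.+1) * (1 - rank_poly F i' (r + 3)) else 0.

Lemma coef_rank_poly (F : comNzRingType) G (T : {poly F}) i r n : rank_recursion G ->
  (forall l, (l <= n)%N -> T`_l = (p l)%:R) -> (0 < n <= i)%N ->
  (T * rank_poly F i r)`_n = (G r n)%:R.
Proof.
move=> [Gr G0 G00]; elim: i n r => [|i IHi] n r Tp /andP[n0 ni]; first by lia.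
rewrite /= mulrCA coefXnM ltnS; case: leqP => nr.
  by rewrite G0// n0.
have [nr0|nr0] := posnP (n - r.+1).
  rewrite nr0; have := Gr _ _ nr; rewrite nr0 addn3 G00 addn0 => ->.
  rewrite mulrBr mulr1 coefB Tp// coefM big_ord1 subn0.
  have -> : (rank_poly F i r.+3)`_0 = 0.
    by case: i {IHi ni} => [|i] /=; rewrite ?coef0// coefXnM.
  by rewrite mulr0 subr0.
rewrite mulrBr mulr1 coefB Tp ?leq_subr// IHi; last by lia.
  by rewrite -(Gr _ _ nr) natrD addrK.
by move=> l ln; apply: Tp; lia.
Qed.

End RankPoly.

Local Open Scope ring_scope.
Local Open Scope complex_scope.

(** * Complex modulus and sampled Fourier inversion *)

Section Cis.
Variable R : realType.
Implicit Types (x y t : R) (z w : R[i]).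

(** The modulus, with values in [R] so that real arithmetic applies to it. *)
Definition cabs z : R := Normc.normc z.

Lemma cabs0 : cabs 0 = 0. Proof. exact: Normc.normc0. Qed.
Lemma cabs1 : cabs 1 = 1. Proof. exact: Normc.normc1. Qed.
Lemma eq0_cabs z : cabs z = 0 -> z = 0. Proof. exact: Normc.eq0_normc. Qed.
Lemma cabsM z w : cabs (z * w) = cabs z * cabs w. Proof. exact: Normc.normcM. Qed.
Lemma cabsV z : cabs z^-1 = (cabs z)^-1. Proof. exact: Normc.normcV. Qed.

Definition cis t : R[i] := cos t +i* sin t.

Lemma cis0 : cis 0 = 1.
Proof. by rewrite /cis cos0 sin0. Qed.

Lemma cisD x y : cis (x + y) = cis x * cis y.
Proof. by rewrite /cis cosD sinD; simpc; rewrite [cos x * sin y + _]addrC. Qed.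

Lemma cisMn x n : cis (n%:R * x) = cis x ^+ n.
Proof.
elim: n => [|n IHn]; first by rewrite mul0r cis0 expr0.
by rewrite -natr1 mulrDl mul1r cisD IHn exprSr.
Qed.

Lemma cabs_cis x : cabs (cis x) = 1.
Proof. by rewrite /= cos2Dsin2 sqrtr1. Qed.

Lemma cisN x : cis (- x) = (cis x)^-1.
Proof.
have c0 : cis x != 0.
  by apply/eqP => c0; have := cabs_cis x; rewrite c0 cabs0 => /esym/eqP; rewrite oner_eq0.
by apply: (mulfI c0); rewrite -cisD subrr cis0 mulfV.
Qed.

Lemma cabs_real x : cabs x%:C = `|x|.
Proof. by rewrite /= expr0n addr0 sqrtr_sqr. Qed.

Lemma cabs_ge0 z : 0 <= cabs z.
Proof. by case: z => a c /=; exact: sqrtr_ge0. Qed.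

Lemma cabs_eq0 z : (cabs z == 0) = (z == 0).
Proof.
by apply/eqP/eqP => [/eq0_cabs|->]; rewrite ?cabs0.
Qed.

Lemma cabsX z n : cabs (z ^+ n) = cabs z ^+ n.
Proof. by elim: n => [|n IHn]; rewrite ?expr0 ?cabs1// !exprS cabsM IHn. Qed.

Lemma ler_cabsD z w : cabs (z + w) <= cabs z + cabs w.
Proof. exact: le_normcD. Qed.

Lemma cabsNE z : cabs (- z) = cabs z.
Proof. exact: normcN. Qed.

Lemma ler_cabsB z w : cabs (z - w) <= cabs z + cabs w.
Proof. by rewrite -[cabs w]cabsNE; exact: ler_cabsD. Qed.

Lemma lerB_cabs z w : cabs z - cabs w <= cabs (z + w).
Proof.
rewrite lerBlDr -[X in cabs X <= _](addrK w).
by apply: le_trans (ler_cabsB _ _) _.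
Qed.

Lemma cabs_sum (I : Type) (r : seq I) (P : pred I) (F : I -> R[i]) :
  cabs (\sum_(i <- r | P i) F i) <= \sum_(i <- r | P i) cabs (F i).
Proof.
elim/big_rec2: _ => [|i x z _ xz]; first by rewrite cabs0.
by apply: le_trans (ler_cabsD _ _) _; rewrite lerD2l.
Qed.

Lemma cabs_prod (I : Type) (r : seq I) (P : pred I) (F : I -> R[i]) :
  cabs (\prod_(i <- r | P i) F i) = \prod_(i <- r | P i) cabs (F i).
Proof. by elim/big_rec2: _ => [|i x z _ xz]; rewrite ?cabs1// cabsM xz. Qed.

Lemma Re_le_cabs z : `|complex.Re z| <= cabs z.
Proof. by case: z => a c /=; rewrite -sqrtr_sqr ler_wsqrtr// lerDl sqr_ge0. Qed.

Lemma cabs_sqr z : cabs z ^+ 2 = complex.Re z ^+ 2 + complex.Im z ^+ 2.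
Proof. by case: z => a c /=; rewrite sqr_sqrtr// addr_ge0 ?sqr_ge0. Qed.

Lemma Re_sum (I : Type) (r : seq I) (P : pred I) (F : I -> R[i]) :
  complex.Re (\sum_(i <- r | P i) F i) = \sum_(i <- r | P i) complex.Re (F i).
Proof. by elim/big_rec2: _ => // i x z _ <-; case: (F i) z => a b [c d]. Qed.

Lemma Re_realM x z : complex.Re (x%:C * z) = x * complex.Re z.
Proof. by case: z => a c /=; rewrite mul0r subr0. Qed.

End Cis.

Section DFT.
Variable R : realType.

Definition sample_mesh (L : nat) : R := 2 * pi / (2 * L + 1)%:R.
(** The points are centred: the angles lie in [-pi, pi] and 0 is among them. *)
Definition sample_angle (L j : nat) : R := (j%:R - L%:R) * sample_mesh L.

(** By 1 - cos x = 2 sin(x/2)^2. *)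
Lemma cos_lt1 (x : R) : 0 < x < 2 * pi -> cos x < 1.
Proof.
move=> /andP[x0 x2].
have : 0 < sin (x / 2) by apply: sin_gt0_pi; lra.
have xE : x = (x / 2) *+ 2 by rewrite -mulr_natr divfK.
move=> s0; rewrite {1}xE cos_mulr2n cos2sin2.
have : 0 < sin (x / 2) ^+ 2 by rewrite exprn_gt0.
lra.
Qed.

Lemma cis_neq1 (x : R) : 0 < `|x| < 2 * pi -> cis x != 1.
Proof.
move=> /cos_lt1; rewrite cos_norm => c1; apply/eqP => /(congr1 (@complex.Re _)) /= cE.
by rewrite cE ltxx in c1.
Qed.

Lemma sum_cis_sample L (l n : nat) : (l < 2 * L + 1)%N -> (n < 2 * L + 1)%N ->
  \sum_(j < 2 * L + 1) cis (l%:R * sample_angle L j) * cis (- (n%:R * sample_angle L j)) =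
  if l == n then (2 * L + 1)%:R else 0.
Proof.
move=> lM nM; case: eqP => [->|/eqP ln].
  under eq_bigr do rewrite -cisD subrr cis0.
  by rewrite sumr_const card_ord.
set M := (2 * L + 1)%N in lM nM *.
have M0 : (0 < M%:R :> R) by rewrite ltr0n /M addn1.
set w := cis ((l%:R - n%:R) * sample_mesh L).
have E (j : 'I_M) : cis (l%:R * sample_angle L j) * cis (- (n%:R * sample_angle L j)) =
    cis (- ((l%:R - n%:R) * L%:R * sample_mesh L)) * w ^+ j.
  by rewrite /w -cisMn -!cisD /sample_angle; congr cis; ring.
rewrite (eq_bigr _ (fun j _ => E j)) -mulr_sumr.
have wM : w ^+ M = 1.
  rewrite -cisMn.
  have -> : M%:R * ((l%:R - n%:R) * sample_mesh L) = l%:R * (2 * pi) - n%:R * (2 * pi).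
    by rewrite /sample_mesh -/M; field; rewrite gt_eqF.
  have c2 k : cis (k%:R * (2 * pi)) = 1 :> R[i].
    by rewrite cisMn /cis mulrC mulr_natr cos2pi sin2pi expr1n.
  by rewrite cisD c2 cisN c2 invr1 mulr1.
have w1 : w != 1.
  apply: cis_neq1; rewrite /sample_mesh -/M normrM.
  have -> : `|2 * pi / M%:R| = 2 * pi / M%:R :> R.
    by rewrite ger0_norm// divr_ge0// mulr_ge0// pi_ge0.
  rewrite mulrA ltr_pdivrMr// mulr_gt0 ?invr_gt0 ?mulr_gt0 ?pi_gt0//; last first.
    by rewrite normr_gt0 subr_eq0 eqr_nat.
  rewrite /= mulrC ltr_pM2l ?mulr_gt0 ?pi_gt0//.
  have lM' : l%:R < M%:R :> R by rewrite ltr_nat.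
  have nM' : n%:R < M%:R :> R by rewrite ltr_nat.
  have l0 : 0 <= l%:R :> R by rewrite ler0n.
  have n0 : 0 <= n%:R :> R by rewrite ler0n.
  by rewrite ltr_norml; apply/andP; split; lra.
suff -> : \sum_(j < M) w ^+ j = 0 by rewrite mulr0.
by apply: (mulfI (x := w - 1)); rewrite ?subr_eq0// mulr0 -subrX1 wM subrr.
Qed.

(** The point q = exp(- b + i t). *)
Definition qpt (b t : R) : R[i] := (expR (- b))%:C * cis t.

Lemma qptX b t k : qpt b t ^+ k = (expR (- (k%:R * b)))%:C * cis (k%:R * t).
Proof. by rewrite /qpt exprMn -cisMn -rmorphXn -expRM_natl mulrN. Qed.

Lemma cabs_qpt b t : cabs (qpt b t) = expR (- b).
Proof. by rewrite /qpt cabsM cabs_cis cabs_real mulr1 ger0_norm// expR_ge0. Qed.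

(** Orthogonality of characters; no aliasing occurs because the degree of [U] is
    below the number of points. *)
Lemma coef_dft (U : {poly R[i]}) (L n : nat) b :
  (size U <= 2 * L + 1)%N -> (n < 2 * L + 1)%N ->
  U`_n * (expR (- (n%:R * b)))%:C * (2 * L + 1)%:R =
  \sum_(j < 2 * L + 1) U.[qpt b (sample_angle L j)] * cis (- (n%:R * sample_angle L j)).
Proof.
move=> sU nM.
under eq_bigr => j _.
  rewrite (horner_coef_wide _ sU) mulr_suml.
  under eq_bigr do rewrite qptX mulrA -(mulrA _ (cis _)).
  over.
rewrite exchange_big /=; under eq_bigr do rewrite -mulr_sumr sum_cis_sample//.
rewrite (bigD1 (Ordinal nM))//= eqxx big1 ?addr0// => l ln.
by case: eqP => [lnE|]; rewrite ?mulr0//; case/eqP: ln; exact/val_inj.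
Qed.

End DFT.

(** * Elementary inequalities *)

Import numFieldNormedType.Exports.

Section Elementary.
Variable R : realType.
Implicit Types x y t : R.

Lemma ge0_of_derive (f df : R -> R) x :
  (forall y, is_derive y 1 f (df y)) -> f 0 = 0 ->
  (forall y, 0 <= y <= x -> 0 <= df y) -> 0 <= x -> 0 <= f x.
Proof.
move=> fE f0 df0; rewrite le_eqVlt => /predU1P[<-|x0]; first by rewrite f0.
have [] := @MVT R f df _ _ x0 (fun y _ => fE y).
  apply: derivable_within_continuous => y _.
  by have [] := fE y.
move=> c; rewrite in_itv/= => /andP[c0 cx]; rewrite f0 !subr0 => ->.
by rewrite mulr_ge0 ?df0 ?ltW.
Qed.

Lemma sin_le_id x : 0 <= x -> sin x <= x.
Proof.
move=> x0; rewrite -subr_ge0.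
apply: (@ge0_of_derive (fun y => y - sin y) (fun y => 1 - cos y)) => //.
by rewrite sin0 subr0.
Qed.

Lemma normr_sin_le x : `|sin x| <= `|x|.
Proof.
have H y : 0 <= y -> `|sin y| <= y.
  move=> y0; rewrite ler_norml sin_le_id// andbT -subr_ge0 opprK.
  apply: (@ge0_of_derive (fun z => sin z + z) (fun z => cos z + 1)) => //.
  by rewrite sin0 addr0.
case: (ger0P x) => x0; first exact: H.
by rewrite -normrN -sinN H// oppr_ge0 ltW.
Qed.

Lemma cos_half x : 1 - cos x = 2 * sin (x / 2) ^+ 2.
Proof.
have xE : x = (x / 2) *+ 2 by rewrite -mulr_natr divfK.
rewrite {1}xE cos_mulr2n cos2sin2; ring.
Qed.

Lemma cos_ge x : 1 - x ^+ 2 / 2 <= cos x.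
Proof.
suff : 1 - cos x <= x ^+ 2 / 2 by lra.
have : sin (x / 2) ^+ 2 <= (x / 2) ^+ 2.
  rewrite -(real_normK (num_real (sin _))) -(real_normK (num_real (x / 2))).
  by rewrite lerXn2r ?nnegrE// normr_sin_le.
rewrite cos_half; lra.
Qed.

Lemma sin_ge_cubic x : 0 <= x -> x - x ^+ 3 / 6 <= sin x.
Proof.
move=> x0; rewrite -subr_ge0.
apply: (@ge0_of_derive (fun y => sin y - (y - y ^+ 3 / 6)) (fun y => cos y - (1 - y ^+ 2 / 2))) => //.
- move=> y.
  have -> : (fun y0 : R => sin y0 - (y0 - y0 ^+ 3 / 6)) =
     sin - (id - ((1/6) *: (@GRing.exp R ^~ 3%N))).
    by apply/funext => z /=; rewrite !fctE /= mulrC mul1r.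
  apply: is_derive_eq; rewrite /= /GRing.scale /=; lra.
- by rewrite sin0 expr0n/=; lra.
- by move=> y _; have := cos_ge y; lra.
Qed.

Lemma mul_cos_le_sin x : 0 <= x <= pi -> x * cos x <= sin x.
Proof.
move=> /andP[x0 xpi]; rewrite -subr_ge0.
apply: (@ge0_of_derive (fun y => sin y - y * cos y) (fun y => y * sin y)) => //.
- move=> y; have -> : (fun y0 : R => sin y0 - y0 * cos y0) = sin - (id * cos) by [].
  by apply: is_derive_eq; rewrite /GRing.scale /=; ring.
- by rewrite sin0 mul0r subrr.
- move=> y /andP[y0 yx]; rewrite mulr_ge0// sin_ge0_pi// y0 /=.
  exact: le_trans xpi.
Qed.

Lemma sin_id_bound x : `|sin x - x| <= `|x| ^+ 3.
Proof.
have H y : 0 <= y -> `|sin y - y| <= y ^+ 3.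
  move=> y0; rewrite ler_norml.
  have := sin_le_id y0; have := sin_ge_cubic y0; have : 0 <= y ^+ 3 by rewrite exprn_ge0.
  lra.
case: (ger0P x) => x0; first exact: H.
by rewrite -normrN opprB addrC -sinN -[X in sin _ + X]opprK H// oppr_ge0 ltW.
Qed.

Lemma sin_ge_third x : 0 <= x <= 2 -> x / 3 <= sin x.
Proof.
move=> /andP[x0 x2]; apply: le_trans (sin_ge_cubic x0).
have : x ^+ 2 <= 4 by nra.
by move=> x4; rewrite exprS; nra.
Qed.

Lemma one_sub_cos_ge x : `|x| <= 4 -> x ^+ 2 / 18 <= 1 - cos x.
Proof.
move=> x4; rewrite -cos_norm -(real_normK (num_real x)) cos_half.
have := @sin_ge_third (`|x| / 2); have := normr_ge0 x; move: `|x| x4 => y y4 y0 s.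
have /s : 0 <= y / 2 <= 2 by lra.
by move: (sin _) => z; nra.
Qed.

Lemma one_sub_cos_le x : 1 - cos x <= x ^+ 2 / 2.
Proof. by have := cos_ge x; lra. Qed.

Lemma mul_cos_sub_sin x : `|x * cos x - sin x| <= 2 * `|x| ^+ 3.
Proof.
have -> : x * cos x - sin x = - (x * (1 - cos x)) - (sin x - x) by ring.
apply: le_trans (ler_normB _ _) _; have := sin_id_bound x.
rewrite normrN normrM (ger0_norm (x := 1 - _)); last by have := cos_le1 x; lra.
have := one_sub_cos_le x; rewrite -(real_normK (num_real x)).
have := normr_ge0 x; move: `|x| => y y0 c s.
have : y * (1 - cos x) <= y * (y ^+ 2 / 2) by rewrite ler_wpM2l.
have -> : y * (y ^+ 2 / 2) = y ^+ 3 / 2 by field.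
have : 0 <= y ^+ 3 by rewrite exprn_ge0.
lra.
Qed.

Lemma expR_le_inv x : x < 1 -> expR x <= (1 - x)^-1.
Proof.
move=> x1; rewrite -[expR x]invrK -expRN lef_pV2 ?posrE ?expR_gt0 ?subr_gt0//.
exact: expR_ge1Dx.
Qed.

Lemma expR_le_lin x : 0 <= x <= 1 / 2 -> expR x <= 1 + 2 * x.
Proof.
move=> /andP[x0 x2]; apply: le_trans (expR_le_inv _) _; first lra.
rewrite -[leLHS]mul1r ler_pdivrMr; nra.
Qed.

Lemma one_sub_expR_ge x : 0 <= x -> x / (1 + x) <= 1 - expR (- x).
Proof.
move=> x0; have x1 : 0 < 1 + x by lra.
suff : expR (- x) <= (1 + x)^-1.
  have -> : x / (1 + x) = 1 - (1 + x)^-1 by field; rewrite gt_eqF.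
  lra.
by rewrite expRN lef_pV2 ?posrE ?expR_gt0// expR_ge1Dx.
Qed.

Lemma expR_ge_pow x n : 0 <= x -> x ^+ n <= n`!%:R * expR x.
Proof.
move=> x0; case: n => [|n].
  by rewrite expr0 fact0 mul1r; apply: le_trans (expR_ge1Dx x); lra.
rewrite mulrC -ler_pdivrMr ?ltr0n ?fact_gt0//.
by apply: le_trans (expR_ge1Dxn n x0); rewrite lerDr.
Qed.

Lemma cabs_cis_sub1 t : cabs (cis t - 1) <= `|t|.
Proof.
rewrite -(@ler_pXn2r _ 2%N) ?nnegrE ?cabs_ge0// cabs_sqr /= real_normK ?num_real//.
have := one_sub_cos_le t; have := cos2Dsin2 t; rewrite oppr0 addr0; nra.
Qed.

Lemma cabs_expcis_sub1 x t : 0 <= x <= 1 / 2 ->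
  cabs (((expR x)%:C * cis t)%C - 1) <= 2 * (x + `|t|).
Proof.
move=> /andP[x0 x2].
have -> : ((expR x)%:C * cis t)%C - 1 = ((expR x)%:C * (cis t - 1))%C + (expR x - 1)%:C%C.
  by rewrite rmorphB /=; ring.
apply: le_trans (ler_cabsD _ _) _; rewrite cabsM !cabs_real.
have e1 : 1 <= expR x by have := expR_ge1Dx x; lra.
have e2 := @expR_le_lin x; rewrite x0 x2 in e2; have {}e2 := e2 isT.
rewrite (ger0_norm (expR_ge0 x)) (ger0_norm (x := expR x - 1)) ?subr_ge0//.
have := cabs_cis_sub1 t; have := normr_ge0 t; have := cabs_ge0 (cis t - 1).
by move: (cabs _) `|t| => u v; nra.
Qed.

End Elementary.

(** * The rank series close to q = 1 *)

#[local] Hint Extern 0 (is_true (0 <= cabs _)) => exact: cabs_ge0 : core.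

Section Profile.
Variable R : realType.
Implicit Types (y e a c : R[i]).

(** The approximation of A_r at y = q^(-r-1), with e = q^(-3) - 1.  The solution of
    y A + A = 1 is 1 / (1 + y); the second term is the first order effect of
    the shift from r to r + 3, which multiplies y by 1 + e. *)
Definition profile e y : R[i] := (1 + y)^-1 + e * y * (1 + y) ^- 3.

Lemma cabsM_le a c (u v : R) : cabs a <= u -> cabs c <= v -> cabs (a * c) <= u * v.
Proof. by move=> au cv; rewrite cabsM ler_pM. Qed.

Lemma cabsD_le a c (u v : R) : cabs a <= u -> cabs c <= v -> cabs (a + c) <= u + v.
Proof. by move=> au cv; apply: le_trans (ler_cabsD _ _) _; rewrite lerD. Qed.

Lemma cabsB_le a c (u v : R) : cabs a <= u -> cabs c <= v -> cabs (a - c) <= u + v.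
Proof. by move=> au cv; apply: le_trans (ler_cabsB _ _) _; rewrite lerD. Qed.

(** Both points lie outside the unit disc and stay away from the pole -1 of the
    profile. *)
Definition away (y y' : R[i]) :=
  [/\ 1 <= cabs y, cabs y <= cabs y', cabs y <= 2 * cabs (1 + y) &
      cabs y' <= 2 * cabs (1 + y')].

Section Bounds.
Variables (y y' e : R[i]).
Hypothesis G : away y y'.

Let y_gt0 : 0 < cabs y.
Proof. by case: G => g1 _ _ _; apply: lt_le_trans g1. Qed.

Lemma one_plus_y_neq0 : 1 + y != 0.
Proof. by case: G => g1 g2 g3 g4; rewrite -cabs_eq0 gt_eqF//; lra. Qed.

Lemma one_plus_y_neq0' : 1 + y' != 0.
Proof. by case: G => g1 g2 g3 g4; rewrite -cabs_eq0 gt_eqF//; lra. Qed.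

Lemma cabs_inv_1Dy : cabs (1 + y)^-1 <= 2 * (cabs y)^-1.
Proof.
case: G => g1 g2 g3 g4.
rewrite cabsV -[2]invrK -invfM lef_pV2 ?posrE ?mulr_gt0 ?invr_gt0//; lra.
Qed.

Lemma cabs_inv_1Dy' : cabs (1 + y')^-1 <= 2 * (cabs y)^-1.
Proof.
case: G => g1 g2 g3 g4.
rewrite cabsV -[2]invrK -invfM lef_pV2 ?posrE ?mulr_gt0 ?invr_gt0//; lra.
Qed.

Lemma inv_cabs_le1 : (cabs y)^-1 <= 1.
Proof. by case: G => g1 _ _ _; rewrite invf_le1. Qed.

Lemma cabs_inv_1Dy_le2 : cabs (1 + y)^-1 <= 2.
Proof. by have := inv_cabs_le1; have := cabs_inv_1Dy; lra. Qed.

Lemma cabs_inv_1Dy'_le2 : cabs (1 + y')^-1 <= 2.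
Proof. by have := inv_cabs_le1; have := cabs_inv_1Dy'; lra. Qed.

Lemma cabs_y_inv_1Dy : cabs (y * (1 + y)^-1) <= 2.
Proof.
rewrite cabsM; apply: le_trans (_ : cabs y * (2 * (cabs y)^-1) <= _).
  by rewrite ler_wpM2l// cabs_inv_1Dy.
by rewrite mulrCA divff ?mulr1// gt_eqF.
Qed.

Lemma cabs_y_inv_1Dy' : cabs (y * (1 + y')^-1) <= 2.
Proof.
rewrite cabsM; apply: le_trans (_ : cabs y * (2 * (cabs y)^-1) <= _).
  by rewrite ler_wpM2l// cabs_inv_1Dy'.
by rewrite mulrCA divff ?mulr1// gt_eqF.
Qed.

Lemma profile_le : cabs e <= 1 -> cabs (profile e y) <= 10 * (cabs y)^-1.
Proof.
move=> e1; rewrite /profile.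
set a := (1 + y)^-1.
have -> : e * y * (1 + y) ^- 3 = e * (y * a) * (a * a).
  by rewrite /a; field; exact: one_plus_y_neq0.
have h1 := cabs_inv_1Dy; have h2 := cabs_inv_1Dy_le2; have h3 := cabs_y_inv_1Dy.
apply: le_trans (cabsD_le h1 (cabsM_le (cabsM_le e1 h3) (cabsM_le h1 h2))) _.
lra.
Qed.

(** The correction term was chosen to cancel the terms of order e: what
    remains has an explicit factor e^2. *)
Lemma profile_defect : y' = y * (1 + e) ->
  cabs (y * profile e y + profile e y' - 1) <= 64 * cabs e ^+ 2.
Proof.
move=> y'E; rewrite /profile.
set a := (1 + y)^-1; set c := (1 + y')^-1.
have -> : y * (a + e * y * (1 + y) ^- 3) + (c + e * y' * (1 + y') ^- 3) - 1 =
   e * e * ((y * a) * (y * c) * (a - (a * a + a * c + c * c)) + (y * c) * (c * c)).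
  rewrite /a /c; have := one_plus_y_neq0'; rewrite {}y'E => h'; field.
  by rewrite one_plus_y_neq0 h'.
have h2 := cabs_inv_1Dy_le2; have h3 := cabs_y_inv_1Dy.
have h2' := cabs_inv_1Dy'_le2; have h3' := cabs_y_inv_1Dy'.
rewrite -/a in h2 h3; rewrite -/c in h2' h3'.
rewrite cabsM cabsM -expr2 mulrC ler_wpM2r ?exprn_ge0//.
apply: le_trans (cabsD_le (cabsM_le (cabsM_le h3 h3') (cabsB_le h2
  (cabsD_le (cabsD_le (cabsM_le h2 h2) (cabsM_le h2 h2')) (cabsM_le h2' h2'))))
  (cabsM_le h3' (cabsM_le h2' h2'))) _.
lra.
Qed.

(** With y' = y (1 + d) the main term of the difference is d y / (1 + y)^2, the
    derivative of the logistic function, from which sech^2 comes. *)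
Lemma profile_diff d : y' = y * (1 + d) ->
  cabs (profile e y - profile e y' - d * (y * (1 + y) ^- 2)) <=
  (56 * cabs e * cabs d + 8 * cabs d ^+ 2) * (cabs y)^-1.
Proof.
move=> y'E; rewrite /profile.
set a := (1 + y)^-1; set c := (1 + y')^-1.
have -> : a + e * y * (1 + y) ^- 3 - (c + e * y' * (1 + y') ^- 3) - d * (y * (1 + y) ^- 2) =
   e * d * (((y * a) * (y * c)) * (a * a + a * c + c * c) - (y * c) * (c * c))
    - d * d * ((y * a) * (y * a) * c).
  rewrite /a /c; have := one_plus_y_neq0'; rewrite {}y'E => h'; field.
  by rewrite one_plus_y_neq0 h'.
have g := cabs_inv_1Dy; have g' := cabs_inv_1Dy'.
have h2 := cabs_inv_1Dy_le2; have h3 := cabs_y_inv_1Dy.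
have h2' := cabs_inv_1Dy'_le2; have h3' := cabs_y_inv_1Dy'.
rewrite -/a in h2 h3 g; rewrite -/c in h2' h3' g'.
have k0 : 0 <= (cabs y)^-1 by rewrite invr_ge0.
move: (cabs y)^-1 k0 g g' => k k0 g g'.
apply: le_trans (cabsB_le
  (cabsM_le (lexx _) (cabsB_le (cabsM_le (cabsM_le h3 h3')
  (cabsD_le (cabsD_le (cabsM_le g h2) (cabsM_le g h2')) (cabsM_le g' h2')))
  (cabsM_le h3' (cabsM_le g' h2'))))
  (cabsM_le (lexx _) (cabsM_le (cabsM_le h3 h3) g'))) _.
by rewrite !cabsM le_eqVlt; apply/orP; left; apply/eqP; ring.
Qed.

Lemma cabs_logistic_slope_le : cabs (y * (1 + y) ^- 2) <= 4 * (cabs y)^-1.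
Proof.
have -> : y * (1 + y) ^- 2 = (y * (1 + y)^-1) * (1 + y)^-1.
  by field; exact: one_plus_y_neq0.
by apply: le_trans (cabsM_le cabs_y_inv_1Dy cabs_inv_1Dy) _; lra.
Qed.

(** The difference of y / (1 + y)^2 at two points y, w factors as
    (y - w) (1 - y w) / ((1 + y)^2 (1 + w)^2). *)
Lemma logistic_slope_diff (w : R) (k : R) : 1 <= w -> cabs (y - w%:C) <= w * k ->
  cabs (y * (1 + y) ^- 2 - (w / (1 + w) ^+ 2)%:C) <= 8 * k * (cabs y)^-1.
Proof.
move=> w1 yw.
have w0 : 1 + w%:C != 0.
  rewrite -(rmorph1 (real_complex R)) -rmorphD -cabs_eq0 cabs_real.
  by rewrite normr_eq0 gt_eqF//; lra.
have -> : (w / (1 + w) ^+ 2)%:C = w%:C * (1 + w%:C) ^- 2.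
  by rewrite rmorphM fmorphV rmorphXn rmorphD rmorph1.
set a := (1 + y)^-1.
have -> : y * (1 + y) ^- 2 - w%:C * (1 + w%:C) ^- 2 =
   (y - w%:C) * (1 - y * w%:C) * ((a * a) * ((1 + w%:C)^-1 * (1 + w%:C)^-1)).
  by rewrite /a; field; rewrite one_plus_y_neq0 w0.
have g := cabs_inv_1Dy; rewrite -/a in g.
have nw : cabs w%:C = w by rewrite cabs_real ger0_norm//; lra.
have nw1 : cabs (1 + w%:C)^-1 <= w^-1.
  rewrite cabsV -(rmorph1 (real_complex R)) -rmorphD cabs_real ger0_norm; last lra.
  by rewrite lef_pV2 ?posrE; lra.
have h : cabs (1 - y * w%:C) <= 2 * (cabs y * w).
  case: G => g1 _ _ _.
  have := @ler_cabsB R 1 (y * w%:C); rewrite cabs1 cabsM nw; nra.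
apply: le_trans (cabsM_le (cabsM_le yw h) (cabsM_le (cabsM_le g g) (cabsM_le nw1 nw1))) _.
rewrite le_eqVlt; apply/orP; left; apply/eqP; field.
by rewrite !gt_eqF//; lra.
Qed.

End Bounds.
End Profile.

Section RankSeries.
Variable R : realType.
Implicit Types (b t : R).

Lemma qptV b t : (qpt b t)^-1 = qpt (- b) (- t).
Proof. by rewrite /qpt invfM -fmorphV -expRN cisN opprK. Qed.

Lemma qpt_neq0 b t : qpt b t != 0.
Proof. by rewrite -cabs_eq0 cabs_qpt gt_eqF// expR_gt0. Qed.

(** If |t| <= 1 then the point has nonnegative real part; otherwise b > 1 and
    its modulus is at least 2. *)
Lemma cabs_one_plus_qpt b t : `|t| <= b ->
  cabs (qpt (- b) t) <= 2 * cabs (1 + qpt (- b) t).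
Proof.
move=> tb; have b0 : 0 <= b by apply: le_trans tb.
have zn := cabs_qpt (- b) t; rewrite opprK in zn.
have [t1|t1] := lerP `|t| 1.
  have c0 : 0 <= cos t.
    rewrite cos_ge0_pihalf//; have := @pihalf_ge1 R.
    by move: t1; rewrite ler_norml => /andP[]; lra.
  apply: le_trans (_ : cabs (1 + qpt (- b) t) <= _); last first.
    by have := cabs_ge0 (1 + qpt (- b) t); lra.
  rewrite -(@ler_pXn2r _ 2%N) ?nnegrE// !cabs_sqr.
  have : 0 <= complex.Re (qpt (- b) t).
    by rewrite /qpt Re_realM mulr_ge0 ?expR_ge0.
  case: (qpt _ _) => u v /=; nra.
have e2 : 2 <= expR b by have := expR_ge1Dx b; lra.
have := @lerB_cabs R (qpt (- b) t) 1; rewrite zn cabs1 [qpt _ _ + 1]addrC; lra.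
Qed.

Definition rank_series b t i r : R[i] := (rank_poly R[i] i r).[qpt b t].

Lemma rank_seriesS b t i r :
  rank_series b t i.+1 r = qpt b t ^+ r.+1 * (1 - rank_series b t i (r + 3)).
Proof. by rewrite /rank_series /= hornerM hornerXn hornerD hornerN hornerC. Qed.

Lemma rank_series0 b t r : rank_series b t 0 r = 0.
Proof. by rewrite /rank_series /= horner0. Qed.

Lemma cabs_qptX b t k : cabs (qpt b t ^+ k) = expR (- b) ^+ k.
Proof. by rewrite cabsX cabs_qpt. Qed.

Lemma expRN_itv01 b : 0 < b -> 0 < expR (- b) < 1.
Proof. by move=> b0; rewrite expR_gt0 expR_lt1 oppr_lt0. Qed.

(** The bound is a fixed point of the recursion for the moduli. *)
Lemma rank_series_le b t i r : 0 < b ->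
  cabs (rank_series b t i r) <= expR (- b) / (1 - expR (- b)).
Proof.
move=> b0; have /andP[r0 r1] := expRN_itv01 b0.
elim: i r => [|i IHi] r.
  by rewrite rank_series0 cabs0 divr_ge0//; lra.
rewrite rank_seriesS cabsM cabs_qptX.
apply: le_trans (_ : expR (- b) * (1 + expR (- b) / (1 - expR (- b))) <= _).
  apply: ler_pM => //.
    by rewrite exprS ler_piMr ?exprn_ile1// ltW.
  by apply: le_trans (ler_cabsB _ _) _; rewrite cabs1 lerD2l.
rewrite le_eqVlt; apply/orP; left; apply/eqP; field.
by rewrite gt_eqF//; lra.
Qed.

(** q^(-r). *)
Definition invpt b t (r : nat) : R[i] := qpt (- (r%:R * b)) (- (r%:R * t)).

Lemma invptE b t r : invpt b t r = (qpt b t ^+ r)^-1.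
Proof. by rewrite qptX -/(qpt (r%:R * b) (r%:R * t)) qptV. Qed.

Lemma cabs_invpt b t r : cabs (invpt b t r) = (expR (- b) ^+ r)^-1.
Proof. by rewrite invptE cabsV cabs_qptX. Qed.

Lemma invpt_ge1 b t r : 0 < b -> 1 <= cabs (invpt b t r).
Proof.
move=> b0; have /andP[r0 r1] := expRN_itv01 b0.
by rewrite cabs_invpt invf_ge1 ?exprn_gt0// exprn_ile1// ltW.
Qed.

Lemma invpt_le b t r s : 0 < b -> (r <= s)%N -> cabs (invpt b t r) <= cabs (invpt b t s).
Proof.
move=> b0 rs; have /andP[r0 r1] := expRN_itv01 b0.
by rewrite !cabs_invpt lef_pV2 ?posrE ?exprn_gt0// ler_wiXn2l// ltW.
Qed.

Lemma invpt_one_plus b t r : `|t| <= b ->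
  cabs (invpt b t r) <= 2 * cabs (1 + invpt b t r).
Proof.
move=> tb; apply: cabs_one_plus_qpt; rewrite normrN normrM ger0_norm ?ler0n//.
by rewrite ler_wpM2l.
Qed.

Lemma invptD b t r s : invpt b t (r + s) = invpt b t r * (1 + (invpt b t s - 1)).
Proof. by rewrite !invptE exprD invfM; ring. Qed.

Lemma invpt_sub1_le b t s : 0 < b <= 1 / 100 -> `|t| <= b -> (s <= 3)%N ->
  cabs (invpt b t s - 1) <= 2 * s%:R * (b + `|t|).
Proof.
move=> /andP[b0 b1] tb s3.
have s3' : s%:R <= 3 :> R by rewrite ler_nat.
have s0 : 0 <= s%:R :> R by [].
rewrite /invpt /qpt opprK; apply: le_trans (cabs_expcis_sub1 _ _) _.
  by apply/andP; split; nra.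
rewrite normrN normrM (ger0_norm s0); lra.
Qed.

Definition rank_error b t i r :=
  cabs (rank_series b t i r - profile (invpt b t 3 - 1) (invpt b t r.+1)).

(** Subtracting the approximate functional equation of the profile from that of
    the rank series; division by y gives the factor exp(- b)^(r+1). *)
Lemma rank_error_rec b t i r : 0 < b <= 1 / 100 -> `|t| <= b ->
  rank_error b t i.+1 r <= expR (- b) ^+ r.+1 * (rank_error b t i (r + 3) + (100 * b) ^+ 2).
Proof.
move=> b01 tb; have /andP[b0 b1] := b01.
rewrite /rank_error; set e := invpt b t 3 - 1.
set y := invpt b t r.+1; set y' := invpt b t (r + 3).+1.
have y'E : y' = y * (1 + e) by rewrite /y' -addSn invptD.
have yy' : cabs y <= cabs y' by apply: invpt_le => //; lia.
have G : away y y' by split=> //; [exact: invpt_ge1|exact: invpt_one_plus..].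
have D := profile_defect G y'E.
have e12 : cabs e <= 12 * b.
  by apply: le_trans (invpt_sub1_le b01 tb (leqnn 3)) _; lra.
have {}D : cabs (y * profile e y + profile e y' - 1) <= (100 * b) ^+ 2.
  apply: le_trans D _.
  have : cabs e ^+ 2 <= (12 * b) ^+ 2 by rewrite lerXn2r ?nnegrE//; lra.
  by have := sqr_ge0 b; lra.
have -> : rank_series b t i.+1 r - profile e y =
    - (qpt b t ^+ r.+1 * ((rank_series b t i (r + 3) - profile e y') + (y * profile e y + profile e y' - 1))).
  rewrite rank_seriesS /y invptE; field.
  by rewrite expf_neq0 ?qpt_neq0//.
rewrite cabsNE cabsM cabs_qptX ler_wpM2l ?exprn_ge0 ?expR_ge0//.
exact: cabsD_le (lexx _) D.
Qed.

Lemma rank_error0 b t r : 0 < b <= 1 / 100 -> `|t| <= b ->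
  rank_error b t 0 r <= 10 * expR (- b) ^+ r.
Proof.
move=> b01 tb; have /andP[b0 b1] := b01.
rewrite /rank_error rank_series0 sub0r cabsNE.
have e12 : cabs (invpt b t 3 - 1) <= 1.
  by apply: le_trans (invpt_sub1_le b01 tb (leqnn 3)) _; lra.
apply: le_trans (profile_le (y := invpt b t r.+1) (y' := invpt b t r.+1) _ e12) _.
  by split=> //; [exact: invpt_ge1|exact: invpt_one_plus..].
have /andP[r0 r1] := expRN_itv01 b0.
by rewrite cabs_invpt invrK ler_pM2l// exprS ler_piMl ?exprn_ge0// ltW.
Qed.

End RankSeries.

Section RankError.
Variable R : realType.
Implicit Types (b t h : R).

Lemma expRN_pow_le (b e : R) : 0 < b -> 0 < e ->
  exists I, forall i, (I <= i)%N -> expR (- b) ^+ i <= e.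
Proof.
move=> b0 e0; have := archi_boundP (_ : 0 <= (e * b)^-1).
rewrite invr_ge0 ltW ?mulr_gt0// => /(_ isT); set I := Num.bound _ => HI.
exists I => i Ii; rewrite -expRM_natl mulrN expRN -[e]invrK lef_pV2 ?posrE ?expR_gt0 ?invr_gt0//.
apply: le_trans (expR_ge1Dx _); apply: le_trans (_ : I%:R * b <= _).
  by rewrite -ler_pdivrMr// -invfM ltW.
have : I%:R * b <= i%:R * b by rewrite ler_wpM2r ?ler_nat// ltW.
lra.
Qed.

(** From r = R0 on the recursion contracts, so a constant S dominates its
    solutions; below R0 each of the at most R0 steps down adds D.  The initial
    values are only needed for large r, as i steps of the recursion lead from
    r to r + 3 i. *)
Lemma supersolution (rho D S : R) (R0 I0 : nat) (e : nat -> nat -> R) :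
  0 < rho < 1 -> 0 <= D -> rho ^+ R0 * (S + D) <= S -> 0 <= S ->
  (forall i r, e i.+1 r <= rho ^+ r.+1 * (e i (r + 3) + D)) ->
  (forall r, (I0 <= r)%N -> e 0%N r <= S) ->
  forall i r, (I0 <= r + 3 * i)%N -> e i r <= S + (R0 - r)%:R * D.
Proof.
move=> /andP[rho0 rho1] D0 RS S0 eS e0; elim=> [|i IHi] r rI.
  by apply: le_trans (e0 _ _) _; [lia|rewrite lerDl mulr_ge0].
apply: le_trans (eS _ _) _; have : (I0 <= r + 3 + 3 * i)%N by lia.
move=> /IHi {}IHi; apply: le_trans (_ : rho ^+ r.+1 * (S + (R0 - (r + 3))%:R * D + D) <= _).
  by rewrite ler_pM2l ?exprn_gt0// lerD2r.
have [rR|rR] := leqP R0 r.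
  have -> : (R0 - r = 0)%N by lia.
  have -> : (R0 - (r + 3) = 0)%N by lia.
  rewrite !mul0r !addr0; apply: le_trans RS; rewrite ler_wpM2r ?addr_ge0//.
  by rewrite ler_wiXn2l ?ltW//; lia.
apply: le_trans (_ : S + (R0 - (r + 3))%:R * D + D <= _).
  have X0 : 0 <= S + (R0 - (r + 3))%:R * D + D by rewrite !addr_ge0 ?mulr_ge0.
  by rewrite ler_piMl// exprn_ile1// ltW.
rewrite -addrA lerD2l -[X in _ + X]mul1r -mulrDl ler_wpM2r//.
by rewrite natr1 ler_nat; lia.
Qed.

(** With R0 of order 1 / h one has exp(- b)^R0 <= 1 / (1 + h), so that S = D / h with
    D = O(b^2) satisfies the hypothesis of [supersolution]; both S and R0 D are then
    O(h^3).  A last application of the recursion supplies exp(- b)^r. *)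
Lemma rank_error_le : exists2 c : R, 60 * 50 <= c &
  forall b h, 0 < b <= 1 / 100 -> 0 < h -> h ^+ 2 = b ->
  exists I, forall i, (I <= i)%N -> forall t r, `|t| <= b ->
  rank_error b t i r <= 4 * c * h ^+ 3 * expR (- b) ^+ r.
Proof.
have [c c1 cE] : exists2 c : R, 60 * 50 <= c & c = 100 ^+ 2 by exists (100 ^+ 2); lra.
have c0 : 0 < c by clear cE; lra.
exists c => // b h b01 h0 hb; have /andP[b0 b1] := b01.
have /andP[rho0 rho1] := expRN_itv01 b0.
set rho := expR (- b) in rho0 rho1 *.
(* D bounds the defect of the profile; S solves S = (S + D) / (1 + h). *)
set D := c * b ^+ 2; set S := D / h.
have D0 : 0 < D by rewrite mulr_gt0// exprn_gt0.
have S0 : 0 < S by rewrite divr_gt0.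
have h1 : h <= 1 / 10 by rewrite -(@ler_pXn2r _ 2%N) ?nnegrE ?hb//; lra.
have [I HI] := @expRN_pow_le b (S / 10) b0 (divr_gt0 S0 (ltr0n _ 10)).
have := archi_boundP (_ : 0 <= h^-1); rewrite invr_ge0 ltW// => /(_ isT).
have := Num.Theory.trunc_itv (_ : 0 <= h^-1); rewrite invr_ge0 ltW// => /(_ isT).
set R0 := (Num.trunc h^-1).+1 => /andP[R01 R02] _.
have RS : rho ^+ R0 * (S + D) <= S.
  have : rho ^+ R0 <= (1 + h)^-1.
    rewrite /rho -expRM_natl mulrN expRN lef_pV2 ?posrE ?expR_gt0; [|lra..].
    apply: le_trans (expR_ge1Dx _); rewrite lerD2l -hb.
    by rewrite expr2 mulrA ler_peMl ?(ltW h0)// -ler_pdivrMr// mul1r ltW.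
  move=> rh; apply: le_trans (_ : (1 + h)^-1 * (S + D) <= _).
    by rewrite ler_wpM2r// addr_ge0// ltW.
  rewrite mulrC ler_pdivrMr; last lra.
  by rewrite mulrDr mulr1 lerD2l /S divfK ?gt_eqF.
exists I.+1 => -[//|i] Ii t r tb.
have key s : rank_error b t i s <= 3 * c * h ^+ 3.
  apply: le_trans (@supersolution rho D S R0 I _ _ (ltW D0) RS (ltW S0) _ _ i s _) _.
  - by rewrite rho0 rho1.
  - by move=> j u; rewrite /D cE -exprMn; exact: rank_error_rec.
  - move=> u Iu; apply: le_trans (rank_error0 _ b01 tb) _.
    by have := HI _ Iu; rewrite -/rho; lra.
  - by move: Ii; clear; lia.
  have : (R0 - s)%:R <= h^-1 * 2 :> R.
    apply: le_trans (_ : R0%:R <= _); first by rewrite ler_nat leq_subr.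
    have : 1 <= h^-1 by rewrite invf_ge1//; lra.
    by move: R01; rewrite /R0 -natr1; lra.
  move=> R0s; have : (R0 - s)%:R * D <= h^-1 * 2 * D by rewrite ler_wpM2r// ltW.
  have -> : h^-1 * 2 * D = 2 * S by rewrite /S; ring.
  have -> : 3 * c * h ^+ 3 = 3 * S.
    by rewrite /S /D -hb; field; rewrite gt_eqF.
  lra.
apply: le_trans (rank_error_rec i r b01 tb) _; rewrite -/rho exprMn -cE exprS -/D.
have -> : 4 * c * h ^+ 3 * rho ^+ r = rho ^+ r * (4 * (c * h ^+ 3)) by ring.
have D3 : D <= c * h ^+ 3.
  have h30 : 0 <= h ^+ 3 by rewrite exprn_ge0// ltW.
  rewrite /D -hb -exprM ler_pM2l//.
  have -> : h ^+ (2 * 2) = h * h ^+ 3 by rewrite -exprS.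
  by rewrite ler_piMl//; lra.
have h3 : 0 < c * h ^+ 3 by rewrite mulr_gt0// exprn_gt0.
have k := key (r + 3)%N.
apply: le_trans (_ : rho ^+ r * (rank_error b t i (r + 3) + D) <= _).
  apply: ler_wpM2r; first by rewrite addr_ge0 ?(ltW D0)// /rank_error.
  by rewrite -exprS; apply: ler_wiXn2l; rewrite ?ltW.
by rewrite ler_pM2l ?exprn_gt0//; lra.
Qed.

(** This is b / 4 sech(b m / 2)^2, see [sech_profileE]. *)
Definition sech_profile b (m : nat) : R := b * (expR (m%:R * b) / (1 + expR (m%:R * b)) ^+ 2).

Lemma sech_profile_ge b m : 0 < b -> b * expR (- b) ^+ m / 4 <= sech_profile b m.
Proof.
move=> b0; rewrite /sech_profile -expRM_natl mulrN expRN -mulrA ler_pM2l//.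
have : 1 <= expR (m%:R * b).
  have := expR_ge1Dx (m%:R * b); have : 0 <= m%:R * b by rewrite mulr_ge0// ltW.
  lra.
move: (expR _) => w w1.
rewrite ler_pdivlMr; last by rewrite exprn_gt0//; lra.
apply: le_trans (_ : w^-1 / 4 * (4 * w ^+ 2) <= _).
  by rewrite ler_wpM2l ?divr_ge0 ?invr_ge0//; nra.
by rewrite le_eqVlt; apply/orP; left; apply/eqP; field; rewrite gt_eqF//; lra.
Qed.

Lemma sech_profile_le b m : 0 < b -> sech_profile b m <= b.
Proof.
move=> b0; rewrite /sech_profile ler_piMr ?(ltW b0)//.
have := expR_gt0 (m%:R * b); move: (expR _) => w w0.
by rewrite ler_pdivrMr ?exprn_gt0 ?addr_gt0//; nra.
Qed.

(** The profile difference is d y / (1 + y)^2 up to O(b^2), with d = q^(-1) - 1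
    close to b and y close to exp(m b); replacing d and y costs |t| / b and
    b + (m + 1) |t| in relative terms, while the error of the profile costs h. *)
Lemma rank_series_diff : exists2 C : R, 0 < C &
  forall b h, 0 < b <= 1 / 100 -> 0 < h -> h ^+ 2 = b ->
  exists I, forall i, (I <= i)%N -> forall t m, `|t| <= b ->
  cabs (rank_series b t i m - rank_series b t i m.+1 - (sech_profile b m)%:C) <=
  C * b * expR (- b) ^+ m * (h + `|t| / b + m%:R * `|t|).
Proof.
have [c c1 Hc] := rank_error_le; have c0 : 0 < c by lra.
exists (12 * c); first by rewrite mulr_gt0.
move=> b h b01 h0 hb; have /andP[b0 b1] := b01.
have [I HI] := Hc b h b01 h0 hb; exists I => i Ii t m tb.
have E1 := HI i Ii t m tb; have E2 := HI i Ii t m.+1 tb.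
have /andP[rho0 rho1] := expRN_itv01 b0.
have h1 : h <= 1 / 10 by rewrite -(@ler_pXn2r _ 2%N) ?nnegrE ?hb//; lra.
have {}E2 : rank_error b t i m.+1 <= 4 * c * h ^+ 3 * expR (- b) ^+ m.
  apply: le_trans E2 _; rewrite ler_pM2l ?mulr_gt0 ?exprn_gt0//.
  by rewrite ler_wiXn2l ?ltW.
rewrite /rank_error in E1 E2.
set e := invpt b t 3 - 1 in E1 E2.
set y := invpt b t m.+1 in E1 E2; set y' := invpt b t m.+2 in E1 E2.
set d := invpt b t 1 - 1.
have y'E : y' = y * (1 + d) by rewrite /y' -addn1 invptD.
have G : away y y'.
  split; [exact: invpt_ge1|exact: invpt_le|exact: invpt_one_plus..].
have e12 : cabs e <= 12 * b.
  by apply: le_trans (invpt_sub1_le b01 tb (leqnn 3)) _; lra.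
have d4 : cabs d <= 4 * b.
  by apply: le_trans (invpt_sub1_le b01 tb (isT : 1 <= 3)%N) _; lra.
set w := expR (m%:R * b).
have w1 : 1 <= w.
  have := expR_ge1Dx (m%:R * b); have : 0 <= m%:R * b by rewrite mulr_ge0// ltW.
  rewrite -/w; lra.
have t0 : 0 <= `|t| by [].
have yw : cabs (y - w%:C) <= w * (2 * (b + m.+1%:R * `|t|)).
  have -> : y = w%:C * ((expR b)%:C * cis (- (m.+1%:R * t))).
    rewrite /y /invpt /qpt opprK mulrA -rmorphM -expRD; congr (_%:C * _).
    by congr expR; rewrite -natr1; ring.
  rewrite -[X in _ - X]mulr1 -mulrBr cabsM cabs_real ger0_norm; last lra.
  rewrite ler_pM2l; last lra.
  apply: le_trans (cabs_expcis_sub1 _ _) _; first by apply/andP; split; lra.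
  by rewrite normrN normrM ger0_norm.
have db : cabs (d - b%:C) <= 2 * `|t| + 2 * b ^+ 2.
  have -> : d - b%:C = (expR b)%:C * (cis (- t) - 1) + (expR b - 1 - b)%:C.
    by rewrite /d /invpt /qpt opprK !mul1r !rmorphB rmorph1; ring.
  have eb2 : expR b <= 1 + b + 2 * b ^+ 2.
    apply: le_trans (expR_le_inv _) _; first lra.
    by rewrite -[leLHS]mul1r ler_pdivrMr; nra.
  have eb1 := expR_ge1Dx b.
  apply: le_trans (ler_cabsD _ _) _; rewrite cabsM !cabs_real ger0_norm ?expR_ge0//.
  rewrite ger0_norm; last lra.
  have := cabs_cis_sub1 (- t); rewrite normrN => ct.
  have : expR b * cabs (cis (- t) - 1) <= 2 * `|t|.
    by apply: ler_pM; rewrite ?expR_ge0//; nra.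
  lra.
have F1 := profile_diff e G y'E.
have F2 := logistic_slope_diff G w1 yw.
have F3 := cabs_logistic_slope_le G.
have yV : (cabs y)^-1 <= expR (- b) ^+ m.
  by rewrite cabs_invpt invrK ler_wiXn2l ?ltW.
set v := y * (1 + y) ^- 2 in F1 F2 F3.
have -> : rank_series b t i m - rank_series b t i m.+1 - (sech_profile b m)%:C =
  (rank_series b t i m - profile e y) - (rank_series b t i m.+1 - profile e y') +
  ((profile e y - profile e y' - d * v) + ((d - b%:C) * v
   + b%:C * (v - (w / (1 + w) ^+ 2)%:C))).
  by rewrite /sech_profile -/w rmorphM /=; ring.
have F4 := cabsM_le db F3.
have nb : cabs b%:C <= b by rewrite cabs_real ger0_norm// ltW.
have F5 := cabsM_le nb F2.
apply: le_trans (cabsD_le (cabsB_le E1 E2) (cabsD_le F1 (cabsD_le F4 F5))) _.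
have k0 : 0 <= (cabs y)^-1 by rewrite invr_ge0.
move: (cabs y)^-1 k0 yV => k k0 kr.
have r0 : 0 < expR (- b) ^+ m by rewrite exprn_gt0.
move: (expR (- b) ^+ m) r0 kr => r r0 kr.
have m0 : 0 <= m%:R :> R by [].
have de : cabs e * cabs d <= 48 * b ^+ 2.
  have : cabs e * cabs d <= (12 * b) * (4 * b) by apply: ler_pM.
  lra.
have d2 : cabs d ^+ 2 <= 16 * b ^+ 2.
  have : cabs d * cabs d <= (4 * b) * (4 * b) by apply: ler_pM.
  by rewrite -!expr2; lra.
have bh : b ^+ 2 <= b * h.
  by rewrite expr2 ler_pM2l// -hb expr2 ler_piMl; lra.
have h3 : h ^+ 3 = b * h by rewrite exprSr hb.
have bt : b * (`|t| / b) = `|t| by rewrite mulrCA divff ?mulr1// gt_eqF.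
rewrite -(@natr1 R m); set T := `|t| / b in bt *; rewrite -bt.
have T0 : 0 <= T by rewrite divr_ge0// ltW.
rewrite h3; clearbody T; clear -b0 b1 h0 h1 de d2 bh k0 kr r0 m0 T0 hb c0 c1.
have mT : 0 <= m%:R * (b * T) by rewrite !mulr_ge0// ltW.
have bT : 0 <= b * T by rewrite mulr_ge0// ltW.
have bh0 : 0 < b * h by rewrite mulr_gt0.
set X := (56 * cabs e * cabs d + 8 * cabs d ^+ 2).
have X1 : X <= c * (b * h).
  by apply: le_trans (_ : 60 * 50 * (b * h) <= _); [rewrite /X -mulrA; lra|rewrite ler_pM2r].
apply: le_trans (_ : 8 * c * (b * h) * r + (c * (b * h) * r + ((2 * (b * T) + 2 * (b * h)) * (4 * r)
   + b * (8 * (2 * (b + (m%:R + 1) * (b * T))) * r))) <= _).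
  apply: lerD; first lra.
  have X0 : 0 <= X by rewrite addr_ge0 ?mulr_ge0// ?exprn_ge0.
  apply: lerD; first by apply: ler_pM.
  apply: lerD.
    apply: ler_pM; [by nra|by lra|by lra|by lra].
  rewrite ler_pM2l// ler_wpM2l//.
  by rewrite mulr_ge0// mulr_ge0//; lra.
have -> : 12 * c * b * r * (h + T + m%:R * (b * T)) =
   r * (12 * c * (b * h + b * T + b * (m%:R * (b * T)))) by ring.
have -> : 8 * c * (b * h) * r + (c * (b * h) * r + ((2 * (b * T) + 2 * (b * h)) * (4 * r)
   + b * (8 * (2 * (b + (m%:R + 1) * (b * T))) * r))) =
  r * ((9 * c + 8) * (b * h) + 8 * (b * T) + 16 * b ^+ 2 + b * (16 * (m%:R * (b * T))) + 16 * b * (b * T)) by ring.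
rewrite ler_pM2l//.
have c10 : 10 <= c by clear -c1; lra.
clear c1 X X1 de d2 k0 kr.
have ch : 10 * (b * h) <= c * (b * h) by rewrite ler_pM2r.
have cT : 10 * (b * T) <= c * (b * T) by rewrite ler_wpM2r.
have cmT : 10 * (b * (m%:R * (b * T))) <= c * (b * (m%:R * (b * T))).
  by rewrite ler_wpM2r// mulr_ge0// ltW.
have : b * (b * T) <= 1 * (b * T) by rewrite ler_wpM2r//; lra.
have : 0 <= b * (m%:R * (b * T)) by rewrite mulr_ge0// ltW.
lra.
Qed.

End RankError.

(** * Decay of the generating function of partitions on a circle *)

Section Kernel.
Variable R : realType.
Implicit Types (b t r : R).

(** The characteristic function of the geometric law with weights (1 - r) r^j. *)
Definition geom_char r t : R[i] := (1 - r)%:C / (1 - r%:C * cis t).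

Lemma cabs_geom_denom r t : cabs (1 - r%:C * cis t) ^+ 2 = (1 - r) ^+ 2 + 2 * r * (1 - cos t).
Proof.
rewrite cabs_sqr /=; have := cos2Dsin2 t.
move: (cos t) (sin t) => c s cs.
have -> : (1 - (r * c - 0 * s)) ^+ 2 + (0 - (r * s + 0 * c)) ^+ 2 =
  1 - 2 * r * c + r ^+ 2 * c ^+ 2 + r ^+ 2 * s ^+ 2 by ring.
have -> : s ^+ 2 = 1 - c ^+ 2 by lra.
ring.
Qed.

Lemma cabs_geom_denom_ge r t : 0 < r < 1 -> 1 - r <= cabs (1 - r%:C * cis t).
Proof.
move=> /andP[r0 r1]; rewrite -(@ler_pXn2r _ 2%N) ?nnegrE//; last lra.
rewrite cabs_geom_denom lerDl mulr_ge0//; have := cos_le1 t; nra.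
Qed.

Lemma geom_denom_neq0 r t : 0 < r < 1 -> 1 - r%:C * cis t != 0.
Proof.
move=> r01; rewrite -cabs_eq0 gt_eqF//.
by have := cabs_geom_denom_ge t r01; case/andP: r01; lra.
Qed.

Lemma cabs_geom_char_sqr r t : 0 < r < 1 ->
  cabs (geom_char r t) ^+ 2 = (1 + 2 * (r / (1 - r) ^+ 2) * (1 - cos t))^-1.
Proof.
move=> r01; have /andP[r0 r1] := r01.
rewrite /geom_char cabsM cabsV exprMn exprVn cabs_geom_denom cabs_real.
rewrite real_normK ?num_real//.
have c1 : 0 <= 1 - cos t by have := cos_le1 t; lra.
have x0 : 0 < (1 - r) ^+ 2 by rewrite exprn_gt0//; lra.
move: (1 - cos t) ((1 - r) ^+ 2) c1 x0 => c x c1 x0.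
field; rewrite !gt_eqF// ltr_wpDr// ?mulr_ge0//; lra.
Qed.

Lemma geom_gain_ge0 r t : 0 < r < 1 -> 0 <= 2 * (r / (1 - r) ^+ 2) * (1 - cos t).
Proof.
move=> /andP[r0 r1]; apply: mulr_ge0; last by rewrite subr_ge0 cos_le1.
by rewrite mulr_ge0// divr_ge0 ?(ltW r0)// sqr_ge0.
Qed.

Lemma cabs_geom_char_le1 r t : 0 < r < 1 -> cabs (geom_char r t) <= 1.
Proof.
move=> r01; have /andP[r0 r1] := r01.
have g := geom_gain_ge0 t r01.
by rewrite -(@ler_pXn2r _ 2%N) ?nnegrE// cabs_geom_char_sqr// expr1n invf_le1; lra.
Qed.

(** The denominator of the squared modulus is at least 1 + 2 r (1 - cos t), and
    1 + x dominates exp(x / 4) for x in [0, 4]. *)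
Lemma cabs_geom_char_le r t : 0 < r < 1 ->
  cabs (geom_char r t) <= expR (- (r * (1 - cos t) / 8)).
Proof.
move=> r01; have /andP[r0 r1] := r01.
rewrite -(@ler_pXn2r _ 2%N) ?nnegrE ?expR_ge0// cabs_geom_char_sqr//.
rewrite -expRM_natl mulrN expRN lef_pV2 ?posrE ?expR_gt0//; last first.
  by have := geom_gain_ge0 t r01; lra.
  have c1 := cos_le1 t; have c2 := cos_geN1 t.
  apply: le_trans (expR_le_lin _) _; first by apply/andP; split; nra.
  rewrite lerD2l.
  have : r <= r / (1 - r) ^+ 2.
    by rewrite ler_pdivlMr ?exprn_gt0//; [nra|lra].
  move: (r / _) => s rs; nra.
Qed.

(** The product over the part sizes k + 1: P(q) / P(exp(- b)) when the parts are
    at most K. *)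
Definition size_char K b t : R[i] :=
  \prod_(k < K) geom_char (expR (- (k.+1%:R * b))) (k.+1%:R * t).

Lemma cabs_size_char_le K b t : 0 < b ->
  cabs (size_char K b t) <=
  expR (- (\sum_(k < K) expR (- (k.+1%:R * b)) * (1 - cos (k.+1%:R * t))) / 8).
Proof.
move=> b0; rewrite /size_char cabs_prod mulNr mulr_suml -sumrN expR_sum.
apply: ler_prod => k _; rewrite cabs_ge0 cabs_geom_char_le//.
by rewrite expR_gt0 expR_lt1 oppr_lt0 mulr_gt0.
Qed.

Lemma cabs_size_char_le1 K b t : 0 < b -> cabs (size_char K b t) <= 1.
Proof.
move=> b0; rewrite /size_char cabs_prod; apply: prodr_ile1 => k _.
by rewrite cabs_ge0 cabs_geom_char_le1// expR_gt0 expR_lt1 oppr_lt0 mulr_gt0.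
Qed.

Lemma sum_one_sub_cos_small V t : `|t| * V%:R <= 4 ->
  t ^+ 2 * V%:R ^+ 3 / 54 <= \sum_(k < V) (1 - cos (k.+1%:R * t)).
Proof.
move=> tV; apply: le_trans (_ : \sum_(k < V) t ^+ 2 / 18 * k.+1%:R ^+ 2 <= _); last first.
  apply: ler_sum => k _; apply: le_trans (one_sub_cos_ge _).
    by rewrite exprMn le_eqVlt; apply/orP; left; apply/eqP; ring.
  rewrite normrM ger0_norm// mulrC; apply: le_trans tV.
  by rewrite ler_wpM2l// ler_nat.
rewrite -mulr_sumr.
have : V%:R ^+ 3 / 3 <= \sum_(k < V) k.+1%:R ^+ 2 :> R.
  elim: V {tV} => [|V IHV]; first by rewrite big_ord0 expr0n mul0r.
  rewrite big_ord_recr /=; apply: le_trans (_ : V%:R ^+ 3 / 3 + V.+1%:R ^+ 2 <= _); last by rewrite lerD2r.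
  rewrite -natr1; have : 0 <= V%:R :> R by [].
  move: V%:R => v v0; nra.
have := sqr_ge0 t; move: (\sum_(_ < _) _) (V%:R ^+ 3) => s v; nra.
Qed.

(** The closed form of the Dirichlet kernel. *)
Lemma dirichlet V t :
  2 * sin (t / 2) * (\sum_(k < V) cos (k.+1%:R * t)) = sin ((V%:R + 1 / 2) * t) - sin (t / 2).
Proof.
elim: V => [|V IHV].
  by rewrite big_ord0 mulr0 add0r mulrAC mul1r mulrC subrr.
rewrite big_ord_recr /= mulrDr IHV.
have -> : (V.+1%:R + 1 / 2) * t = V.+1%:R * t + t / 2 by field.
have -> : (V%:R + 1 / 2) * t = V.+1%:R * t - t / 2 by rewrite -natr1; field.
rewrite !sinD sinN cosN; ring.
Qed.

Lemma sum_one_sub_cos_large V t : `|t| <= pi -> 6 <= `|t| * V%:R ->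
  V%:R / 2 <= \sum_(k < V) (1 - cos (k.+1%:R * t)).
Proof.
move=> tpi tV.
have -> : \sum_(k < V) (1 - cos (k.+1%:R * t)) = \sum_(k < V) (1 - cos (k.+1%:R * `|t|)).
  apply: eq_bigr => k _; congr (1 - _); rewrite -[LHS]cos_norm normrM.
  by rewrite (ger0_norm (ler0n _ _)).
have t0 : 0 < `|t|.
  rewrite lt_neqAle normr_ge0 andbT eq_sym; apply/eqP => t0.
  by move: tV; rewrite t0 mul0r; lra.
move: `|t| t0 tpi tV => {}t t0 tpi tV.
have s6 : t / 6 <= sin (t / 2).
  have -> : t / 6 = (t / 2) / 3 by field.
  by apply: sin_ge_third; have := @pihalf_lt2 R; lra.
have D := dirichlet V t; rewrite sumrB sumr_const card_ord.
have := sin_le1 ((V%:R + 1 / 2) * t).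
move: (\sum_(_ < _) _) (sin (_ * t)) (sin (t / 2)) s6 D => C u s s6 D u1.
have CV : C <= V%:R / 2.
  have [C0|C0] := lerP C 0; first by (have V0 : 0 <= V%:R :> R by []); lra.
  have : t / 6 * C <= s * C by apply: ler_wpM2r; [exact: ltW C0|exact: s6].
  by move=> tC; rewrite -(ler_pM2l t0); lra.
lra.
Qed.

(** The exponent is at least a constant times the sum of 1 - cos(k t) over
    k <= V with V of order 1 / b.  That sum is of order t^2 V^3 if |t| V is bounded,
    and of order V otherwise, by the Dirichlet kernel. *)
Lemma size_char_bound : exists2 c : R, 0 < c & forall K b t,
  0 < b <= 1 / 100 -> 4 <= K%:R * b -> `|t| <= pi ->
  cabs (size_char K b t) <= expR (- (c * t ^+ 2 / b ^+ 3)) + expR (- (c / b)).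
Proof.
exists (expR (- 4) / 8 / 60); first by rewrite !divr_gt0 ?expR_gt0.
move=> K b t /andP[b0 b1] Kb tpi.
have e4 : 0 < expR (- 4) :> R by exact: expR_gt0.
have key V : V%:R * b <= 4 -> cabs (size_char K b t) <=
    expR (- (expR (- 4) / 8 * \sum_(k < V) (1 - cos (k.+1%:R * t)))).
  move=> Vb; apply: le_trans (cabs_size_char_le K t b0) _; rewrite ler_expR mulNr lerN2.
  rewrite mulrAC ler_pM2r// mulr_sumr.
  have VK : (V <= K)%N.
    by rewrite -(ler_nat R) -(ler_pM2r b0); apply: le_trans Kb.
  rewrite (big_ord_widen K (fun k => expR (-4) * (1 - cos (k.+1%:R * t))) VK) big_mkcond /=.
  apply: ler_sum => k _; case: ifP => kV.
    apply: ler_wpM2r; first by rewrite subr_ge0 cos_le1.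
    rewrite ler_expR lerN2; apply: le_trans Vb; rewrite ler_wpM2r ?(ltW b0)//.
    by rewrite ler_nat.
  by apply: mulr_ge0; rewrite ?expR_ge0// subr_ge0 cos_le1.
have trB (x : R) : 0 <= x -> (Num.trunc x)%:R <= x < (Num.trunc x)%:R + 1.
  by move=> x0; rewrite natr1; exact: Num.Theory.trunc_itv.
have iv x : 0 <= x -> 0 <= x / b by move=> x0; rewrite divr_ge0// ltW.
have ib : b * b^-1 = 1 by rewrite divff// gt_eqF.
have ib1 : 1 <= b^-1 by rewrite invf_ge1//; lra.
(* V = 2 / b keeps V |t| <= 4 in the first case, V = 4 / b gives V |t| >= 6 in
   the second. *)
have [tb|tb] := lerP `|t| (2 * b).
  apply: le_trans (_ : expR (- (expR (- 4) / 8 / 60 * t ^+ 2 / b ^+ 3)) <= _); last first.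
    by rewrite lerDl expR_ge0.
  have /andP[V1 V2] := trB (2 / b) (iv _ (ler0n _ 2)).
  set V := Num.trunc (2 / b) in V1 V2.
  have Vb : V%:R * b <= 2 by rewrite -ler_pdivlMr.
  apply: le_trans (key V _) _; first lra.
  rewrite ler_expR lerN2.
  have tV : `|t| * V%:R <= 4.
    apply: le_trans (_ : 2 * b * V%:R <= _); first by rewrite ler_wpM2r.
    lra.
  have S := sum_one_sub_cos_small tV.
  have Vib : b^-1 <= V%:R by lra.
  have V3 : b^-1 ^+ 3 <= V%:R ^+ 3.
    by rewrite lerXn2r ?nnegrE//; lra.
  have -> : expR (- 4) / 8 / 60 * t ^+ 2 / b ^+ 3 = expR (- 4) * (8^-1 * (60^-1 * (t ^+ 2 / b ^+ 3))).
    by rewrite !mulrA.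
  rewrite -(mulrA (expR _)) ler_pM2l//.
  apply: le_trans (_ : 8^-1 * (t ^+ 2 * V%:R ^+ 3 / 54) <= _); last first.
    by rewrite ler_pM2l.
  rewrite -exprVn; have := sqr_ge0 t; have : 0 <= b^-1 ^+ 3 by rewrite exprn_ge0//; lra.
  move: (t ^+ 2) (V%:R ^+ 3) (b^-1 ^+ 3) V3 => x y z V3 z0 x0.
  have : x * z <= x * y by rewrite ler_wpM2l.
  have : 0 <= x * z by rewrite mulr_ge0.
  lra.
apply: le_trans (_ : expR (- (expR (- 4) / 8 / 60 / b)) <= _); last first.
  by rewrite lerDr expR_ge0.
have /andP[V1 V2] := trB (4 / b) (iv _ (ler0n _ 4)).
set V := Num.trunc (4 / b) in V1 V2.
have Vb : V%:R * b <= 4 by rewrite -ler_pdivlMr.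
apply: le_trans (key V Vb) _; rewrite ler_expR lerN2 -!mulrA ler_pM2l//.
have V3 : 3 * b^-1 <= V%:R by lra.
have tV : 6 <= `|t| * V%:R.
  have -> : 6 = 2 * b * (3 * b^-1) by rewrite mulrACA ib; lra.
  by apply: ler_pM => //; [rewrite mulr_ge0// ltW|lra|rewrite ltW].
have S := sum_one_sub_cos_large tpi tV.
apply: le_trans (_ : 8^-1 * (V%:R / 2) <= _); last by rewrite ler_pM2l.
lra.
Qed.

End Kernel.

(** * The value of zeta(2) *)

Section Basel.
Variable R : realType.
Implicit Types x : R.

Definition csc2 x : R := (sin x ^+ 2)^-1.

(** 1 / sin^2 + 1 / cos^2 = 1 / (sin cos)^2. *)
Lemma csc2_double x : 0 < x < pi / 2 -> csc2 x + csc2 (x + pi / 2) = 4 * csc2 (2 * x).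
Proof.
move=> x01; have s0 := sin_gt0_pihalf x01.
have c0 : 0 < cos x.
  by apply: cos_gt0_pihalf; case/andP: x01; have := @pi_gt0 R; lra.
rewrite /csc2 sinDpihalf [2 * x]mulr_natl sin_mulr2n -[_ *+ 2]mulr_natl.
have cs : cos x ^+ 2 = 1 - sin x ^+ 2 by rewrite cos2sin2.
rewrite !exprMn.
have -> : (sin x ^+ 2)^-1 + (cos x ^+ 2)^-1 = (sin x ^+ 2 + cos x ^+ 2) / (cos x ^+ 2 * sin x ^+ 2).
  by field; rewrite !gt_eqF.
rewrite addrC cos2Dsin2; field; by rewrite !gt_eqF.
Qed.

(** sin x <= x <= tan x, the second inequality being squared and multiplied by
    cos(x)^2. *)
Lemma csc2_bounds x : 0 < x < pi / 2 -> x ^- 2 <= csc2 x <= x ^- 2 + 1.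
Proof.
move=> x01; have s0 := sin_gt0_pihalf x01; have /andP[x0 x1] := x01.
have sx : sin x <= x by rewrite sin_le_id// ltW.
have xc : x * cos x <= sin x by apply: mul_cos_le_sin; have := @pi_gt0 R; lra.
have c0 : 0 < cos x by apply: cos_gt0_pihalf; have := @pi_gt0 R; lra.
rewrite /csc2; apply/andP; split.
  by rewrite lef_pV2 ?posrE ?exprn_gt0// lerXn2r ?nnegrE// ltW.
have h : x ^+ 2 <= sin x ^+ 2 * (1 + x ^+ 2).
  have : (x * cos x) ^+ 2 <= sin x ^+ 2 by rewrite lerXn2r ?nnegrE ?mulr_ge0// ltW.
  by rewrite exprMn cos2sin2; lra.
have -> : x ^- 2 + 1 = (1 + x ^+ 2) / x ^+ 2 by field; rewrite gt_eqF.
by rewrite -[leLHS]mul1r ler_pdivrMr ?exprn_gt0// mulrAC ler_pdivlMr ?exprn_gt0// mul1r mulrC.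
Qed.

Lemma sum_shift (G : nat -> R) N :
  \sum_(N.+1 <= i < N + N) G i = \sum_(1 <= i < N) G (i + N)%N.
Proof. by rewrite -[N.+1]add1n big_addn addnK. Qed.

(** Doubling the number of points and pairing k with k + N by [csc2_double]
    multiplies the sum by 4; the unpaired middle point adds 1. *)
Lemma sum_csc2 m : \sum_(1 <= k < 2 ^ m) csc2 (k%:R * (pi / (2 ^ m)%:R)) = ((2 ^ m)%:R ^+ 2 - 1) / 3.
Proof.
elim: m => [|m IHm]; first by rewrite expn0 big_geq// expr1n subrr mul0r.
have N0 : (0 < 2 ^ m)%N by rewrite expn_gt0.
rewrite expnS; move: (2 ^ m)%N N0 IHm => N N0 IHm.
have NR : 0 < N%:R :> R by rewrite ltr0n.
rewrite mul2n -addnn (big_cat_nat (n := N)) //=; last by rewrite leq_addr.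
rewrite [X in _ + X]big_ltn; last by rewrite -{1}(addn0 N) ltn_add2l.
rewrite sum_shift addrCA -big_split /=.
have -> : csc2 (N%:R * (pi / (N + N)%:R)) = 1.
  rewrite natrD; have -> : N%:R * (pi / (N%:R + N%:R)) = pi / 2 :> R.
    by field; rewrite gt_eqF//; lra.
  by rewrite /csc2 sin_pihalf expr1n invr1.
rewrite (eq_big_nat _ _ (F2 := fun k => 4 * csc2 (k%:R * (pi / N%:R)))); last first.
  move=> k /andP[k1 kN].
  have kR : 0 < k%:R :> R by rewrite ltr0n.
  have kNR : k%:R < N%:R :> R by rewrite ltr_nat.
  have -> : (k + N)%:R * (pi / (N + N)%:R) = k%:R * (pi / (N + N)%:R) + pi / 2 :> R.
    by rewrite !natrD; field; rewrite gt_eqF//; lra.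
  rewrite csc2_double.
    by congr (4 * csc2 _); rewrite natrD; field; rewrite !gt_eqF//; lra.
  rewrite mulr_gt0 ?divr_gt0 ?pi_gt0//= ?ltr0n ?addn_gt0 ?N0//.
  rewrite mulrCA ltr_pM2l ?pi_gt0// ltr_pdivrMr natrD; lra.
rewrite -mulr_sumr IHm natrD; by field.
Qed.

Definition zeta2 (L : nat) : R := \sum_(1 <= k < L.+1) k%:R ^- 2.

(** In the sum of 1 / sin(k pi / 2N)^2 the symmetric halves agree, and each term
    differs from (2N / (k pi))^2 by at most 1. *)
Lemma zeta2_dyadic m : (0 < m)%N ->
  pi ^+ 2 / 6 * (1 - 5 / (2 ^ m)%:R) <= zeta2 (2 ^ m.-1).-1 <= pi ^+ 2 / 6.
Proof.
case: m => // m _ /=; rewrite /zeta2 prednK ?expn_gt0//.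
have := sum_csc2 m.+1; rewrite expnS.
have N0 : (0 < 2 ^ m)%N by rewrite expn_gt0.
move: (2 ^ m)%N N0 => N N0.
have NR : 1 <= N%:R :> R by rewrite ler1n.
rewrite mul2n -addnn (big_cat_nat (n := N)) //=; last by rewrite leq_addr.
rewrite [X in _ + X]big_ltn; last by rewrite -{1}(addn0 N) ltn_add2l.
have -> : csc2 (N%:R * (pi / (N + N)%:R)) = 1.
  rewrite natrD; have -> : N%:R * (pi / (N%:R + N%:R)) = pi / 2 :> R.
    by field; rewrite gt_eqF//; lra.
  by rewrite /csc2 sin_pihalf expr1n invr1.
rewrite [X in _ + (_ + X)]big_nat_rev /=.
rewrite sum_shift.
set F := \sum_(1 <= i < N) _; rewrite [X in _ + (_ + X)](_ : _ = F); last first.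
  apply: eq_big_nat => k /andP[k1 kN].
  have -> : (1 + N + (N + N) - (k + N).+1 = N + N - k)%N by lia.
  rewrite /csc2 natrB ?(leq_trans (ltnW kN)) ?leq_addr// natrD.
  have -> : (N%:R + N%:R - k%:R) * (pi / (N%:R + N%:R)) = pi - k%:R * (pi / (N%:R + N%:R)) :> R.
    by field; rewrite gt_eqF//; lra.
  by rewrite sinB sinpi cospi mul0r mulN1r sub0r opprK.
rewrite natrD => FE.
have {}FE : F = (2 * N%:R ^+ 2 - 2) / 3 by lra.
set p2 := pi ^+ 2.
have p0 : 0 < p2 :> R by rewrite exprn_gt0// pi_gt0.
set Z := \sum_(_ <= _ < _) _.
have bnd (k : nat) : (0 < k < N)%N ->
    4 * N%:R ^+ 2 / p2 * k%:R ^- 2 <= csc2 (k%:R * (pi / (N%:R + N%:R)))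
    <= 4 * N%:R ^+ 2 / p2 * k%:R ^- 2 + 1.
  move=> /andP[k0 kN]; have kR : 0 < k%:R :> R by rewrite ltr0n.
  have kNR : k%:R < N%:R :> R by rewrite ltr_nat.
  have -> : 4 * N%:R ^+ 2 / p2 * k%:R ^- 2 = (k%:R * (pi / (N%:R + N%:R))) ^- 2 :> R.
    rewrite /p2; have := @pi_gt0 R; move: (@pi R) => P P0; field; rewrite !gt_eqF//; lra.
  apply: csc2_bounds; rewrite mulr_gt0 ?divr_gt0 ?pi_gt0//=; last lra.
  by rewrite mulrCA ltr_pM2l ?pi_gt0// ltr_pdivrMr; lra.
have F1 : 4 * N%:R ^+ 2 / p2 * Z <= F.
  rewrite /Z mulr_sumr /F !big_seq; apply: ler_sum => k.
  by rewrite mem_index_iota natrD => /bnd/andP[].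
have F2 : F <= 4 * N%:R ^+ 2 / p2 * Z + N%:R.
  apply: le_trans (_ : \sum_(1 <= k < N) (4 * N%:R ^+ 2 / p2 * k%:R ^- 2 + 1) <= _).
    rewrite /F !big_seq; apply: ler_sum => k.
    by rewrite mem_index_iota natrD => /bnd/andP[].
  rewrite big_split /= -mulr_sumr lerD2l sumr_const_nat -mulr_natr mul1r ler_nat.
  by rewrite leq_subr.
have N2 : 0 < N%:R ^+ 2 :> R by rewrite exprn_gt0//; lra.
have ZE : Z = 4 * N%:R ^+ 2 / p2 * Z * (p2 / (4 * N%:R ^+ 2)).
  by field; rewrite !gt_eqF//; lra.
set G := 4 * N%:R ^+ 2 / p2 * Z in F1 F2 ZE *.
have w0 : 0 < p2 / (4 * N%:R ^+ 2) by rewrite divr_gt0// mulr_gt0.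
apply/andP; split; last first.
  rewrite ZE; apply: le_trans (_ : (2 * N%:R ^+ 2) / 3 * (p2 / (4 * N%:R ^+ 2)) <= _).
    by rewrite ler_pM2r//; lra.
  by rewrite le_eqVlt; apply/orP; left; apply/eqP; field; rewrite gt_eqF//; lra.
rewrite ZE; apply: le_trans (_ : ((2 * N%:R ^+ 2 - 5 * N%:R) / 3) * (p2 / (4 * N%:R ^+ 2)) <= _); last first.
  by rewrite ler_pM2r//; lra.
rewrite le_eqVlt; apply/orP; left; apply/eqP; field; rewrite !gt_eqF//; lra.
Qed.

Lemma zeta2_tail L D : (0 < L)%N -> zeta2 (L + D) <= zeta2 L + L%:R^-1 - (L + D)%:R^-1.
Proof.
move=> L0; elim: D => [|D IHD]; first by rewrite addn0; lra.
rewrite addnS {1}/zeta2 big_nat_recr//= -/(zeta2 (L + D)).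
have : 0 < (L + D)%:R :> R by rewrite ltr0n addn_gt0 L0.
rewrite -natr1; move: (L + D)%:R IHD => x IHD x0.
suff : (x + 1) ^- 2 <= x^-1 - (x + 1)^-1 by lra.
have -> : x^-1 - (x + 1)^-1 = (x * (x + 1))^-1 by field; rewrite !gt_eqF//; lra.
rewrite lef_pV2 ?posrE ?exprn_gt0 ?mulr_gt0//; nra.
Qed.

Lemma zeta2_mono L D : zeta2 L <= zeta2 (L + D).
Proof.
rewrite /zeta2 (big_cat_nat (n := L.+1) (p := (L + D).+1)) //=; last by rewrite ltnS leq_addr.
by rewrite lerDl sumr_ge0// => k _; rewrite invr_ge0 exprn_ge0.
Qed.

Lemma zeta2_bounds L : (0 < L)%N -> pi ^+ 2 / 6 - L%:R^-1 <= zeta2 L <= pi ^+ 2 / 6.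
Proof.
move=> L0; have LR : 0 < L%:R :> R by rewrite ltr0n.
have p6 : pi ^+ 2 / 6 <= 3 :> R.
  have := @pihalf_lt2 R; have := @pi_gt0 R; nra.
have far D : exists2 m, (0 < m)%N & (D <= (2 ^ m.-1).-1)%N.
  by exists D.+1 => //=; have := ltn_expl D (isT : 1 < 2)%N; lia.
apply/andP; split; last first.
  have [m m0 Lm] := far L; have /andP[_] := zeta2_dyadic m0.
  by apply: le_trans; rewrite -(subnKC Lm) zeta2_mono.
apply/ler_addgt0Pr => e e0.
have e15 : 0 <= 15 / e by rewrite divr_ge0// ltW.
have := archi_boundP e15.
set B := Num.bound _ => HB.
have [m m0 Lm] := far (L + B)%N; have /andP[low _] := zeta2_dyadic m0.
have LX : (L <= (2 ^ m.-1).-1)%N by lia.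
have tail := zeta2_tail ((2 ^ m.-1).-1 - L) L0; rewrite subnKC// in tail.
have Bm : B%:R <= (2 ^ m)%:R :> R.
  rewrite ler_nat; have : (2 ^ m.-1 <= 2 ^ m)%N by rewrite leq_exp2l// leq_pred.
  lia.
have m2 : 0 < (2 ^ m)%:R :> R by rewrite ltr0n expn_gt0.
have small : 5 / (2 ^ m)%:R <= e / 3.
  rewrite ler_pdivrMr// -ler_pdivrMl ?divr_gt0//.
  have -> : (e / 3)^-1 * 5 = 15 / e by field; rewrite gt_eqF.
  lra.
have last0 : 0 <= (2 ^ m.-1).-1%:R^-1 :> R by rewrite invr_ge0.
set u := 5 / _ in low small; set v := ((2 ^ m.-1).-1%:R^-1) in tail last0.
have p0 : 0 <= pi ^+ 2 / 6 :> R by rewrite divr_ge0// sqr_ge0.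
have : pi ^+ 2 / 6 * u <= 3 * (e / 3).
  by apply: ler_pM => //; rewrite divr_ge0// ltW.
lra.
Qed.

End Basel.

(** * Real part of the centred characteristic function *)

Section Centered.
Variable R : realType.
Implicit Types (b t r : R).

Definition geom_mean r : R := r / (1 - r).

(** The characteristic function of a geometric variable minus its mean; its third
    order Taylor coefficient is the first one that is not real. *)
Definition geom_centered r t : R[i] := geom_char r t * cis (- (geom_mean r * t)).

Lemma geom_mean_gt0 r : 0 < r < 1 -> 0 < geom_mean r.
Proof. by move=> /andP[r0 r1]; rewrite /geom_mean divr_gt0// subr_gt0. Qed.

Lemma geom_centeredE r t : 0 < r < 1 ->
  let m := geom_mean r in
  let A := 1 + m * (1 - cos t) in let B := m * sin t in
  geom_centered r t = ((A ^+ 2 + B ^+ 2)^-1)%:C *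
    ((A * cos (m * t) + B * sin (m * t)) +i* (B * cos (m * t) - A * sin (m * t))).
Proof.
move=> r01 m A B; have /andP[r0 r1] := r01.
have m0 : 0 < m by exact: geom_mean_gt0.
have A1 : 1 <= A.
  by rewrite /A lerDl mulr_ge0 ?(ltW m0)// subr_ge0 cos_le1.
have AB : 0 < A ^+ 2 + B ^+ 2 by rewrite ltr_pwDl ?exprn_gt0 ?sqr_ge0//; lra.
have dE : 1 - r%:C * cis t = (1 - r)%:C * (A -i* B).
  apply/eqP; rewrite eq_complex /= /A /B /m /geom_mean; apply/andP; split; apply/eqP; field; rewrite gt_eqF//; lra.
have r1C : (1 - r)%:C != 0 :> R[i].
  by rewrite -cabs_eq0 cabs_real normr_eq0 gt_eqF// subr_gt0.
have w0 : A -i* B != 0 by rewrite eq_complex /= negb_and gt_eqF//; lra.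
have gE : geom_char r t = ((A ^+ 2 + B ^+ 2)^-1)%:C * (A +i* B).
  rewrite /geom_char dE invfM mulrA divff// mul1r; apply: (mulIf w0); rewrite mulVf//.
  apply/eqP; rewrite eq_complex /=; apply/andP; split; apply/eqP; field; rewrite gt_eqF//.
rewrite /geom_centered -/m gE -mulrA; congr (_ * _).
rewrite /cis cosN sinN; apply/eqP; rewrite eq_complex /=; apply/andP; split; apply/eqP; ring.
Qed.

Lemma Im_realM x (z : R[i]) : complex.Im (x%:C * z) = x * complex.Im z.
Proof. by case: z => a c /=; rewrite mul0r addr0. Qed.

(** After multiplication by the squared denominator the imaginary part is
    m sin t cos(m t) - sin(m t) - m (1 - cos t) sin(m t), whose terms of order t cancel. *)
Lemma Im_geom_centered_le r t : 0 < r < 1 ->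
  `|complex.Im (geom_centered r t)| <=
  2 * `|t| ^+ 3 * (geom_mean r + geom_mean r ^+ 2 + geom_mean r ^+ 3).
Proof.
move=> r01; rewrite geom_centeredE// Im_realM /=.
have m0 := geom_mean_gt0 r01; set m := geom_mean r in m0 *; clearbody m.
set A := 1 + m * _; set B := m * sin t.
have A1 : 1 <= A.
  by rewrite /A lerDl mulr_ge0 ?(ltW m0)// subr_ge0 cos_le1.
have AB : 1 <= A ^+ 2 + B ^+ 2 by have := sqr_ge0 B; nra.
rewrite normrM ger0_norm; last by rewrite invr_ge0; lra.
apply: le_trans (_ : `|B * cos (m * t) - A * sin (m * t)| <= _).
  by rewrite ler_piMl// invf_le1; lra.
have -> : B * cos (m * t) - A * sin (m * t) =
  (- (m * (1 - cos t) * sin (m * t)) + m * (sin t - t) * cos (m * t))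
  + (m * t * cos (m * t) - sin (m * t)) by rewrite /A /B; ring.
have h1 := normr_sin_le (m * t); have h2 := one_sub_cos_le t.
have h3 := sin_id_bound t; have h4 := mul_cos_sub_sin (m * t).
have h5 := cos_max (m * t); have h6 : 0 <= 1 - cos t by rewrite subr_ge0 cos_le1.
apply: le_trans (ler_normD _ _) _.
have mt : `|m * t| = m * `|t| by rewrite normrM gtr0_norm.
rewrite mt in h1 h4.
have t0 : 0 <= `|t| by [].
have t2 : t ^+ 2 = `|t| ^+ 2 by rewrite real_normK ?num_real.
rewrite t2 in h2.
have k1 : `|m * (1 - cos t) * sin (m * t)| <= m * (`|t| ^+ 2 / 2) * (m * `|t|).
  rewrite !normrM (gtr0_norm m0) (ger0_norm h6).
  by apply: ler_pM => //; rewrite ?mulr_ge0 ?(ltW m0)// ler_wpM2l ?(ltW m0).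
have k2 : `|m * (sin t - t) * cos (m * t)| <= m * `|t| ^+ 3 * 1.
  rewrite !normrM (gtr0_norm m0).
  by apply: ler_pM => //; rewrite ?mulr_ge0 ?(ltW m0)// ler_wpM2l ?(ltW m0).
have k3 := ler_normD (- (m * (1 - cos t) * sin (m * t))) (m * (sin t - t) * cos (m * t)).
rewrite normrN in k3.
have t3 : 0 <= `|t| ^+ 3 by rewrite exprn_ge0.
have -> : 2 * `|t| ^+ 3 * (m + m ^+ 2 + m ^+ 3) =
  2 * (m * `|t| ^+ 3) + 2 * (m ^+ 2 * `|t| ^+ 3) + 2 * (m * `|t|) ^+ 3 by ring.
have e1 : m * (`|t| ^+ 2 / 2) * (m * `|t|) = (m ^+ 2 * `|t| ^+ 3) / 2 by field.
have : 0 <= m ^+ 2 * `|t| ^+ 3 by rewrite mulr_ge0// exprn_ge0// ltW.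
have : 0 <= m * `|t| ^+ 3 by rewrite mulr_ge0// ltW.
lra.
Qed.

Lemma mul_sin_ge0 s t : 0 <= s * t -> `|s| <= 2 -> `|t| <= 2 -> 0 <= sin s * sin t.
Proof.
have H (x y : R) : 0 <= x -> 0 <= y -> x <= 2 -> y <= 2 -> 0 <= sin x * sin y.
  move=> x0 y0 x2 y2.
  have := @sin_ge_third R x; rewrite x0 x2 => /(_ isT) => sx.
  have := @sin_ge_third R y; rewrite y0 y2 => /(_ isT) => sy.
  by rewrite mulr_ge0//; lra.
move=> st; rewrite !ler_norml => /andP[s1 s2] /andP[t1 t2].
have [s0|s0] := lerP 0 s; have [t0|t0] := lerP 0 t.
- exact: H.
- have [->|s00] := eqVneq s 0; first by rewrite sin0 mul0r.
  by have : 0 < s by [rewrite lt_neqAle eq_sym s00]; nra.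
- have [->|t00] := eqVneq t 0; first by rewrite sin0 mulr0.
  by have : 0 < t by [rewrite lt_neqAle eq_sym t00]; nra.
- by rewrite -mulrNN -!sinN H; lra.
Qed.

(** The numerator is (1 + m) cos(m t) - m cos(t + m t).  It is a sum of
    nonnegative terms if t is small, and close to 1 if m is small. *)
Lemma Re_geom_centered_ge0 r t : 0 < r < 1 -> geom_mean r * `|t| <= 1 ->
  `|t| <= 2 \/ geom_mean r <= 1 / 2 -> 0 <= complex.Re (geom_centered r t).
Proof.
move=> r01; rewrite geom_centeredE// Re_realM /=.
have m0 := geom_mean_gt0 r01; set m := geom_mean r in m0 *; clearbody m => mt h.
have mtE : `|m * t| = m * `|t| by rewrite normrM gtr0_norm.
have t0 : 0 <= `|t| by [].
have mt2 : (m * t) ^+ 2 <= 1.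
  by rewrite -real_normK ?num_real// mtE expr_le1 ?mulr_ge0// ltW.
have c1 := cos_ge (m * t).
apply: mulr_ge0; first by rewrite invr_ge0 addr_ge0// sqr_ge0.
case: h => h.
  have : 0 <= m * (1 - cos t) * cos (m * t).
    by rewrite !mulr_ge0 ?(ltW m0) ?subr_ge0 ?cos_le1//; lra.
  have : 0 <= m * (sin t * sin (m * t)).
    rewrite mulr_ge0 ?(ltW m0)// mul_sin_ge0//; last by rewrite mtE; lra.
    by rewrite mulrCA mulr_ge0 ?(ltW m0)// -expr2 sqr_ge0.
  lra.
have -> : (1 + m * (1 - cos t)) * cos (m * t) + m * sin t * sin (m * t) =
   (1 + m) * cos (m * t) - m * cos (t + m * t) by rewrite cosD; ring.
have : m * cos (t + m * t) <= m * 1 by rewrite ler_pM2l// cos_le1.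
have : (1 + m) * (1 - (m * t) ^+ 2 / 2) <= (1 + m) * cos (m * t) by rewrite ler_pM2l; lra.
have : (1 + m) * (m * t) ^+ 2 <= (1 + m) * 1 by rewrite ler_pM2l; lra.
lra.
Qed.

Lemma cabs_geom_centered r t : cabs (geom_centered r t) = cabs (geom_char r t).
Proof. by rewrite /geom_centered cabsM cabs_cis mulr1. Qed.

(** Telescoping, as all factors lie in the unit disc. *)
Lemma prod_near_real K (F : nat -> R[i]) :
  (forall k, cabs (F k) <= 1) ->
  cabs (\prod_(k < K) F k - (\prod_(k < K) complex.Re (F k))%:C) <= \sum_(k < K) `|complex.Im (F k)|.
Proof.
move=> F1; elim: K => [|K IHK]; first by rewrite !big_ord0 subrr cabs0.
rewrite !big_ord_recr /=; set P := \prod_(k < K) F k; set Q := \prod_(k < K) _.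
have -> : P * F K - (Q * complex.Re (F K))%:C =
   (P - Q%:C) * (complex.Re (F K))%:C + P * (F K - (complex.Re (F K))%:C).
  by rewrite rmorphM /=; ring.
apply: le_trans (ler_cabsD _ _) _; apply: lerD.
  rewrite cabsM -[leRHS]mulr1; apply: ler_pM => //.
  by rewrite cabs_real; apply: le_trans (Re_le_cabs _) _.
have -> : F K - (complex.Re (F K))%:C = 'i%C * (complex.Im (F K))%:C.
  by case: (F K) => a c /=; apply/eqP; rewrite eq_complex /=; apply/andP; split; apply/eqP; ring.
rewrite cabsM cabsM -[leRHS]mul1r; apply: ler_pM => //.
- exact: mulr_ge0.
- by rewrite /P cabs_prod; apply: prodr_ile1 => k _; rewrite cabs_ge0 F1.
- by rewrite cabs_real /cabs /= expr0n expr1n add0r sqrtr1 mul1r.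
Qed.

Lemma Re_prod_ge K (F : nat -> R[i]) :
  (forall k, cabs (F k) <= 1) -> (forall k, 0 <= complex.Re (F k)) ->
  \prod_(k < K) cabs (F k) - 2 * \sum_(k < K) `|complex.Im (F k)| <=
  complex.Re (\prod_(k < K) F k).
Proof.
move=> F1 F0; have := prod_near_real K F1.
set P := \prod_(k < K) F k; set Q := \prod_(k < K) complex.Re _; set S := \sum_(_ < _) _ => PQ.
have Q0 : 0 <= Q by rewrite prodr_ge0.
have cQ : cabs Q%:C = Q by rewrite cabs_real ger0_norm.
have h1 : cabs P - Q <= S.
  by have := @lerB_cabs R P (- Q%:C); rewrite cabsNE cQ => h; exact: le_trans h PQ.
have h2 : `|complex.Re (P - Q%:C)| <= S by apply: le_trans (Re_le_cabs _) PQ.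
have h3 : complex.Re (P - Q%:C) = complex.Re P - Q by case: (P) => a c.
rewrite h3 ler_norml in h2; move/andP: h2 => [h2 _].
by rewrite -cabs_prod -/P; lra.
Qed.

Lemma cabs_geom_char_ge r t : 0 < r < 1 ->
  expR (- (r / (1 - r) ^+ 2 * t ^+ 2 / 2)) <= cabs (geom_char r t).
Proof.
move=> r01; have /andP[r0 r1] := r01.
rewrite -(@ler_pXn2r _ 2%N) ?nnegrE ?expR_ge0// cabs_geom_char_sqr//.
have g := geom_gain_ge0 t r01.
rewrite -expRM_natl mulrN expRN lef_pV2 ?posrE ?expR_gt0//; last lra.
apply: le_trans (expR_ge1Dx _); rewrite lerD2l.
have s0 : 0 <= r / (1 - r) ^+ 2 by rewrite divr_ge0 ?sqr_ge0 ?ltW.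
have := one_sub_cos_le t; move: (r / _) s0 g => s s0 g h.
have : s * (1 - cos t) <= s * (t ^+ 2 / 2) by rewrite ler_wpM2l.
lra.
Qed.

End Centered.

Section Moments.
Variable R : realType.
Implicit Types (b t r x : R).

Lemma geom_mean_le x : 0 < x -> geom_mean (expR (- x)) <= x^-1.
Proof.
move=> x0; have /andP[r0 r1] := expRN_itv01 x0.
rewrite /geom_mean ler_pdivrMr ?subr_gt0// mulrC ler_pdivlMr//.
have : (1 + x) * expR (- x) <= 1.
  by rewrite expRN ler_pdivrMr ?expR_gt0// mul1r expR_ge1Dx.
lra.
Qed.

(** By 1 + x <= 6 exp(x / 6), cubed. *)
Lemma cube_expR_le x : 0 <= x -> (1 + x) ^+ 3 * expR (- x) <= 216 * expR (- (x / 2)).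
Proof.
move=> x0.
have h : (1 + x) <= 6 * expR (x / 6) by have := expR_ge1Dx (x / 6); lra.
have : (1 + x) ^+ 3 <= (6 * expR (x / 6)) ^+ 3 by rewrite lerXn2r ?nnegrE ?mulr_ge0 ?expR_ge0//; lra.
rewrite exprMn -expRM_natl => h3.
have -> : expR (- (x / 2)) = expR (3 * (x / 6)) * expR (- x).
  by rewrite -expRD; congr expR; field.
rewrite mulrA ler_pM2r ?expR_gt0//.
by apply: le_trans h3 _; rewrite ler_wpM2r ?expR_ge0//; lra.
Qed.

Lemma inv_one_sub_expR_le x : 0 < x -> (1 - expR (- x))^-1 <= (1 + x) / x.
Proof.
move=> x0; have /andP[r0 r1] := expRN_itv01 x0.
rewrite -[leRHS]invrK lef_pV2 ?posrE ?subr_gt0 ?invr_gt0 ?divr_gt0//; last lra.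
by rewrite invf_div one_sub_expR_ge// ltW.
Qed.

Lemma third_moment_le x : 0 < x ->
  expR (- x) / (1 - expR (- x)) ^+ 3 <= 216 * expR (- (x / 2)) / x ^+ 3.
Proof.
move=> x0; have /andP[r0 r1] := expRN_itv01 x0.
apply: le_trans (_ : expR (- x) * ((1 + x) / x) ^+ 3 <= _).
  rewrite ler_wpM2l ?expR_ge0// -exprVn lerXn2r ?nnegrE ?invr_ge0 ?inv_one_sub_expR_le//.
    by rewrite subr_ge0 ltW.
  by rewrite divr_ge0//; lra.
rewrite exprMn exprVn mulrA ler_pM2r ?invr_gt0 ?exprn_gt0// mulrC.
by apply: cube_expR_le; rewrite ltW.
Qed.

Lemma second_moment_le x : 0 < x ->
  expR (- x) / (1 - expR (- x)) ^+ 2 <= 216 * expR (- (x / 2)) / x ^+ 2.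
Proof.
move=> x0; have /andP[r0 r1] := expRN_itv01 x0.
apply: le_trans (_ : expR (- x) * ((1 + x) / x) ^+ 2 <= _).
  rewrite ler_wpM2l ?expR_ge0// -exprVn lerXn2r ?nnegrE ?invr_ge0 ?inv_one_sub_expR_le//.
    by rewrite subr_ge0 ltW.
  by rewrite divr_ge0//; lra.
rewrite exprMn exprVn mulrA ler_pM2r ?invr_gt0 ?exprn_gt0// mulrC.
apply: le_trans (_ : (1 + x) ^+ 3 * expR (- x) <= _).
  by rewrite ler_wpM2r ?expR_ge0// ler_weXn2l//; lra.
by apply: cube_expR_le; rewrite ltW.
Qed.

Lemma geom_mean_cubic_le x : 0 < x ->
  geom_mean (expR (- x)) + geom_mean (expR (- x)) ^+ 2 + geom_mean (expR (- x)) ^+ 3 <=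
  3 * (expR (- x) / (1 - expR (- x)) ^+ 3).
Proof.
move=> x0; have /andP[r0 r1] := expRN_itv01 x0; rewrite /geom_mean.
move: (expR (- x)) r0 r1 => r r0 r1.
have i1 : 1 <= (1 - r)^-1 by rewrite invf_ge1; lra.
rewrite -exprVn; move: (1 - r)^-1 i1 => i i1.
have i2 : i <= i ^+ 2 by rewrite expr2 ler_peMr//; lra.
have i3 : i ^+ 2 <= i ^+ 3 by rewrite [leRHS]exprS ler_peMl ?sqr_ge0.
rewrite !exprMn.
have r2 : r ^+ 2 <= r by rewrite expr2 ler_piMr//; lra.
have r3 : r ^+ 3 <= r by rewrite exprS ler_piMr ?exprn_ile1//; lra.
have i30 : 0 <= i ^+ 3 by rewrite exprn_ge0//; lra.
have i20 : 0 <= i ^+ 2 by rewrite exprn_ge0//; lra.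
have : r * i <= r * i ^+ 3 by rewrite ler_pM2l//; lra.
have : r ^+ 2 * i ^+ 2 <= r * i ^+ 3 by rewrite ler_pM ?sqr_ge0.
have : r ^+ 3 * i ^+ 3 <= r * i ^+ 3 by rewrite ler_wpM2r.
lra.
Qed.

Lemma sum_expR_le K x : 0 < x -> \sum_(k < K) expR (- (k.+1%:R * x)) <= x^-1.
Proof.
move=> x0; have /andP[r0 r1] := expRN_itv01 x0.
under eq_bigr do rewrite -mulrN expRM_natl.
apply: le_trans (geom_mean_le x0); rewrite /geom_mean.
rewrite ler_pdivlMr ?subr_gt0//; move: (expR (- x)) r0 r1 => r r0 r1.
have -> : (\sum_(k < K) r ^+ k.+1) * (1 - r) = r - r ^+ K.+1.
  elim: K => [|K IHK]; first by rewrite big_ord0 expr1; ring.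
  by rewrite big_ord_recr /= mulrDl IHK [r ^+ K.+2]exprS; ring.
by rewrite gerBl exprn_ge0// ltW.
Qed.

(** The mean size of the random partition with parts at most K. *)
Definition size_mean K b : R := \sum_(k < K) k.+1%:R * geom_mean (expR (- (k.+1%:R * b))).

Lemma size_char_centered K b t :
  size_char K b t * cis (- (size_mean K b * t)) =
  \prod_(k < K) geom_centered (expR (- (k.+1%:R * b))) (k.+1%:R * t).
Proof.
rewrite /size_char /size_mean mulr_suml -sumrN.
have -> : cis (\sum_(i < K) - (i.+1%:R * geom_mean (expR (- (i.+1%:R * b))) * t)) =
  \prod_(i < K) cis (- (i.+1%:R * geom_mean (expR (- (i.+1%:R * b))) * t)).
  by elim/big_rec2: _ => [|i x y _ E]; rewrite ?cis0 ?cisD ?E.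
rewrite -big_split /=; apply: eq_bigr => k _; rewrite /geom_centered; congr (_ * cis _).
ring.
Qed.

(** After centring, the product of the factors is within the sum of the imaginary
    parts, a third moment of order |t|^3 / b^4, of a nonnegative real number.  The
    variance, of order b^(-3), bounds its modulus below by exp(- C t^2 / b^3), and
    centring at n instead of the mean costs |size_mean - n| |t|. *)
Lemma Re_size_char_ge : exists2 C : R, 0 < C & forall K (n b t : R), 0 < b -> `|t| <= b ->
  expR (- (C * t ^+ 2 / b ^+ 3)) - C * (`|t| ^+ 3 / b ^+ 4) - `|size_mean K b - n| * `|t| <=
  complex.Re (size_char K b t * cis (- (n * t))).
Proof.
exists (4 * 6 * 216); first by rewrite !mulr_gt0.
move=> K n b t b0 tb.
apply: le_trans (_ : expR (- (216 * t ^+ 2 / b ^+ 3)) - 4 * 6 * 216 * (`|t| ^+ 3 / b ^+ 4)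
    - `|size_mean K b - n| * `|t| <= _).
  rewrite !lerD2r ler_expR lerN2 ler_pM2r ?invr_gt0 ?exprn_gt0//.
  by rewrite ler_wpM2r ?sqr_ge0// -[leLHS]mul1r ler_wpM2r//; lra.
have kb k : 0 < k.+1%:R * b by rewrite mulr_gt0.
have r01 k := expRN_itv01 (kb k).
set F := fun k : nat => geom_centered (expR (- (k.+1%:R * b))) (k.+1%:R * t).
have F1 k : cabs (F k) <= 1 by rewrite cabs_geom_centered cabs_geom_char_le1.
have F0 k : 0 <= complex.Re (F k).
  have ktE : `|k.+1%:R * t| = k.+1%:R * `|t| by rewrite normrM ger0_norm.
  have kt : `|k.+1%:R * t| <= k.+1%:R * b by rewrite ktE ler_wpM2l.
  have gm := geom_mean_le (kb k).
  apply: Re_geom_centered_ge0 => //.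
    apply: le_trans (_ : (k.+1%:R * b)^-1 * (k.+1%:R * b) <= _).
      by apply: ler_pM => //; rewrite ltW// geom_mean_gt0.
    by rewrite mulVf// gt_eqF.
  have [h|h] := lerP `|k.+1%:R * t| 2; [by left|right].
  apply: le_trans gm _; rewrite div1r lef_pV2 ?posrE//.
  by apply: le_trans kt; rewrite ltW.
have := Re_prod_ge K F1 F0; rewrite -size_char_centered.
set P := size_char K b t * cis _.
have -> : size_char K b t * cis (- (n * t)) = P + P * (cis ((size_mean K b - n) * t) - 1).
  rewrite mulrBr mulr1 addrC subrK /P -mulrA -cisD; congr (_ * cis _); ring.
have -> (z w : R[i]) : complex.Re (z + w) = complex.Re z + complex.Re w by case: z w => a c [a' c'].
have P1 : cabs P <= 1 by rewrite /P cabsM cabs_cis mulr1 cabs_size_char_le1.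
have h1 : - (`|size_mean K b - n| * `|t|) <= complex.Re (P * (cis ((size_mean K b - n) * t) - 1)).
  have : `|complex.Re (P * (cis ((size_mean K b - n) * t) - 1))| <= `|size_mean K b - n| * `|t|.
    apply: le_trans (Re_le_cabs _) _; rewrite cabsM -normrM -[leRHS]mul1r.
    by apply: ler_pM => //; exact: cabs_cis_sub1.
  by rewrite ler_norml => /andP[].
have h2 : expR (- (216 * t ^+ 2 / b ^+ 3)) <= \prod_(k < K) cabs (F k).
  apply: le_trans (_ : \prod_(k < K) expR (- (expR (- (k.+1%:R * b / 2)) * (216 * t ^+ 2 / (2 * b ^+ 2)))) <= _).
    rewrite -expR_sum sumrN ler_expR lerN2 -mulr_suml.
    have := @sum_expR_le K (b / 2); rewrite divr_gt0// => /(_ isT).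
    under eq_bigr do rewrite mulrA.
    move=> S; apply: le_trans (_ : (b / 2)^-1 * (216 * t ^+ 2 / (2 * b ^+ 2)) <= _).
      apply: ler_wpM2r S; apply: divr_ge0; first by apply: mulr_ge0 => //; exact: sqr_ge0.
      by apply: mulr_ge0 => //; exact: sqr_ge0.
    by rewrite le_eqVlt; apply/orP; left; apply/eqP; field; rewrite gt_eqF.
  apply: ler_prod => k _; apply/andP; split; first exact: expR_ge0.
  rewrite /F cabs_geom_centered.
  apply: le_trans (cabs_geom_char_ge _ (r01 k)); rewrite ler_expR lerN2.
  have := second_moment_le (kb k); set s := _ / _ => S.
  apply: le_trans (_ : 216 * expR (- (k.+1%:R * b / 2)) / (k.+1%:R * b) ^+ 2 * (k.+1%:R * t) ^+ 2 / 2 <= _).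
    by rewrite ler_pM2r// ler_wpM2r// sqr_ge0.
  by rewrite le_eqVlt; apply/orP; left; apply/eqP; field; rewrite !gt_eqF.
have h3 : \sum_(k < K) `|complex.Im (F k)| <= 2 * 6 * 216 * (`|t| ^+ 3 / b ^+ 4).
  apply: le_trans (_ : \sum_(k < K) expR (- (k.+1%:R * b / 2)) * (6 * 216 * (`|t| ^+ 3 / b ^+ 3)) <= _).
    apply: ler_sum => k _; apply: le_trans (Im_geom_centered_le _ (r01 k)) _.
    apply: le_trans (_ : 2 * `|k.+1%:R * t| ^+ 3 * (3 * (216 * expR (- (k.+1%:R * b / 2)) / (k.+1%:R * b) ^+ 3)) <= _).
      rewrite ler_wpM2l ?mulr_ge0 ?exprn_ge0//.
      apply: le_trans (geom_mean_cubic_le (kb k)) _; rewrite ler_pM2l//.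
      exact: third_moment_le.
    rewrite normrM ger0_norm//.
    by rewrite le_eqVlt; apply/orP; left; apply/eqP; field; rewrite !gt_eqF.
  rewrite -mulr_suml; have := @sum_expR_le K (b / 2); rewrite divr_gt0// => /(_ isT).
  under eq_bigr do rewrite mulrA.
  move=> S; apply: le_trans (_ : (b / 2)^-1 * (6 * 216 * (`|t| ^+ 3 / b ^+ 3)) <= _).
    apply: ler_wpM2r S; apply: mulr_ge0 => //; apply: divr_ge0; first exact: exprn_ge0.
    by apply: exprn_ge0; exact: ltW.
  by rewrite le_eqVlt; apply/orP; left; apply/eqP; field; rewrite gt_eqF.
lra.
Qed.

End Moments.

(** * The size_mean size *)

Section MeanBound.
Variable R : realType.
Implicit Types (b t r x y : R).

Lemma is_derive_expRN x : is_derive x 1 (fun y : R => expR (- y)) (- expR (- x)).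
Proof.
have H : is_derive x 1 (- (@id R)) (- 1) by apply: is_deriveN.
have := @is_derive1_comp R expR (- (@id R)) x (expR (- x)) (-1) (is_derive_expR (- x)) H.
by rewrite mulrN1.
Qed.

(** 2 y <= 2 sinh y <= 2 y cosh y. *)
Lemma sinh_bounds y : 0 <= y -> 2 * y <= expR y - expR (- y) <= y * (expR y + expR (- y)).
Proof.
move=> y0; apply/andP; split; rewrite -subr_ge0.
  apply: (@ge0_of_derive R (fun x : R => expR x - expR (- x) - 2 * x) (fun x : R => expR x + expR (- x) - 2)) => //.
  - move=> x; have -> : (fun x : R => expR x - expR (- x) - 2 * x) = expR - (fun x : R => expR (- x)) - (2 *: (@id R)).
      by [].
    have := is_derive_expRN x => H.
    by apply: is_derive_eq; rewrite /GRing.scale /=; ring.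
  - by rewrite oppr0 expR0; ring.
  - move=> x _; rewrite expRN; have := expR_gt0 x; move: (expR x) => u u0.
    have -> : u + u^-1 - 2 = (u - 1) ^+ 2 / u by field; rewrite gt_eqF.
    by rewrite divr_ge0 ?sqr_ge0 ?ltW.
apply: (@ge0_of_derive R (fun x : R => x * (expR x + expR (- x)) - (expR x - expR (- x)))
   (fun x : R => x * (expR x - expR (- x)))) => //.
- move=> x; have H := is_derive_expRN x.
  have -> : (fun x : R => x * (expR x + expR (- x)) - (expR x - expR (- x))) =
     (@id R) * (expR + (fun x : R => expR (- x))) - (expR - (fun x : R => expR (- x))) by [].
  by apply: is_derive_eq; rewrite /GRing.scale /= !fctE; ring.
- by rewrite oppr0 expR0; ring.
- move=> x /andP[x0 _]; rewrite mulr_ge0// subr_ge0 ler_expR; lra.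
Qed.

(** The middle term is 1 / (4 sinh(x/2)^2); the lower bound uses sinh y <= y cosh y
    and cosh^2 = 1 + sinh^2. *)
Lemma inv_sinh_bounds x : 0 < x ->
  x ^- 2 - 1 / 4 <= expR (- x) / (1 - expR (- x)) ^+ 2 <= x ^- 2.
Proof.
move=> x0; have /andP[r0 r1] := expRN_itv01 x0.
have /andP[s1 s2] := @sinh_bounds (x / 2) (ltW (divr_gt0 x0 (ltr0n _ 2))).
set u := expR (x / 2) in s1 s2; have u0 : 0 < u by exact: expR_gt0.
rewrite expRN -/u in s1 s2.
have -> : expR (- x) = u ^- 2 by rewrite expRN /u -expRM_natl; congr (expR _)^-1; field.
set S := u - u^-1 in s1 s2; set T := u + u^-1 in s2.
have TS : T ^+ 2 = S ^+ 2 + 4 by rewrite /T /S; field; rewrite gt_eqF.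
have S0 : 0 < S by lra.
have u1 : 1 < u by rewrite /u expR_gt1 divr_gt0.
have -> : u ^- 2 / (1 - u ^- 2) ^+ 2 = S ^- 2.
  by rewrite /S; field; rewrite !gt_eqF//; nra.
clearbody S T.
have h1 : x ^+ 2 <= S ^+ 2 by rewrite lerXn2r ?nnegrE ?(ltW x0) ?(ltW S0)//; lra.
have h2 : S ^+ 2 <= (x / 2 * T) ^+ 2.
  by rewrite lerXn2r ?nnegrE ?(ltW S0)//; lra.
have x2 : 0 < x ^+ 2 by rewrite exprn_gt0.
have S2 : 0 < S ^+ 2 by rewrite exprn_gt0.
apply/andP; split; last by rewrite lef_pV2 ?posrE.
rewrite exprMn TS in h2.
have -> : x ^- 2 - 1 / 4 = (1 - x ^+ 2 / 4) / x ^+ 2 by field; rewrite gt_eqF.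
rewrite ler_pdivrMr// [leRHS]mulrC ler_pdivlMr//.
lra.
Qed.

Lemma sum_arith_geom K x : (\sum_(k < K) k.+1%:R * x ^+ k.+1) * (1 - x) ^+ 2 =
  x - K.+1%:R * x ^+ K.+1 + K%:R * x ^+ K.+2.
Proof.
elim: K => [|K IHK]; first by rewrite big_ord0 !mul0r expr1 mul1r addr0 subrr.
rewrite big_ord_recr /= mulrDl IHK -!natr1 !exprS; ring.
Qed.

Lemma sum_arith_geom_bounds K x : 0 < x < 1 ->
  x / (1 - x) ^+ 2 * (1 - K.+1%:R * x ^+ K) <= \sum_(k < K) k.+1%:R * x ^+ k.+1 <=
  x / (1 - x) ^+ 2.
Proof.
move=> /andP[x0 x1]; have d0 : 0 < (1 - x) ^+ 2 by rewrite exprn_gt0// subr_gt0.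
have E := sum_arith_geom K x; have xK : 0 <= x ^+ K by rewrite exprn_ge0// ltW.
rewrite [x / _ * _]mulrAC ler_pdivrMr// ler_pdivlMr// E !exprS -natr1.
have K0 : 0 <= K%:R :> R by [].
have x00 := ltW x0; set v := x ^+ K in xK *; clearbody v.
have h1 : 0 <= x * v by exact: mulr_ge0.
have h2 : 0 <= K%:R * (x * v) by exact: mulr_ge0.
have h3 : 0 <= K%:R * (x * (x * v)) by apply: mulr_ge0 => //; exact: mulr_ge0.
have : K%:R * (x * (x * v)) <= K%:R * (x * v).
  by apply: ler_wpM2l => //; apply: ler_piMl => //; exact: ltW.
lra.
Qed.

Lemma geom_mean_expand r L : 0 < r < 1 ->
  geom_mean r = \sum_(l < L) r ^+ l.+1 + r ^+ L * geom_mean r.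
Proof.
move=> /andP[r0 r1]; have r1' : 1 - r != 0 by rewrite gt_eqF// subr_gt0.
elim: L => [|L IHL]; first by rewrite big_ord0 add0r mul1r.
rewrite big_ord_recr /= {1}IHL -addrA; congr (_ + _).
by rewrite /geom_mean !exprS; field.
Qed.

(** The sum of k / (exp(k b) - 1), expanded into geometric series of which the first
    L terms are kept and summed over k first. *)
Lemma size_mean_expand K L b : 0 < b ->
  size_mean K b = \sum_(l < L) (\sum_(k < K) k.+1%:R * expR (- (l.+1%:R * b)) ^+ k.+1) +
   \sum_(k < K) expR (- (k.+1%:R * b)) ^+ L * (k.+1%:R * geom_mean (expR (- (k.+1%:R * b)))).
Proof.
move=> b0; rewrite exchange_big -big_split /=; apply: eq_bigr => k _.
rewrite {1}(geom_mean_expand L (expRN_itv01 (mulr_gt0 (ltr0Sn R k) b0))).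
rewrite mulrDr mulr_sumr mulrCA; congr (_ + _); apply: eq_bigr => l _; congr (_ * _).
by rewrite -!expRM_natl; congr expR; ring.
Qed.

Lemma size_mean_rest_le K L b : 0 < b -> (0 < L)%N ->
  \sum_(k < K) expR (- (k.+1%:R * b)) ^+ L * (k.+1%:R * geom_mean (expR (- (k.+1%:R * b)))) <=
  (L%:R * b ^+ 2)^-1.
Proof.
move=> b0 L0; have LR : 0 < L%:R :> R by rewrite ltr0n.
apply: le_trans (_ : \sum_(k < K) expR (- (k.+1%:R * (L%:R * b))) * b^-1 <= _).
  apply: ler_sum => k _; have kb : 0 < k.+1%:R * b by rewrite mulr_gt0.
  have -> : expR (- (k.+1%:R * b)) ^+ L = expR (- (k.+1%:R * (L%:R * b))).
    by rewrite -expRM_natl; congr expR; ring.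
  rewrite ler_wpM2l ?expR_ge0//.
  apply: le_trans (_ : k.+1%:R * (k.+1%:R * b)^-1 <= _).
    by rewrite ler_wpM2l// geom_mean_le.
  by rewrite le_eqVlt; apply/orP; left; apply/eqP; field; rewrite !gt_eqF.
rewrite -mulr_suml; apply: le_trans (_ : (L%:R * b)^-1 * b^-1 <= _).
  by rewrite ler_wpM2r ?invr_ge0 ?(ltW b0)// sum_expR_le// mulr_gt0.
by rewrite -invfM le_eqVlt; apply/orP; left; apply/eqP; rewrite expr2 mulrA.
Qed.

Lemma size_mean_rest_ge0 K L b : 0 < b ->
  0 <= \sum_(k < K) expR (- (k.+1%:R * b)) ^+ L * (k.+1%:R * geom_mean (expR (- (k.+1%:R * b)))).
Proof.
move=> b0; apply: sumr_ge0 => k _; rewrite mulr_ge0 ?exprn_ge0 ?expR_ge0// mulr_ge0//.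
by rewrite ltW// geom_mean_gt0// expRN_itv01// mulr_gt0.
Qed.

Lemma sum_inv_sqr L b : \sum_(l < L) (l.+1%:R * b) ^- 2 = zeta2 R L / b ^+ 2.
Proof.
rewrite /zeta2 big_add1 /= big_mkord mulr_suml; apply: eq_bigr => l _.
by rewrite exprMn invfM.
Qed.

(** Summed over k, the l-th term of the expansion is 1 / (4 sinh(l b / 2)^2), that is
    1 / (l b)^2 + O(1).  For L of order 1 / b the sum over l is zeta(2) / b^2 + O(1 / b),
    and zeta(2) / b^2 = n. *)
Lemma size_mean_near n b : 0 < b <= 1 / 100 -> n%:R * b ^+ 2 = pi ^+ 2 / 6 ->
  `|size_mean n b - n%:R| <= 20 / b.
Proof.
move=> /andP[b0 b1] nb.
have p1 : 2 / 3 <= pi ^+ 2 / 6 :> R by have := @pi_ge2 R; nra.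
have b2 : 0 < b ^+ 2 by rewrite exprn_gt0.
have nE : n%:R = pi ^+ 2 / 6 / b ^+ 2 :> R by rewrite -nb mulfK// gt_eqF.
have ib : 0 <= b^-1 by rewrite invr_ge0 ltW.
have /andP[L1 L2] := Num.Theory.trunc_itv ib.
set L := (Num.trunc b^-1).+1 in L2.
have LE : L%:R = (Num.trunc b^-1)%:R + 1 :> R by rewrite natr1.
have ib1 : 1 <= b^-1 by rewrite invf_ge1//; lra.
have LR : 0 < L%:R :> R by rewrite ltr0n.
have /andP[Z1 Z2] := @zeta2_bounds R L isT.
have Lb : (L%:R * b ^+ 2)^-1 <= b^-1.
  rewrite lef_pV2 ?posrE ?mulr_gt0// expr2 mulrA ler_peMl ?(ltW b0)//.
  by rewrite -ler_pdivrMr// mul1r ltW.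
have rest1 := size_mean_rest_le n b0 (isT : 0 < L)%N.
have rest0 := size_mean_rest_ge0 n L b0.
rewrite (size_mean_expand n L b0); set X := \sum_(k < n) _ in rest1 rest0 *.
have lb l : 0 < l.+1%:R * b by rewrite mulr_gt0.
have S2 : \sum_(l < L) (l.+1%:R * b) ^- 2 <= n%:R.
  by rewrite sum_inv_sqr nE ler_pM2r ?invr_gt0.
have U : \sum_(l < L) (\sum_(k < n) k.+1%:R * expR (- (l.+1%:R * b)) ^+ k.+1) <= n%:R.
  apply: le_trans S2; apply: ler_sum => l _.
  have /andP[_ h] := sum_arith_geom_bounds n (expRN_itv01 (lb l)).
  by apply: le_trans h _; have /andP[] := inv_sinh_bounds (lb l).
set q := n.+1%:R * expR (- b) ^+ n.
have q0 : 0 <= q by rewrite mulr_ge0// exprn_ge0// expR_ge0.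
have Low : \sum_(l < L) ((l.+1%:R * b) ^- 2 - 1 / 4 - q * (l.+1%:R * b) ^- 2) <=
   \sum_(l < L) (\sum_(k < n) k.+1%:R * expR (- (l.+1%:R * b)) ^+ k.+1).
  apply: ler_sum => l _.
  have /andP[h _] := sum_arith_geom_bounds n (expRN_itv01 (lb l)).
  apply: le_trans h; have /andP[h1 h2] := inv_sinh_bounds (lb l).
  set s := expR _ / _ in h1 h2 *.
  have s0 : 0 <= s by rewrite divr_ge0 ?expR_ge0// sqr_ge0.
  have : n.+1%:R * expR (- (l.+1%:R * b)) ^+ n <= q.
    rewrite ler_pM2l// lerXn2r ?nnegrE ?expR_ge0// ler_expR lerN2.
    by rewrite ler_peMl ?(ltW b0)// ler1n.
  move: (_ * _ ^+ n) => q' q'q.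
  have : s * q' <= (l.+1%:R * b) ^- 2 * q.
    apply: le_trans (_ : s * q <= _); first by rewrite ler_wpM2l.
    by rewrite ler_wpM2r.
  move: ((l.+1%:R * b) ^- 2) h1 h2 => A h1 h2; clearbody q s; lra.
rewrite !sumrB -[X in _ - X <= _]mulr_sumr sum_inv_sqr sumr_const card_ord -[_ *+ L]mulr_natr in Low.
have ZL : n%:R - b^-1 <= zeta2 R L / b ^+ 2.
  apply: le_trans (_ : (pi ^+ 2 / 6 - L%:R^-1) / b ^+ 2 <= _); last by rewrite ler_pM2r ?invr_gt0.
  rewrite mulrBl -nE -invfM; lra.
(* exp(n b) >= (n b)^3 / 6, and n b is of order 1 / b. *)
have qn : q * (zeta2 R L / b ^+ 2) <= 18 * b^-1.
  apply: le_trans (_ : q * n%:R <= _).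
    by apply: ler_wpM2l => //; rewrite nE ler_pM2r ?invr_gt0.
  have n1 : 1 <= n%:R :> R.
    rewrite ler1n lt0n; apply/eqP => n0; move: nb; rewrite n0 mul0r; lra.
  have e3 := @expR_ge_pow R (n%:R * b) 3 (mulr_ge0 (ler0n _ _) (ltW b0)).
  rewrite /q -expRM_natl mulrN expRN.
  have nb0 : 0 < (n%:R * b) ^+ 3 by rewrite exprn_gt0// mulr_gt0//; lra.
  have e3' : (expR (n%:R * b))^-1 <= 6 * (n%:R * b) ^- 3.
    by rewrite ler_pdivlMr// mulrC ler_pdivrMr ?expR_gt0.
  apply: le_trans (_ : (2 * n%:R) * (6 * (n%:R * b) ^- 3) * n%:R <= _).
    apply: ler_wpM2r => //; apply: ler_pM => //.
    by rewrite -natr1; lra.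
  have -> : 2 * n%:R * (6 * (n%:R * b) ^- 3) * n%:R = 12 / (n%:R * b ^+ 2) / b :> R.
    by field; rewrite !gt_eqF//; lra.
  rewrite ler_pM2r ?invr_gt0// nb ler_pdivrMr; lra.
by rewrite ler_norml; apply/andP; split; lra.
Qed.

End MeanBound.

(** * Sums over the sample points *)

Section Sampling.
Variable R : realType.
Implicit Types (a b t x : R).

Lemma sample_mesh_gt0 L : 0 < sample_mesh R L.
Proof. by rewrite /sample_mesh divr_gt0 ?mulr_gt0 ?pi_gt0// ltr0n addn1. Qed.

Lemma sample_angle_right L i : `|sample_angle R L (i + L)| = i%:R * sample_mesh R L.
Proof.
rewrite /sample_angle natrD addrK ger0_norm// mulr_ge0// ltW//; exact: sample_mesh_gt0.
Qed.

Lemma sample_angle_left L i : (i < L)%N -> `|sample_angle R L (L - i.+1)| = i.+1%:R * sample_mesh R L.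
Proof.
move=> iL; have -> : sample_angle R L (L - i.+1) = - (i.+1%:R * sample_mesh R L).
  by rewrite /sample_angle natrB//; ring.
by rewrite normrN ger0_norm// mulr_ge0// ltW//; exact: sample_mesh_gt0.
Qed.

Lemma sample_angle_le_pi L (j : 'I_(2 * L + 1)) : `|sample_angle R L j| <= pi.
Proof.
have jL : `|(j%:R - L%:R) : R| <= L%:R.
  have : (j <= 2 * L)%N by have := ltn_ord j; move: (nat_of_ord j) => i; lia.
  rewrite -(ler_nat R) natrM => h; have : 0 <= j%:R :> R by [].
  by rewrite ler_norml => j0; apply/andP; split; lra.
rewrite /sample_angle normrM [X in _ * X]ger0_norm; last by rewrite ltW//; exact: sample_mesh_gt0.
apply: le_trans (_ : L%:R * sample_mesh R L <= _).
  by rewrite ler_wpM2r// ltW//; exact: sample_mesh_gt0.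
have E : (2 * L + 1)%:R = 2 * L%:R + 1 :> R by rewrite natrD natrM.
have L0 : 0 <= L%:R :> R by [].
rewrite /sample_mesh E mulrA ler_pdivrMr; last lra.
have := @pi_gt0 R; lra.
Qed.

(** Comparison with two geometric series. *)
Lemma sum_expR_sample_le L a : 0 < a -> a <= (2 * L + 1)%:R ->
  \sum_(j < 2 * L + 1) expR (- (a * `|sample_angle R L j|)) <= 3 * (2 * L + 1)%:R / a.
Proof.
move=> a0 aM; have s0 := sample_mesh_gt0 L.
set s := sample_mesh R L in s0.
have as0 : 0 < a * s by rewrite mulr_gt0.
set x := expR (- (a * s)); have /andP[x0 x1] := expRN_itv01 as0.
have G : \sum_(0 <= i < L.+1) x ^+ i <= 1 + (a * s)^-1.
  apply: le_trans (_ : (1 - x)^-1 <= _); last first.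
    apply: le_trans (inv_one_sub_expR_le as0) _.
    by rewrite mulrDl mul1r divff ?gt_eqF// addrC.
  rewrite big_mkord -[leRHS]mul1r ler_pdivlMr ?subr_gt0//.
  have : x ^+ L.+1 - 1 = (x - 1) * \sum_(i < L.+1) x ^+ i by exact: subrX1.
  have : 0 <= x ^+ L.+1 by rewrite exprn_ge0// ltW.
  lra.
have xE i : expR (- (a * (i%:R * s))) = x ^+ i.
  by rewrite /x -expRM_natl; congr expR; ring.
rewrite -(big_mkord predT (fun j => expR (- (a * `|sample_angle R L j|)))).
rewrite (big_cat_nat (n := L)) //=; last by lia.
have right_half : \sum_(L <= j < 2 * L + 1) expR (- (a * `|sample_angle R L j|)) <= 1 + (a * s)^-1.
  apply: le_trans G; rewrite -[X in \sum_(X <= _ < _) _]add0n big_addn.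
  have -> : (2 * L + 1 - L = L.+1)%N by lia.
  by under eq_bigr do rewrite sample_angle_right xE.
have left_half : \sum_(0 <= j < L) expR (- (a * `|sample_angle R L j|)) <= 1 + (a * s)^-1.
  apply: le_trans G; rewrite big_nat_rev /= big_nat_recr //= add0n.
  apply: le_trans (_ : \sum_(0 <= i < L) x ^+ i <= _); last first.
    by rewrite lerDl exprn_ge0// ltW.
  rewrite !big_nat; apply: ler_sum => i /andP[_ iL].
  by rewrite sample_angle_left// xE exprS ler_piMl ?exprn_ge0 ?(ltW x0) ?(ltW x1).
have M0 : 0 < (2 * L + 1)%:R :> R by rewrite ltr0n addn1.
set M := (2 * L + 1)%:R in aM M0 *.
have asV : (a * s)^-1 <= M / a / 2.
  have -> : (a * s)^-1 = M / a / 2 / pi.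
    rewrite /s /sample_mesh -/M; have := @pi_gt0 R; move: (@pi R) => P P0.
    by field; rewrite !gt_eqF.
  rewrite ler_pdivrMr ?pi_gt0// ler_peMr//.
    by rewrite !divr_ge0// ltW.
  by have := @pi_ge2 R; lra.
have : 1 <= M / a by rewrite ler_pdivlMr// mul1r.
rewrite -mulrA; lra.
Qed.

(** The points to the right of the centre already suffice. *)
Lemma count_sample_ge L x : (0 < L)%N -> 0 < x <= 1 ->
  (2 * L + 1)%:R * x / 8 <= \sum_(j < 2 * L + 1) (`|sample_angle R L j| <= x)%R%:R :> R.
Proof.
move=> L0 /andP[x0 x1]; have s0 := sample_mesh_gt0 L.
have M0 : 0 < (2 * L + 1)%:R :> R by rewrite ltr0n addn1.
have xs0 : 0 <= x / sample_mesh R L by rewrite divr_ge0// ltW.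
have /andP[k1 k2] := Num.Theory.trunc_itv xs0.
set k := Num.trunc _ in k1 k2.
have xsE : x / sample_mesh R L = (2 * L + 1)%:R * x / (2 * pi).
  by rewrite /sample_mesh; have := @pi_gt0 R; move: (@pi R) => P P0; field; rewrite !gt_eqF.
have kL : (k <= L)%N.
  rewrite -(ler_nat R); apply: le_trans k1 _; rewrite xsE.
  rewrite ler_pdivrMr ?mulr_gt0 ?pi_gt0//.
  have LR : 1 <= L%:R :> R by rewrite ler1n.
  have := @pi_ge2 R; move: (@pi R) => P P2; rewrite natrD natrM; nra.
apply: le_trans (_ : k.+1%:R <= _).
  apply: le_trans (ltW k2); rewrite xsE ler_pM2l ?mulr_gt0//.
  rewrite lef_pV2 ?posrE ?mulr_gt0 ?pi_gt0//.
  by have := @pihalf_lt2 R; lra.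
rewrite -(big_mkord predT (fun j => (`|sample_angle R L j| <= x)%R%:R)).
rewrite (big_cat_nat (n := L)) //=; last by lia.
rewrite (big_cat_nat (m := L) (n := (L + k.+1)%N)) //=; [|lia..].
rewrite addrCA; apply: le_trans (_ : \sum_(L <= j < L + k.+1) 1 <= _).
  by rewrite sumr_const_nat addKn.
apply: le_trans (_ : \sum_(L <= j < L + k.+1) (`|sample_angle R L j| <= x)%R%:R <= _).
  rewrite !big_nat; apply: ler_sum => j /andP[Lj jk].
  rewrite -(subnK Lj) sample_angle_right.
  have : (j - L)%:R <= k%:R :> R by rewrite ler_nat; lia.
  move=> jk'; have -> : (j - L)%:R * sample_mesh R L <= x by rewrite -ler_pdivlMr//; lra.
  by [].
by rewrite lerDl addr_ge0// sumr_ge0.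
Qed.

End Sampling.

(** * The lower bound for p(n) *)

Section PartitionValue.
Variable R : realType.
Implicit Types (a b t x : R).

Definition partition_weight K b : R := \prod_(k < K) (1 - expR (- (k.+1%:R * b)))^-1.

Lemma partition_weight_gt0 K b : 0 < b -> 0 < partition_weight K b.
Proof.
move=> b0; apply: prodr_gt0 => k _; rewrite invr_gt0 subr_gt0.
by have /andP[] := expRN_itv01 (mulr_gt0 (ltr0Sn R k) b0).
Qed.

(** The numerators of the finite geometric sums; the product tends to 1 as J
    grows. *)
Definition truncation K J b t : R[i] := \prod_(k < K) (1 - qpt b t ^+ (k.+1 * J.+1)).

Lemma horner_partition_poly K J b t : 0 < b ->
  (partition_poly R[i] K J).[qpt b t] =
  (partition_weight K b)%:C * size_char K b t * truncation K J b t.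
Proof.
move=> b0; rewrite /partition_poly horner_prod /partition_weight rmorph_prod /=.
rewrite /size_char /truncation -!big_split /=; apply: eq_bigr => k _.
have r01 := expRN_itv01 (mulr_gt0 (ltr0Sn R k) b0).
have d0 := geom_denom_neq0 (k.+1%:R * t) r01.
have qE : (expR (- (k.+1%:R * b)))%:C * cis (k.+1%:R * t) = qpt b t ^+ k.+1 by rewrite qptX.
rewrite /geom_char qE; rewrite qE in d0.
have r1C : (1 - expR (- (k.+1%:R * b)))%:C != 0 :> R[i].
  rewrite -cabs_eq0 cabs_real normr_eq0 gt_eqF// subr_gt0.
  by case/andP: r01.
rewrite fmorphV mulrA mulVf// mul1r horner_sum.
under eq_bigr do rewrite hornerXn exprM.
rewrite exprM; set z := qpt b t ^+ k.+1 in d0 *.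
have h : z ^+ J.+1 - 1 = (z - 1) * \sum_(i < J.+1) z ^+ i by exact: subrX1.
have -> : 1 - z ^+ J.+1 = (1 - z) * \sum_(i < J.+1) z ^+ i by rewrite -opprB h -mulNr opprB.
by rewrite mulrA mulVf// mul1r.
Qed.

Lemma cabs_prod_sub1 K (x : nat -> R[i]) (d : R) : d <= 1 -> (forall k, cabs (x k) <= d) ->
  cabs (\prod_(k < K) (1 - x k) - 1) <= 2 ^+ K * d.
Proof.
move=> d1 xd; have d0 : 0 <= d by apply: le_trans (xd 0%N).
suff : cabs (\prod_(k < K) (1 - x k) - 1) <= (2 ^+ K - 1) * d by nra.
elim: K => [|K IHK]; first by rewrite big_ord0 !subrr mul0r cabs0.
rewrite big_ord_recr /=; set P := \prod_(_ < _) _ in IHK *.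
have -> : P * (1 - x K) - 1 = (P - 1) * (1 - x K) + - x K by ring.
have h : cabs (1 - x K) <= 2.
  by have := @ler_cabsB R 1 (x K); have := xd K; rewrite cabs1; lra.
apply: le_trans (cabsD_le (cabsM_le IHK h) (lexx _)) _; rewrite cabsNE.
by have := xd K; rewrite exprS; nra.
Qed.

Lemma truncation_near1 K b e : 0 < b -> 0 < e ->
  exists J0, forall J, (J0 <= J)%N -> forall t, cabs (truncation K J b t - 1) <= e.
Proof.
move=> b0 e0; pose d := Num.min 1 (e / 2 ^+ K).
have d0 : 0 < d by rewrite lt_min ltr01 divr_gt0// exprn_gt0.
have [I HI] := expRN_pow_le b0 d0.
exists I => J IJ t; apply: le_trans (_ : 2 ^+ K * d <= _); last first.
  by rewrite mulrC -ler_pdivlMr ?exprn_gt0// ge_min lexx orbT.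
apply: (@cabs_prod_sub1 K (fun k => qpt b t ^+ (k.+1 * J.+1)) d).
  by rewrite ge_min lexx.
move=> k; rewrite cabs_qptX; apply: HI; apply: leq_trans IJ _.
by rewrite (leq_trans (leqnSn J))// leq_pmull.
Qed.

(** Discrete Fourier inversion for the partition polynomial; replacing the numerators
    by 1 changes each sample by at most e. *)
Lemma p_fourier (K J L n : nat) b e : 0 < b ->
  (n <= K)%N -> (n <= J)%N -> (size (partition_poly R[i] K J) <= 2 * L + 1)%N ->
  (n < 2 * L + 1)%N -> (forall t, cabs (truncation K J b t - 1) <= e) ->
  partition_weight K b * (\sum_(j < 2 * L + 1)
     complex.Re (size_char K b (sample_angle R L j) * cis (- (n%:R * sample_angle R L j))) - (2 * L + 1)%:R * e) <=
  (p n)%:R * expR (- (n%:R * b)) * (2 * L + 1)%:R.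
Proof.
move=> b0 nK nJ sT nL trunc.
have := coef_dft b sT nL; rewrite coef_partition_poly//.
move=> /(congr1 (@complex.Re R)).
have -> : complex.Re ((p n)%:R * (expR (- (n%:R * b)))%:C * (2 * L + 1)%:R) =
   (p n)%:R * expR (- (n%:R * b)) * (2 * L + 1)%:R.
  rewrite -(rmorph_nat (real_complex R) (p n)) -(rmorph_nat (real_complex R) (2 * L + 1)).
  by rewrite -!rmorphM.
move=> ->; rewrite Re_sum.
have -> : (2 * L + 1)%:R * e = \sum_(j < 2 * L + 1) e by rewrite sumr_const card_ord mulr_natl.
rewrite -sumrB mulr_sumr; apply: ler_sum => j _.
have w0 := partition_weight_gt0 K b0.
rewrite horner_partition_poly//.
set N := truncation _ _ _ _; set z := size_char _ _ _ * cis _.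
have -> : (partition_weight K b)%:C * size_char K b (sample_angle R L j) * N * cis (- (n%:R * sample_angle R L j)) =
  (partition_weight K b)%:C * (z * N) by rewrite /z; ring.
rewrite Re_realM ler_pM2l//.
have -> : z * N = z + z * (N - 1) by ring.
have -> (u v : R[i]) : complex.Re (u + v) = complex.Re u + complex.Re v.
  by case: u v => a c [a' c'].
rewrite lerD2l.
have : `|complex.Re (z * (N - 1))| <= 1 * e.
  apply: le_trans (Re_le_cabs _) _; apply: cabsM_le; last exact: trunc.
  by rewrite /z cabsM cabs_cis mulr1 cabs_size_char_le1.
by rewrite mul1r ler_norml => /andP[].
Qed.

End PartitionValue.

Section LowerBound.
Variable R : realType.
Implicit Types (a b t x h : R).

Lemma expR_neg_le x : 0 < x -> expR (- x) <= x^-1.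
Proof.
move=> x0; rewrite expRN lef_pV2 ?posrE ?expR_gt0//.
by have := expR_ge1Dx x; lra.
Qed.

(** One bound for all t, in terms of exponentials that are easy to sum over
    the sample points: a positive contribution from |t| <= h^3, a small error up to
    X h^3 from [Re_size_char_ge], and the tail beyond from [size_char_bound]. *)
Lemma Re_size_char_pointwise : exists2 c : R, 0 < c & exists2 C : R, 0 < C &
  forall n (b h X t : R), 0 < h <= 1 / 10 -> h ^+ 2 = b ->
  n%:R * b ^+ 2 = pi ^+ 2 / 6 -> 1 <= X -> h * X <= 1 -> `|t| <= pi ->
  expR (- C) * (`|t| <= h ^+ 3)%R%:R
    - C * (X ^+ 3 * h) * (4 * expR (- ((X * h ^+ 3)^-1 * `|t|)))
    - expR (- (c * X ^+ 2 / 2)) * expR (- (c * X / (2 * h ^+ 3) * `|t|))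
    - expR (- (c / b)) <=
  complex.Re (size_char n b t * cis (- (n%:R * t))).
Proof.
have [c c_gt0 Hc] := size_char_bound R; have [C0 C0_gt0 HC] := Re_size_char_ge R.
exists c => //; exists (C0 + 20); first by rewrite addr_gt0.
move=> n b h X t /andP[h_gt0 h1] hb nb X1 hX tpi.
have X0 : 0 < X by exact: lt_le_trans X1.
have b0 : 0 < b by rewrite -hb exprn_gt0.
have b1 : b <= 1 / 100 by rewrite -hb; nra.
have hc : 0 < h ^+ 3 by rewrite exprn_gt0.
have nb4 : 4 <= n%:R * b.
  have : n%:R * b ^+ 2 <= n%:R * b * (1 / 100) by rewrite expr2 mulrA ler_wpM2l// mulr_ge0// ltW.
  by rewrite nb; have := @pi_ge2 R; nra.
have mn := @size_mean_near R n b; rewrite b0 b1 in mn; have {}mn := mn isT nb.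
have b3 : b ^+ 3 = (h ^+ 3) ^+ 2 by rewrite -hb -!exprM.
have b4 : b ^+ 4 = h ^+ 3 * (h ^+ 3 * h ^+ 2) by rewrite -hb -!exprD -exprM.
set B := (C0 + 20) * (X ^+ 3 * h).
set T := expR (- (c * X ^+ 2 / 2)).
have C20 : 0 < C0 + 20 by rewrite addr_gt0.
have B0 : 0 < B by rewrite !mulr_gt0// exprn_gt0.
set u := `|t| / h ^+ 3.
have tE : `|t| = u * h ^+ 3 by rewrite /u divfK// gt_eqF.
have u0 : 0 <= u by rewrite divr_ge0// ltW.
have e0 : 0 <= expR (- (c / b)) by exact: expR_ge0.
have T0 : 0 <= T by exact: expR_ge0.
have -> : (X * h ^+ 3)^-1 * `|t| = u / X by rewrite tE; field; rewrite !gt_eqF.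
have -> : c * X / (2 * h ^+ 3) * `|t| = c * X * u / 2 by rewrite tE; field; rewrite !gt_eqF.
have [uX|Xu] := lerP u X.
  have tb : `|t| <= b.
    rewrite tE -hb exprS mulrA ler_piMl ?sqr_ge0//.
    apply: le_trans hX; rewrite mulrC ler_pM2l//.
  have := HC n n%:R b t b0 tb.
  have -> : `|t| ^+ 3 / b ^+ 4 = u ^+ 3 * h by rewrite tE b4; field; rewrite gt_eqF.
  have -> : C0 * t ^+ 2 / b ^+ 3 = C0 * u ^+ 2.
    by rewrite -[t ^+ 2]real_normK ?num_real// tE b3; field; rewrite gt_eqF.
  have k1 : `|size_mean n b - n%:R| * `|t| <= 20 * (u * h).
    apply: le_trans (_ : 20 / b * `|t| <= _); first by rewrite ler_wpM2r.
    by rewrite tE -hb le_eqVlt; apply/orP; left; apply/eqP; field; rewrite gt_eqF.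
  have u3 : u ^+ 3 * h <= X ^+ 3 * h by rewrite ler_pM2r// lerXn2r ?nnegrE// ltW.
  have uh : u * h <= X ^+ 3 * h.
    rewrite ler_pM2r//; apply: le_trans uX _; rewrite exprS ler_peMr ?(ltW X0)//.
    by rewrite exprn_ege1.
  have e4 : 1 <= 4 * expR (- (u / X)).
    have : expR (-1) <= expR (- (u / X)).
      by rewrite ler_expR lerN2 ler_pdivrMr// mul1r.
    suff : 1 / 4 <= expR (-1) :> R by lra.
    have h2' : 1 / 2 <= expR (- (1 / 2)) :> R by have := expR_ge1Dx (- (1 / 2) : R); lra.
    have -> : expR (-1) = expR (- (1 / 2)) * expR (- (1 / 2)) :> R.
      by rewrite -expRD; congr expR; field.
    have -> : 1 / 4 = (1 / 2) * (1 / 2) :> R by field.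
    by apply: ler_pM.
  have BB : C0 * (u ^+ 3 * h) + 20 * (u * h) <= B * (4 * expR (- (u / X))).
    apply: le_trans (_ : B <= _); last by rewrite ler_peMr// ltW.
    have : C0 * (u ^+ 3 * h) <= C0 * (X ^+ 3 * h) by rewrite ler_pM2l.
    by rewrite /B; lra.
  have TT : 0 <= T * expR (- (c * X * u / 2)) by rewrite mulr_ge0// expR_ge0.
  have AA : expR (- (C0 + 20)) * (`|t| <= h ^+ 3)%R%:R <= expR (- (C0 * u ^+ 2)).
    case: (lerP `|t| (h ^+ 3)) => th /=; last by rewrite mulr0 expR_ge0.
    have u1 : u <= 1 by rewrite ler_pdivrMr// mul1r.
    have u2 : u ^+ 2 <= 1 by rewrite expr_le1.
    rewrite mulr1 ler_expR lerN2; have := ler_piMr (ltW C0_gt0) u2; lra.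
  lra.
have th : (`|t| <= h ^+ 3)%R = false.
  by apply/negbTE; rewrite -ltNge tE ltr_pMl//; lra.
rewrite th mulr0 sub0r.
have B4 : 0 <= B * (4 * expR (- (u / X))) by apply: mulr_ge0; [exact: ltW B0|rewrite mulr_ge0 ?expR_ge0].
have zb := Hc n b t; rewrite b0 b1 in zb; have {zb} zb := zb isT nb4 tpi.
have r1 : `|complex.Re (size_char n b t * cis (- (n%:R * t)))| <=
    expR (- (c * t ^+ 2 / b ^+ 3)) + expR (- (c / b)).
  by apply: le_trans (Re_le_cabs _) _; rewrite cabsM cabs_cis mulr1.
have r2 : expR (- (c * t ^+ 2 / b ^+ 3)) <= T * expR (- (c * X * u / 2)).
  rewrite /T -expRD ler_expR -opprD lerN2.
  have -> : c * t ^+ 2 / b ^+ 3 = c * u ^+ 2.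
    by rewrite -[t ^+ 2]real_normK ?num_real// tE b3; field; rewrite gt_eqF.
  have -> : c * X ^+ 2 / 2 + c * X * u / 2 = c * (X * (X + u) / 2) by field.
  rewrite ler_pM2l//; nra.
by move: r1; rewrite ler_norml => /andP[]; lra.
Qed.

(** For X large the tail is small against the contribution of |t| <= h^3; once X is
    fixed, so are the remaining errors if h is small. *)
Lemma sum_Re_size_char_ge : exists2 c0 : R, 0 < c0 & exists2 h0 : R, 0 < h0 &
  forall n (b h : R), 0 < h <= h0 -> h ^+ 2 = b -> n%:R * b ^+ 2 = pi ^+ 2 / 6 ->
  exists L0, forall L, (L0 <= L)%N ->
  c0 * h ^+ 3 * (2 * L + 1)%:R <=
  \sum_(j < 2 * L + 1) complex.Re (size_char n b (sample_angle R L j) * cis (- (n%:R * sample_angle R L j))).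
Proof.
have [c c_gt0 [C C_gt0 point]] := Re_size_char_pointwise.
pose A : R := expR (- C); have A0 : 0 < A by exact: expR_gt0.
(* With this X the tail weighs at most A / 32. *)
pose X : R := 1 + (12 * 32) / (c ^+ 2 * A).
have cA : 0 < c ^+ 2 * A by rewrite mulr_gt0// exprn_gt0.
have XA : (12 * 32) <= X * (c ^+ 2 * A).
  have -> : X * (c ^+ 2 * A) = c ^+ 2 * A + 12 * 32 by rewrite /X; field; rewrite !gt_eqF.
  by rewrite lerDr ltW.
have X1 : 1 <= X by rewrite /X lerDl divr_ge0// ltW.
have AE : A = expR (- C) by [].
clearbody X A.
have X0 : 0 < X by lra.
pose h0 : R := Num.min (Num.min (1 / 10) X^-1)
  (Num.min (A / ((12 * 32) * (C * X ^+ 4))) (A * c ^+ 3 / (6 * 32))).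
have D0 : 0 < (12 * 32) * (C * X ^+ 4) by rewrite !mulr_gt0// exprn_gt0.
have h00 : 0 < h0.
  have c30 : 0 < A * c ^+ 3 / (6 * 32) by rewrite divr_gt0// mulr_gt0// exprn_gt0.
  have D1 := divr_gt0 A0 D0; have t1 : 0 < 1 / 10 :> R by lra.
  by rewrite !lt_min invr_gt0 X0 t1 D1 c30.
exists (A / 32); first by rewrite divr_gt0.
exists h0 => // n b h /andP[h_gt0]; rewrite !le_min => /andP[/andP[h1 h2] /andP[h3 h4]] hb nb.
have b0 : 0 < b by rewrite -hb exprn_gt0.
have hX : h * X <= 1.
  have : h * X <= X^-1 * X by rewrite ler_pM2r.
  by rewrite mulVf ?gt_eqF.
have {}h3 : h * ((12 * 32) * (C * X ^+ 4)) <= A by rewrite -ler_pdivlMr.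
have hc : 0 < h ^+ 3 by rewrite exprn_gt0.
have b3 : b ^+ 3 = (h ^+ 3) ^+ 2 by rewrite -hb -!exprM.
have Xh : 0 < (X * h ^+ 3)^-1 by rewrite invr_gt0 mulr_gt0.
have cX : 0 < c * X / (2 * h ^+ 3).
  by apply: divr_gt0; [exact: mulr_gt0|rewrite mulr_gt0].
have HL0 := archi_boundP (addr_ge0 (ltW Xh) (ltW cX)).
set L0 := Num.bound _ in HL0.
exists L0.+1 => L L0L.
set M := (2 * L + 1)%:R.
have LM : L0%:R <= M :> R by rewrite ler_nat; move: L0L; clear; lia.
have a1 : (X * h ^+ 3)^-1 <= M by lra.
have a2 : c * X / (2 * h ^+ 3) <= M by lra.
have E1 := sum_expR_sample_le Xh a1.
have E2 := sum_expR_sample_le cX a2.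
have L1 : (0 < L)%N by move: L0L; clear; lia.
have h_le1 : h <= 1 by clear -h1; lra.
have h31 : 0 < h ^+ 3 <= 1 by rewrite hc exprn_ile1// ltW.
have E3 := @count_sample_ge R L (h ^+ 3) L1 h31.
set B := C * (X ^+ 3 * h).
set T := expR (- (c * X ^+ 2 / 2)).
have B0 : 0 < B by rewrite !mulr_gt0// exprn_gt0.
apply: le_trans (_ : \sum_(j < 2 * L + 1)
   (A * (`|sample_angle R L j| <= h ^+ 3)%R%:R - B * (4 * expR (- ((X * h ^+ 3)^-1 * `|sample_angle R L j|)))
   - T * expR (- (c * X / (2 * h ^+ 3) * `|sample_angle R L j|)) - expR (- (c / b))) <= _); last first.
  apply: ler_sum => j _; rewrite AE; apply: point => //; first by rewrite h_gt0.
  exact: sample_angle_le_pi.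
rewrite !sumrB -!mulr_sumr sumr_const card_ord -[_ *+ _]mulr_natr -/M.
set S1 := \sum_(_ < _) _ in E3 *; set S2 := \sum_(_ < _) expR (- ((X * _)^-1 * _)) in E1 *.
set S3 := \sum_(_ < _) _ in E2 *.
rewrite -/M in E1 E2 E3.
have M0 : 0 < M by rewrite ltr0n addn1.
have F1 : A * (M * h ^+ 3 / 8) <= A * S1 by rewrite ler_pM2l.
have F2 : B * (4 * S2) <= A * (M * h ^+ 3 / 32).
  apply: le_trans (_ : B * (4 * (3 * M * (X * h ^+ 3))) <= _).
    by rewrite ler_pM2l// ler_pM2l// -[X in 3 * M * X]invrK.
  have -> : B * (4 * (3 * M * (X * h ^+ 3))) = (h * ((12 * 32) * (C * X ^+ 4))) * (M * h ^+ 3 / 32).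
    by rewrite /B; field.
  by rewrite ler_pM2r// divr_gt0// mulr_gt0.
have F3 : T * S3 <= A * (M * h ^+ 3 / 32).
  have X2 : 0 < c * X ^+ 2 / 2 by rewrite divr_gt0// mulr_gt0// exprn_gt0.
  apply: le_trans (_ : (c * X ^+ 2 / 2)^-1 * (3 * M / (c * X / (2 * h ^+ 3))) <= _).
    apply: ler_pM => //; [exact: expR_ge0|by apply: sumr_ge0 => j _; exact: expR_ge0|exact: expR_neg_le].
  have -> : (c * X ^+ 2 / 2)^-1 * (3 * M / (c * X / (2 * h ^+ 3))) =
     (12 * 32) / (c ^+ 2 * X ^+ 3) * (M * h ^+ 3 / 32) by field; rewrite !gt_eqF.
  rewrite ler_pM2r; last by rewrite divr_gt0// mulr_gt0.
  rewrite ler_pdivrMr; last by rewrite mulr_gt0// exprn_gt0.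
  have -> : A * (c ^+ 2 * X ^+ 3) = (X * (c ^+ 2 * A)) * X ^+ 2 by ring.
  apply: le_trans XA _; rewrite ler_peMr//; first by rewrite mulr_ge0// ltW.
  by rewrite exprn_ege1.
have F4 : expR (- (c / b)) * M <= A * (M * h ^+ 3 / 32).
  have e3 := @expR_ge_pow R (c / b) 3 (ltW (divr_gt0 c_gt0 b0)).
  have cb : 0 < (c / b) ^+ 3 by rewrite exprn_gt0// divr_gt0.
  have e4 : expR (- (c / b)) <= 6 / (c / b) ^+ 3.
    by rewrite expRN ler_pdivlMr// mulrC ler_pdivrMr ?expR_gt0.
  apply: le_trans (_ : 6 / (c / b) ^+ 3 * M <= _); first by rewrite ler_pM2r.
  have -> : 6 / (c / b) ^+ 3 * M = h ^+ 3 * ((6 * 32) / c ^+ 3) * (M * h ^+ 3 / 32).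
    by rewrite exprMn exprVn b3; field; rewrite !gt_eqF.
  rewrite ler_pM2r; last by rewrite divr_gt0// mulr_gt0.
  have hh : h ^+ 3 <= h by rewrite exprS ler_piMr ?(ltW h_gt0)// exprn_ile1 ?(ltW h_gt0).
  apply: le_trans (_ : (A * c ^+ 3 / (6 * 32)) * ((6 * 32) / c ^+ 3) <= _).
    rewrite ler_pM2r; last by rewrite divr_gt0// exprn_gt0.
    exact: le_trans hh h4.
  by rewrite le_eqVlt; apply/orP; left; apply/eqP; field; rewrite gt_eqF// exprn_gt0.
have AM : A / 32 * h ^+ 3 * M = A * (M * h ^+ 3 / 8) - 3 * (A * (M * h ^+ 3 / 32)) by field.
clear -F1 F2 F3 F4 AM E3; lra.
Qed.

End LowerBound.

(** * Comparison of N(m, n) and p(n) *)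

Section Assembly.
Variable R : realType.
Implicit Types (a b t x h : R).

(** The factor of P whose coefficients give N(m, n) - b/4 sech(b m / 2)^2 p(n). *)
Definition rank_gap b t i m : R[i] :=
  rank_series b t i m - rank_series b t i m.+1 - (sech_profile b m)%:C.

Lemma rank_gap_far b t i m : 0 < b <= 1 / 100 -> cabs (rank_gap b t i m) <= 3 / b.
Proof.
move=> /andP[b0 b1]; have ib : 1 <= b^-1 by rewrite invf_ge1//; lra.
have g := geom_mean_le b0; rewrite /geom_mean in g.
have r1 := rank_series_le t i m b0; have r2 := rank_series_le t i m.+1 b0.
have s0 : cabs (sech_profile b m)%:C <= 1.
  rewrite cabs_real ger0_norm; first by apply: le_trans (sech_profile_le m b0) _; lra.
  by apply: le_trans (sech_profile_ge m b0); rewrite divr_ge0// mulr_ge0 ?(ltW b0)// exprn_ge0// expR_ge0.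
apply: le_trans (cabsB_le (cabsB_le r1 r2) s0) _; lra.
Qed.

(** For |t| <= b both factors are estimated precisely, the polynomial growth of
    the gap in |t| / h^3 being absorbed by the Gaussian.  For larger t the exponential
    decay of [size_char] wins against the crude bound O(1 / b). *)
Lemma pointwise_bound : exists2 c : R, 0 < c & exists2 C : R, 0 < C &
  forall n (b h : R), 0 < b <= 1 / 100 -> 0 < h -> h ^+ 2 = b -> 4 <= n%:R * b ->
  exists I, forall i, (I <= i)%N -> forall t m, `|t| <= pi ->
  cabs (size_char n b t) * cabs (rank_gap b t i m) <=
  C * (b * expR (- b) ^+ m * (h + m%:R * h ^+ 3)) * expR (- (h ^- 3 * `|t|)) +
  C * (expR (- (c / b)) * (expR (m%:R * b) / b)).
Proof.
have [c c0 Hc] := size_char_bound R; have [C C0 HC] := rank_series_diff R.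
exists c => //; pose E := expR (c^-1); have E1 : 1 <= E.
  by have := expR_ge1Dx c^-1; have : 0 <= c^-1 by [rewrite invr_ge0 ltW]; rewrite /E; lra.
exists (C * E + 3 * C + 6); first by rewrite !addr_gt0 ?mulr_gt0 ?expR_gt0.
move=> n b h b01 h0 hb nb; have /andP[b0 b1] := b01.
have [I HI] := HC b h b01 h0 hb.
exists I => i Ii t m tpi.
have P := Hc n b t b01 nb tpi.
have h1 : h <= 1 / 10 by rewrite -(@ler_pXn2r _ 2%N) ?nnegrE ?hb//; lra.
have hc : 0 < h ^+ 3 by rewrite exprn_gt0.
have b3 : b ^+ 3 = (h ^+ 3) ^+ 2 by rewrite -hb -!exprM.
set u := `|t| / h ^+ 3.
have tE : `|t| = u * h ^+ 3 by rewrite /u divfK// gt_eqF.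
have u0 : 0 <= u by rewrite divr_ge0// ltW.
have -> : h ^- 3 * `|t| = u by rewrite /u mulrC.
clearbody u.
have tu : c * t ^+ 2 / b ^+ 3 = c * u ^+ 2.
  by rewrite -[t ^+ 2]real_normK ?num_real// tE b3; field; rewrite gt_eqF.
rewrite tu in P.
have eb0 : 0 < expR (- (c / b)) by exact: expR_gt0.
have eu0 : 0 < expR (- u) by exact: expR_gt0.
have m0 : 0 <= m%:R :> R by [].
have mb0 : 0 <= m%:R * b by rewrite mulr_ge0// ltW.
have em : 1 + m%:R * b <= expR (m%:R * b) := expR_ge1Dx _.
have /andP[rho0 rho1] := expRN_itv01 b0.
set rm := expR (- b) ^+ m.
have rm0 : 0 < rm by rewrite exprn_gt0.
have rm1 : rm <= 1 by rewrite exprn_ile1// ltW.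
have ib : 1 <= b^-1 by rewrite invf_ge1//; lra.
set X := b * rm * (h + m%:R * h ^+ 3).
have X0 : 0 <= X.
  apply: mulr_ge0; first by rewrite mulr_ge0// ltW.
  by rewrite addr_ge0 ?(ltW h0)// mulr_ge0// ltW.
set Y := expR (m%:R * b) / b.
have Y0 : 0 < Y by rewrite divr_gt0// expR_gt0.
have Yb : b^-1 <= Y by rewrite /Y ler_peMl ?invr_ge0 ?(ltW b0)//; lra.
have XE : 0 <= X * expR (- u) by rewrite mulr_ge0// ltW.
have EY : 0 < expR (- (c / b)) * Y by rewrite mulr_gt0.
have [tb|tb] := lerP `|t| b.
  have := HI i Ii t m tb; rewrite -/(rank_gap b t i m) -/rm => G.
  have uh : u * h <= 1.
    rewrite -(@ler_pM2r _ b)// mul1r; apply: le_trans tb.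
    by rewrite tE -hb le_eqVlt; apply/orP; left; apply/eqP; ring.
  have tbE : `|t| / b = u * h by rewrite tE -hb; field; rewrite gt_eqF.
  rewrite tbE in G.
  have G1 : cabs (rank_gap b t i m) <= C * X * (1 + u).
    apply: le_trans G _.
    have -> : C * X * (1 + u) = C * b * rm * ((h + m%:R * h ^+ 3) * (1 + u)) by rewrite /X; ring.
    apply: ler_wpM2l; first by rewrite !mulr_ge0 ?(ltW C0) ?(ltW b0) ?(ltW rm0).
    rewrite tE; have : 0 <= m%:R * h ^+ 3 by rewrite mulr_ge0// ltW.
    lra.
  have G2 : cabs (rank_gap b t i m) <= 3 * C * Y.
    have Q0 : 0 <= h + u * h + m%:R * `|t|.
      by rewrite addr_ge0 ?mulr_ge0// addr_ge0 ?(ltW h0)// mulr_ge0// ltW.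
    apply: le_trans G _; apply: le_trans (_ : C * (h + u * h + m%:R * `|t|) <= _).
      apply: ler_wpM2r => //; rewrite -mulrA ler_piMr ?(ltW C0)//.
      by rewrite mulr_ile1 ?(ltW b0) ?(ltW rm0)//; lra.
    rewrite -mulrA [3 * _]mulrCA ler_pM2l//.
    have : m%:R * `|t| <= m%:R * b by rewrite ler_wpM2l.
    have : expR (m%:R * b) <= Y by rewrite /Y ler_peMr ?expR_ge0.
    lra.
  (* 2 u <= c u^2 + 1 / c, and E = exp(1 / c). *)
  have k1 : expR (- (c * u ^+ 2)) * (1 + u) <= E * expR (- u).
    apply: le_trans (_ : expR (- (c * u ^+ 2)) * expR u <= _).
      by rewrite ler_wpM2l ?expR_ge0 ?expR_ge1Dx.
    rewrite /E -!expRD ler_expR.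
    have : 0 <= (c * u - 1) ^+ 2 / c by rewrite divr_ge0 ?sqr_ge0 ?ltW.
    have -> : (c * u - 1) ^+ 2 / c = c * u ^+ 2 - 2 * u + c^-1 by field; rewrite gt_eqF.
    lra.
  apply: le_trans (_ : (expR (- (c * u ^+ 2)) + expR (- (c / b))) * cabs (rank_gap b t i m) <= _).
    by rewrite ler_wpM2r.
  rewrite mulrDl.
  have k2 : expR (- (c * u ^+ 2)) * cabs (rank_gap b t i m) <= C * E * (X * expR (- u)).
    apply: le_trans (_ : expR (- (c * u ^+ 2)) * (C * X * (1 + u)) <= _).
      by rewrite ler_wpM2l ?expR_ge0.
    have -> : expR (- (c * u ^+ 2)) * (C * X * (1 + u)) = (C * X) * (expR (- (c * u ^+ 2)) * (1 + u)) by ring.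
    have -> : C * E * (X * expR (- u)) = (C * X) * (E * expR (- u)) by ring.
    by rewrite ler_wpM2l// mulr_ge0// ltW.
  have k3 : expR (- (c / b)) * cabs (rank_gap b t i m) <= 3 * C * (expR (- (c / b)) * Y).
    by rewrite mulrCA ler_pM2l.
  have CE : 0 < C * E by rewrite mulr_gt0// expR_gt0.
  have : 0 <= (3 * C + 6) * (X * expR (- u)) by rewrite mulr_ge0//; lra.
  have : 0 <= (C * E + 6) * (expR (- (c / b)) * Y) by rewrite mulr_ge0 ?(ltW EY)//; lra.
  lra.
have P2 : cabs (size_char n b t) <= 2 * expR (- (c / b)).
  apply: le_trans P _; have : expR (- (c * u ^+ 2)) <= expR (- (c / b)).
    rewrite ler_expR lerN2 -tu -mulrA ler_pM2l//.
    have : b ^+ 2 <= t ^+ 2.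
      rewrite -[t ^+ 2]real_normK ?num_real//.
      by apply: lerXn2r; rewrite ?nnegrE ?(ltW b0) ?(ltW tb).
    move=> bt; have -> : b^-1 = b ^+ 2 / b ^+ 3 by field; rewrite gt_eqF.
    by rewrite ler_pM2r// invr_gt0 exprn_gt0.
  lra.
have G := rank_gap_far t i m b01.
apply: le_trans (_ : (2 * expR (- (c / b))) * (3 * Y) <= _).
  apply: ler_pM => //; apply: le_trans G _; lra.
have CE : 0 < C * E by rewrite mulr_gt0// expR_gt0.
have : 0 <= (C * E + 3 * C + 6) * (X * expR (- u)) by rewrite mulr_ge0//; lra.
have : 0 <= (C * E + 3 * C) * (expR (- (c / b)) * Y) by rewrite mulr_ge0 ?(ltW EY)//; lra.
lra.
Qed.

Lemma N_fourier (K J L n i : nat) (m : int) b : 0 < b ->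
  (0 < n)%N -> (n <= K)%N -> (n <= J)%N -> (n <= i)%N ->
  let U := partition_poly R[i] K J *
    (rank_poly R[i] i `|m|%N - rank_poly R[i] i `|m|%N.+1 - (sech_profile b `|m|%N)%:C%:P) in
  (size U <= 2 * L + 1)%N -> (n < 2 * L + 1)%N ->
  (forall t, cabs (truncation K J b t - 1) <= 1) ->
  `|(N m n)%:R - sech_profile b `|m|%N * (p n)%:R| * expR (- (n%:R * b)) * (2 * L + 1)%:R <=
  2 * partition_weight K b * \sum_(j < 2 * L + 1)
    cabs (size_char K b (sample_angle R L j)) * cabs (rank_gap b (sample_angle R L j) i `|m|%N).
Proof.
move=> b0 n0 nK nJ ni U sU nL trunc.
have [G rG NE] := N_rank_recursion m.
have Tp l : (l <= n)%N -> (partition_poly R[i] K J)`_l = (p l)%:R.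
  by move=> ln; rewrite coef_partition_poly// (leq_trans ln).
have Un : U`_n = ((N m n)%:R - sech_profile b `|m|%N * (p n)%:R)%:C.
  rewrite /U !mulrBr !coefB coefMC !(coef_rank_poly _ rG Tp) ?n0// Tp// NE natrD addrK.
  move: (sech_profile b _) => s; rewrite rmorphB rmorphM !rmorph_nat; congr (_ - _); exact: mulrC.
have := coef_dft b sU nL; rewrite Un => /(congr1 (@cabs R)).
rewrite !cabsM !cabs_real (ger0_norm (expR_ge0 _)).
have -> : cabs (2 * L + 1)%:R = (2 * L + 1)%:R :> R.
  by rewrite -(rmorph_nat (real_complex R)) cabs_real ger0_norm.
move=> ->; apply: le_trans (cabs_sum _ _ _) _; rewrite mulr_sumr.
apply: ler_sum => j _; rewrite cabsM cabs_cis mulr1 /U hornerM cabsM horner_partition_poly//.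
have -> : (rank_poly R[i] i `|m|%N - rank_poly R[i] i `|m|%N.+1 - (sech_profile b `|m|%N)%:C%:P).[qpt b (sample_angle R L j)]
   = rank_gap b (sample_angle R L j) i `|m|%N.
  by rewrite /rank_gap /rank_series !hornerD !hornerN hornerC.
rewrite mulrA ler_wpM2r// !cabsM cabs_real ger0_norm; last by rewrite ltW// partition_weight_gt0.
have : cabs (truncation K J b (sample_angle R L j)) <= 2.
  have := ler_cabsD (truncation K J b (sample_angle R L j) - 1) 1.
  by rewrite subrK cabs1; have := trunc (sample_angle R L j); lra.
set w := partition_weight K b * _ => T2.
have -> : 2 * partition_weight K b * cabs (size_char K b (sample_angle R L j)) = w * 2 by rewrite /w; ring.
by rewrite ler_wpM2l// /w mulr_ge0// ltW// partition_weight_gt0.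
Qed.

Lemma sample_count_bounds (x y n a d : nat) : let L := (x + y + n + a + d)%N in
  [/\ (x <= 2 * L + 1)%N, (y <= 2 * L + 1)%N, (n < 2 * L + 1)%N, (a <= L)%N & (d <= 2 * L + 1)%N].
Proof. by move=> L; rewrite /L; split; lia. Qed.

(** The upper bound for the difference and the lower bound for p(n) share the
    factor P(exp(- b)) exp(n b) h^3, which cancels in the quotient. *)
Lemma N_relative_error : exists2 c : R, 0 < c & exists2 C : R, 0 < C & exists2 h0 : R, 0 < h0 &
  forall n (m : int) (b h : R), 0 < h <= h0 -> h ^+ 2 = b -> n%:R * b ^+ 2 = pi ^+ 2 / 6 ->
  exists2 e : R,
    `|e| <= C * (h + `|m|%N%:R * h ^+ 3 + expR (- (c / b)) * expR (2 * (`|m|%N%:R * b)) / h ^+ 7) &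
    (N m n)%:R = sech_profile b `|m|%N * (p n)%:R * (1 + e).
Proof.
have [c c_gt0 [C C_gt0 HC]] := pointwise_bound.
have [c0 c0_gt0 [h0 h00 Hlow]] := sum_Re_size_char_ge R.
exists c => //; exists (48 * C / c0); first by rewrite divr_gt0// mulr_gt0.
exists (Num.min h0 (1 / 10)); first by rewrite lt_min h00; lra.
move=> n m b h /andP[h_gt0]; rewrite le_min => /andP[hh0 h1] hb nb.
have b0 : 0 < b by rewrite -hb exprn_gt0.
have b1 : b <= 1 / 100 by rewrite -hb; nra.
have b01 : 0 < b <= 1 / 100 by rewrite b0.
have hc : 0 < h ^+ 3 by rewrite exprn_gt0.
have nb4 : 4 <= n%:R * b.
  have : n%:R * b ^+ 2 <= n%:R * b * (1 / 100) by rewrite expr2 mulrA ler_wpM2l// mulr_ge0// ltW.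
  by rewrite nb; have := @pi_ge2 R; nra.
have n_gt0 : (0 < n)%N by rewrite lt0n; apply/eqP => n0; move: nb4; rewrite n0 mul0r; lra.
have [I HI] := HC n b h b01 h_gt0 hb nb4.
have hpos : 0 < h <= h0 by rewrite h_gt0.
have [L0 HL0] := Hlow n b h hpos hb nb.
pose ee := Num.min 1 (c0 * h ^+ 3 / 2).
have ee0 : 0 < ee by rewrite lt_min ltr01 divr_gt0// mulr_gt0.
have [J0 HJ0] := truncation_near1 n b0 ee0.
pose J := (n + J0)%N; pose i := (n + I)%N.
have nJ : (n <= J)%N by exact: leq_addr.
have ni : (n <= i)%N by exact: leq_addr.
have trunc := HJ0 J (leq_addl _ _).
set mu := `|m|%N.
pose U := partition_poly R[i] n J *
    (rank_poly R[i] i mu - rank_poly R[i] i mu.+1 - (sech_profile b mu)%:C%:P).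
pose B := Num.bound (h ^- 3).
pose L := (size U + size (partition_poly R[i] n J) + n + L0 + B)%N.
have [sU sT nL L0L BL] := sample_count_bounds (size U) (size (partition_poly R[i] n J)) n L0 B.
rewrite -/L in sU sT nL L0L BL.
have low := p_fourier b0 (leqnn n) nJ sT nL trunc.
have trunc1 t : cabs (truncation n J b t - 1) <= 1.
  by apply: le_trans (trunc t) _; rewrite ge_min lexx.
have up := N_fourier b0 n_gt0 (leqnn n) nJ ni sU nL trunc1.
set M := (2 * L + 1)%:R in low up.
have M0 : 0 < M by rewrite ltr0n addn1.
have w0 := partition_weight_gt0 n b0.
set w := partition_weight n b in low up w0.
have HL := HL0 L L0L; rewrite -/M in HL.
set q := expR (- (n%:R * b)) in low up.
have q0 : 0 < q by exact: expR_gt0.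
have {}low : w * (c0 * h ^+ 3 / 2) <= (p n)%:R * q.
  rewrite -(ler_pM2r M0); apply: le_trans low; rewrite -(mulrA w) ler_pM2l//.
  have : M * ee <= M * (c0 * h ^+ 3 / 2) by rewrite ler_pM2l// ge_min lexx orbT.
  lra.
have hi : 0 < h ^- 3 by rewrite invr_gt0.
have aM : h ^- 3 <= M.
  apply: le_trans (ltW (archi_boundP (ltW hi))) _; by rewrite ler_nat.
have E1 := sum_expR_sample_le hi aM; rewrite -/M in E1.
set rm := expR (- b) ^+ mu.
have rm0 : 0 < rm by rewrite exprn_gt0// expR_gt0.
set X := b * rm * (h + mu%:R * h ^+ 3).
have X0 : 0 < X.
  by rewrite mulr_gt0 ?mulr_gt0// ltr_pwDl// mulr_ge0// ltW.
set Y := expR (- (c / b)) * (expR (mu%:R * b) / b).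
have Y0 : 0 < Y by rewrite mulr_gt0 ?expR_gt0// divr_gt0 ?expR_gt0.
have {}up : `|(N m n)%:R - sech_profile b mu * (p n)%:R| * q <= 2 * w * (C * X * (3 * h ^+ 3) + C * Y).
  rewrite -(ler_pM2r M0); apply: le_trans up _; rewrite -[leRHS]mulrA ler_pM2l ?mulr_gt0//.
  apply: le_trans (_ : \sum_(j < 2 * L + 1) (C * X * expR (- (h ^- 3 * `|sample_angle R L j|)) + C * Y) <= _).
    apply: ler_sum => j _; apply: HI; [exact: leq_addl|exact: sample_angle_le_pi].
  rewrite big_split /= -mulr_sumr sumr_const card_ord -[_ *+ _]mulr_natr -/M mulrDl lerD2r.
  apply: le_trans (_ : C * X * (3 * M / h ^- 3) <= _).
    by rewrite ler_pM2l// mulr_gt0.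
  by rewrite invrK le_eqVlt; apply/orP; left; apply/eqP; ring.
set H0 := sech_profile b mu in up *.
have HH : b * rm / 4 <= H0 by apply: sech_profile_ge.
have H00 : 0 < H0 by apply: lt_le_trans HH; rewrite divr_gt0// mulr_gt0.
have p0 : 0 < (p n)%:R :> R.
  have : 0 < w * (c0 * h ^+ 3 / 2) by rewrite mulr_gt0// divr_gt0// mulr_gt0.
  by move=> /lt_le_trans/(_ low); rewrite pmulr_lgt0.
exists ((N m n)%:R / (H0 * (p n)%:R) - 1); last first.
  by rewrite addrC subrK mulrC divfK// gt_eqF// mulr_gt0.
have -> : (N m n)%:R / (H0 * (p n)%:R) - 1 = ((N m n)%:R - H0 * (p n)%:R) / (H0 * (p n)%:R).
  by field; rewrite !gt_eqF.
set D := _ - _ in up *.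
have HP : 0 < H0 * (p n)%:R by exact: mulr_gt0.
have HPV : 0 < (H0 * (p n)%:R)^-1 by rewrite invr_gt0.
rewrite normrM (gtr0_norm HPV) ler_pdivrMr//.
rewrite -(ler_pM2r q0); apply: le_trans up _.
set Z := _ + _ / h ^+ 7.
have Z0 : 0 <= Z.
  apply: addr_ge0; first by apply: addr_ge0; [exact: ltW|rewrite mulr_ge0// ltW].
  apply: divr_ge0; first by rewrite mulr_ge0 ?expR_ge0.
  by apply: exprn_ge0; exact: ltW.
apply: le_trans (_ : 48 * C / c0 * Z * (b * rm / 4 * (w * (c0 * h ^+ 3 / 2))) <= _); last first.
  rewrite -[leRHS]mulrA; apply: ler_wpM2l.
    by apply: mulr_ge0 => //; rewrite divr_ge0 ?mulr_ge0 ?(ltW C_gt0) ?(ltW c0_gt0).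
  rewrite -(mulrA H0); apply: ler_pM => //.
    by rewrite divr_ge0// mulr_ge0 ?(ltW b0) ?(ltW rm0).
  by rewrite mulr_ge0 ?(ltW w0)// divr_ge0// mulr_ge0 ?(ltW c0_gt0) ?(ltW hc).
have -> : 48 * C / c0 * Z * (b * rm / 4 * (w * (c0 * h ^+ 3 / 2))) = 2 * w * (C * (3 * (b * rm * h ^+ 3 * Z))).
  by field; rewrite gt_eqF.
rewrite ler_pM2l ?mulr_gt0// -[C * X * _]mulrA -mulrDr ler_pM2l//.
have -> : b * rm * h ^+ 3 * Z = X * h ^+ 3 + b * rm * h ^+ 3 * (expR (- (c / b)) * expR (2 * (mu%:R * b)) / h ^+ 7).
  by rewrite /Z /X; ring.
have : Y <= 3 * (b * rm * h ^+ 3 * (expR (- (c / b)) * expR (2 * (mu%:R * b)) / h ^+ 7)).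
  have rmE : rm * expR (2 * (mu%:R * b)) = expR (mu%:R * b).
    by rewrite /rm -expRM_natl -expRD; congr expR; ring.
  have -> : b * rm * h ^+ 3 * (expR (- (c / b)) * expR (2 * (mu%:R * b)) / h ^+ 7) =
     expR (- (c / b)) * (rm * expR (2 * (mu%:R * b))) * (b * h ^+ 3 / h ^+ 7) by ring.
  rewrite rmE; have -> : b * h ^+ 3 / h ^+ 7 = b^-1 by rewrite -hb; field; rewrite gt_eqF.
  rewrite -mulrA -/Y; lra.
lra.
Qed.

End Assembly.

Lemma sech_profileE (R : realType) (b : R) (m : int) :
  b / 4 * sech (b * m%:~R / 2) ^+ 2 = sech_profile b `|m|%N.
Proof.
have sechN (x : R) : sech (- x) = sech x by rewrite /sech opprK addrC.
have -> : sech (b * m%:~R / 2) = sech (`|m|%N%:R * b / 2).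
  rewrite natr_absz; case: (ger0P m) => _; first by congr sech; ring.
  by rewrite -sechN mulrNz; congr sech; ring.
rewrite /sech_profile /sech; set x := _ * b.
have -> : expR x = expR (x / 2) ^+ 2 by rewrite -expRM_natl; congr expR; field.
rewrite expRN; have := expR_gt0 (x / 2); move: (expR (x / 2)) => u u0.
by field; rewrite !gt_eqF// ?addr_gt0// ?exprn_gt0// mulr_gt0.
Qed.

(** In the given range exp(6 m b) <= n = O(h^(-4)).  Thus exp(- c / b) beats the other
    factors of the last term, and m h^3 <= 1.  If g^3 = max(m, 1), the latter
    reads (g h)^3 <= 1, whence m h^3 <= (g h)^3 <= g h. *)
Lemma error_terms_le (R : realType) (c : R) : 0 < c -> exists2 D : R, 0 < D &
  forall n m (b h : R), (0 < n)%N -> 0 < h <= 1 / 10 -> h ^+ 2 = b ->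
  n%:R * b ^+ 2 = pi ^+ 2 / 6 -> m%:R * b <= ln n%:R / 6 ->
  h + m%:R * h ^+ 3 + expR (- (c / b)) * expR (2 * (m%:R * b)) / h ^+ 7 <=
  D * (h * Num.max m%:R 1 `^ (1 / 3)).
Proof.
move=> c0; pose F : R := 6`!%:R; have F0 : 0 < F by rewrite ltr0n fact_gt0.
have FE : F = 6`!%:R by []; clearbody F.
have c6 : 0 < c ^+ 6 by rewrite exprn_gt0.
have D0 : 0 < 3 * F / c ^+ 6 by rewrite divr_gt0// mulr_gt0.
exists (2 + 3 * F / c ^+ 6); first by rewrite addr_gt0.
move=> n m b h n0 /andP[h0 h1] hb nb mb.
have b0 : 0 < b by rewrite -hb exprn_gt0.
have nR : 0 < n%:R :> R by rewrite ltr0n.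
have h4 : 0 < h ^+ 4 by rewrite exprn_gt0.
have b2 : b ^+ 2 = h ^+ 4 by rewrite -hb -exprM.
have n3 : n%:R <= 3 / h ^+ 4.
  rewrite ler_pdivlMr// -b2 nb; have := @pihalf_lt2 R; have := @pi_gt0 R; nra.
have mb0 : 0 <= m%:R * b by rewrite mulr_ge0// ltW.
have e6 : expR (6 * (m%:R * b)) <= 3 / h ^+ 4.
  apply: le_trans n3; rewrite -[leRHS]lnK ?posrE// ler_expR; lra.
have mh : m%:R * h ^+ 3 <= 1.
  (* The fourth power of 6 m b is at most 24 exp(6 m b), hence O(h^(-4)). *)
  have p4 := @expR_ge_pow R (6 * (m%:R * b)) 4 (mulr_ge0 (ler0n _ 6) mb0).
  have : (6 * (m%:R * b)) ^+ 4 <= 24 * (3 / h ^+ 4).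
    by apply: le_trans p4 _; rewrite ler_pM2l.
  rewrite [24 * _]mulrA ler_pdivlMr// -exprMn => q4.
  have : 6 * (m%:R * b) * h <= 3.
    rewrite -(@ler_pXn2r _ 4%N) ?nnegrE//; last by rewrite mulr_ge0 ?(ltW h0)// mulr_ge0.
    by apply: le_trans q4 _; lra.
  have -> : 6 * (m%:R * b) * h = 6 * (m%:R * h ^+ 3) by rewrite -hb; ring.
  lra.
set M := Num.max _ _; have M1 : 1 <= M by rewrite le_max lexx orbT.
have Mm : m%:R <= M by rewrite le_max lexx.
set g := M `^ (1 / 3).
have g3 : g ^+ 3 = M.
  rewrite /g -powR_mulrn ?powR_ge0// -powRrM.
  by have -> : 1 / 3 * 3 = 1 :> R by [field]; rewrite powRr1//; lra.
have g1 : 1 <= g.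
  rewrite leNgt; apply/negP => g1.
  have : g ^+ 3 < 1 by rewrite exprn_ilt1// powR_ge0.
  by rewrite g3; lra.
have hg : h <= h * g by rewrite ler_peMr// ltW.
have Mh : M * h ^+ 3 <= 1.
  rewrite /M; case: (lerP m%:R 1) => _ //; rewrite mul1r.
  by rewrite exprn_ile1 ?(ltW h0)//; lra.
have g0 : 0 <= g by lra.
have gh1 : g * h <= 1.
  rewrite -(@ler_pXn2r _ 3%N) ?nnegrE//; last by rewrite mulr_ge0 ?(ltW h0).
  by rewrite exprMn g3 expr1n.
have hg0 : 0 < h * g by rewrite mulr_gt0//; lra.
have T2 : m%:R * h ^+ 3 <= h * g.
  apply: le_trans (_ : M * h ^+ 3 <= _).
    by rewrite ler_wpM2r// exprn_ge0// ltW.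
  rewrite -g3 -exprMn mulrC exprS ler_piMr ?(ltW hg0)//.
  by rewrite exprn_ile1 ?(ltW hg0)//; rewrite mulrC.
have T3 : expR (- (c / b)) * expR (2 * (m%:R * b)) / h ^+ 7 <= 3 * F / c ^+ 6 * h.
  have p6 := @expR_ge_pow R (c / b) 6 (ltW (divr_gt0 c0 b0)); rewrite -FE in p6.
  have cb6 : 0 < (c / b) ^+ 6 by rewrite exprn_gt0// divr_gt0.
  have e1 : expR (- (c / b)) <= F / (c / b) ^+ 6.
    by rewrite expRN ler_pdivlMr// mulrC ler_pdivrMr ?expR_gt0.
  have e2 : expR (2 * (m%:R * b)) <= 3 / h ^+ 4.
    apply: le_trans e6; rewrite ler_expR; lra.
  apply: le_trans (_ : F / (c / b) ^+ 6 * (3 / h ^+ 4) / h ^+ 7 <= _).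
    rewrite ler_pM2r ?invr_gt0 ?exprn_gt0//.
    by apply: ler_pM => //; exact: expR_ge0.
  by rewrite -hb le_eqVlt; apply/orP; left; apply/eqP; field; rewrite !gt_eqF.
have : 3 * F / c ^+ 6 * h <= 3 * F / c ^+ 6 * (h * g) by rewrite ler_pM2l.
lra.
Qed.

Local Close Scope complex_scope.

(* The O-term is uniform in m.  In it |m| is read as max(|m|, 1): this only
   matters for m = 0, where a zero error would force the integer N(0, n) to
   equal beta / 4 * p(n), which is impossible since pi ^ 2 is irrational. *)
Theorem theorem1p2 (R : realType) :
  exists (C : R) (n0 : nat), forall (n : nat) (m : int),
    (n0 <= n)%N ->
    `|m%:~R| <= Num.sqrt n%:R * ln n%:R / (pi * Num.sqrt 6) :> R ->
    exists2 e : R,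
      `|e| <= C * (beta R n `^ (1 / 2) * Num.max `|m%:~R| 1 `^ (1 / 3)) &
      (N m n)%:R
        = beta R n / 4 * sech (beta R n * m%:~R / 2) ^+ 2 * (p n)%:R * (1 + e).
Proof.
have [c c0 [C C0 [h0 h0_gt0 H]]] := N_relative_error R.
have [D D0 HD] := error_terms_le c0.
pose h1 := Num.min h0 (1 / 10).
have h1_gt0 : 0 < h1 by rewrite lt_min h0_gt0; lra.
exists (C * D), (Num.bound (3 / h1 ^+ 4)).+1 => n m nn0 mn.
have n0 : (0 < n)%N by apply: leq_trans nn0.
have nR : 0 < n%:R :> R by rewrite ltr0n.
set b := beta R n.
have s6 : 0 < Num.sqrt 6 :> R by rewrite sqrtr_gt0.
have sn : 0 < Num.sqrt n%:R :> R by rewrite sqrtr_gt0.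
have bE : b = pi / (Num.sqrt 6 * Num.sqrt n%:R) by rewrite /b /beta sqrtrM.
have b0 : 0 < b by rewrite bE divr_gt0 ?pi_gt0// mulr_gt0.
have s62 : Num.sqrt 6 ^+ 2 = 6 :> R by rewrite sqr_sqrtr.
have sn2 : Num.sqrt n%:R ^+ 2 = n%:R :> R by rewrite sqr_sqrtr.
have nb : n%:R * b ^+ 2 = pi ^+ 2 / 6.
  by rewrite bE exprMn exprVn exprMn s62 sn2; field; rewrite gt_eqF.
have hb : Num.sqrt b ^+ 2 = b by rewrite sqr_sqrtr// ltW.
have h_gt0 : 0 < Num.sqrt b by rewrite sqrtr_gt0.
set h := Num.sqrt b in hb h_gt0.
have hh1 : h <= h1.
  rewrite -(@ler_pXn2r _ 4%N) ?nnegrE ?(ltW h_gt0) ?(ltW h1_gt0)//.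
  have -> : h ^+ 4 = b ^+ 2 by rewrite -hb -exprM.
  have -> : b ^+ 2 = pi ^+ 2 / 6 / n%:R by rewrite -nb mulrC mulKf// gt_eqF.
  rewrite ler_pdivrMr//; apply: le_trans (_ : 3 <= _).
    by have := @pihalf_lt2 R; have := @pi_gt0 R; nra.
  have h14 : 0 < h1 ^+ 4 by rewrite exprn_gt0.
  rewrite mulrC -ler_pdivrMr//; apply: le_trans (ltW (archi_boundP _)) _.
    by rewrite divr_ge0// ltW.
  by rewrite ler_nat; exact: ltnW.
move: hh1; rewrite le_min => /andP[hh0 hh1].
have mE : `|m%:~R| = `|m|%N%:R :> R by rewrite -intr_norm.
have mb : `|m|%N%:R * b <= ln n%:R / 6.
  apply: le_trans (_ : Num.sqrt n%:R * ln n%:R / (pi * Num.sqrt 6) * b <= _).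
    by rewrite ler_pM2r// -mE.
  rewrite bE; have -> : Num.sqrt n%:R * ln n%:R / (pi * Num.sqrt 6) * (pi / (Num.sqrt 6 * Num.sqrt n%:R))
     = ln n%:R / Num.sqrt 6 ^+ 2 :> R.
    have := @pi_gt0 R; move: (@pi R) => P P0; field; by rewrite !gt_eqF.
  by rewrite s62.
have hh : 0 < h <= h0 by rewrite h_gt0.
have [e eC eN] := H n m b h hh hb nb.
exists e; last by rewrite sech_profileE.
have hh' : 0 < h <= 1 / 10 by rewrite h_gt0.
have E := HD n `|m|%N b h n0 hh' hb nb mb.
have -> : b `^ (1 / 2) = h by rewrite div1r powR12_sqrt// ltW.
by rewrite mE -(mulrA C); apply: le_trans eC _; rewrite ler_pM2l.
Qed.
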